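(* Let $(M,g)$ be a Riemannian manifold, let $\pi:P\to M$ be an $S^1$-principal bundle equipped with a connection $1$-form $\varphi$, and let $c:[0,L]\to M$ be a smooth Jordan curve parametrized by arc length. Then the total space of the pullback bundle $c^*P$ is a torus, and it is endowed with a complex structure naturally induced by the connection $\varphi$ and the Riemannian metric $g$. Moreover, with this complex structure the total space $c^*P$ is biholomorphic to $\mathbb{C}/\Lambda$, where $$\Lambda = 2\pi\mathbb{Z} + (-\alpha+iL)\mathbb{Z}$$ and $\alpha$ is the angle of holonomy of $c$.
   Context: Everything is smooth. A torus is a manifold diffeomorphic to $S^1\times S^1$. $S^1$ acts on $P$ on the right, and $\partial_\theta$ is the vertical vector field $\partial_\theta(p)=\frac{d}{d\theta}\big|_{\theta=0}\, p\cdot e^{i\theta}$. A connection $1$-form is a real $1$-form $\varphi\in\Omega^1(P)$ with $\varphi(\partial_\theta)=1$ which is invariant under the right action $R_z(p)=p\cdot z$, i.e. $\varphi_{pz}(dR_z(X))=\varphi_p(X)$ for $z\in S^1$, $X\in T_pP$. The horizontal bundle is $\ker\varphi$. A smooth Jordan curve $c:[0,L]\to M$ is a simple closed curve whose $L$-periodic extension to $\mathbb{R}$ is smooth. A $\varphi$-horizontal lift of $c$ is a curve $\eta:[0,L]\to P$ with $\pi\circ\eta=c$ and $\varphi(\eta')=0$. The angle of holonomy of $c$ is the real number $\alpha$ (determined modulo $2\pi$) such that $\eta(L)=\eta(0)\cdot e^{i\alpha}$ for a $\varphi$-horizontal lift $\eta$ of $c$; $e^{i\alpha}$ is the holonomy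 of $c$. The total space $c^*P$ (the pullback over the circle $\mathbb{R}/L\mathbb{Z}$) is identified with $\pi^{-1}(c([0,L]))\subset P$. The complex structure $J$ on it induced by $\varphi$ and $g$ is the one given by $J\partial_\theta=\widetilde{c'}$, $J\widetilde{c'}=-\partial_\theta$, where $\widetilde{c'}$ is the $\varphi$-horizontal lift of the unit tangent vector field $c'$; that is, the complex structure for which $s_1+is_2\mapsto \eta(s_2)\cdot e^{is_1}$ is locally biholomorphic, where $\eta$ is extended to a horizontal lift on $\mathbb{R}$ of the periodic extension of $c$. *)

(* Defs.v *)
From HB Require Import structures.
From mathcomp Require Import all_boot all_order all_algebra ring_quotient.
From mathcomp Require Import all_classical all_reals all_analysis.
From mathcomp Require Import complex.

Set Implicit Arguments.
Unset Strict Implicit.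
Unset Printing Implicit Defensive.

Import Order.TTheory GRing.Theory Num.Theory.
Import numFieldNormedType.Exports.

Local Open Scope classical_set_scope.
Local Open Scope ring_scope.
Local Open Scope complex_scope.

(* Only used for finite-dimensional [V], where continuity of all iterated
   directional derivatives up to order [k] is the usual notion of class C^k. *)
Fixpoint Ck (K : numFieldType) (V W : normedModType K) (k : nat) (U : set V)
    (f : V -> W) : Prop :=
  (forall u, U u -> {for u, continuous f}) /\
  (if k is k'.+1 then
     (forall u v, U u -> derivable f u v) /\ (forall v, Ck k' U ('D_v f))
   else True).

Definition smooth_on (K : numFieldType) (V W : normedModType K) (U : set V)
    (f : V -> W) : Prop :=
  forall k, Ck k U f.

(* Elements of C are complex numbers with the normed topology, and derivability
   of maps C -> C is over the scalar field R[i], i.e. complex derivability. *)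
Notation C R := ((complex R)^o).

Definition holomorphic_on (R : realType) (U : set (C R)) (f : C R -> C R) :
    Prop :=
  forall z, U z -> derivable f z 1.

(* A chart carries a total map and a total inverse; only the values of [cmap] on
   [cdom] and of [cinv] on the image [cim] are meaningful. *)
Record chart (T E : Type) := Chart {
  cdom : set T;
  cmap : T -> E;
  cinv : E -> T }.

Definition cim (T E : Type) (x : chart T E) : set E := cmap x @` cdom x.

Definition is_chart (T E : topologicalType) (x : chart T E) : Prop :=
  [/\ open (cdom x),
      open (cim x),
      forall p, cdom x p -> cinv x (cmap x p) = p,
      forall p, cdom x p -> {for p, continuous (cmap x)}
    & forall u, cim x u -> {for u, continuous (cinv x)}].

Section Manifolds.
Context (K : numFieldType).

(* [reg U f] is the regularity required of a map [f] on the open set [U] of the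
   model space: [@smooth_on _ _ _] for smooth manifolds,
   [@holomorphic_on _] for Riemann surfaces. *)
Definition is_manifold (T : topologicalType) (E : normedModType K)
    (reg : set E -> (E -> E) -> Prop) (A : set (chart T E)) : Prop :=
  [/\ hausdorff_space T, @second_countable T,
      forall x, A x -> is_chart x,
      forall p, exists2 x, A x & cdom x p
    & forall x y, A x -> A y ->
        reg (cmap x @` (cdom x `&` cdom y)) (cmap y \o cinv x)].

Definition morphism_on (T T' : topologicalType) (E E' : normedModType K)
    (reg : set E -> (E -> E') -> Prop)
    (A : set (chart T E)) (A' : set (chart T' E')) (U : set T) (f : T -> T') :
    Prop :=
  (forall p, U p -> {for p, continuous f}) /\
  (forall x y, A x -> A' y ->
     reg (cmap x @` (U `&` cdom x `&` f @^-1` cdom y))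
         (cmap y \o f \o cinv x)).

Definition isomorphic (T T' : topologicalType) (E : normedModType K)
    (reg : set E -> (E -> E) -> Prop)
    (A : set (chart T E)) (A' : set (chart T' E)) : Prop :=
  [/\ is_manifold reg A, is_manifold reg A'
    & exists f : T -> T', exists g : T' -> T,
      [/\ cancel f g, cancel g f,
          morphism_on reg A A' setT f & morphism_on reg A' A setT g]].

Definition model_atlas (E : normedModType K) : set (chart E E) :=
  [set Chart setT id id].

Definition prod_chart (T T' : Type) (E E' : Type)
    (x : chart T E) (y : chart T' E') : chart (T * T') (E * E') :=
  Chart (cdom x `*` cdom y)
        (fun p => (cmap x p.1, cmap y p.2))
        (fun u => (cinv x u.1, cinv y u.2)).

Definition prod_atlas (T T' : Type) (E E' : Type)
    (A : set (chart T E)) (A' : set (chart T' E')) :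
    set (chart (T * T') (E * E')) :=
  [set z | exists x y, [/\ A x, A' y & z = prod_chart x y]].

(* The charts of the quotient of E by a covering map q : E -> T are the
   continuous local sections of q. *)
Definition section_atlas (T E : topologicalType) (q : E -> T) :
    set (chart T E) :=
  [set x | is_chart x /\ forall u, cim x u -> cinv x u = q u].

(* The (maximal) atlas of a subset S of a smooth manifold: the homeomorphisms x
   from an open subset of S onto an open subset of F such that x^-1 is smooth as
   a map into the ambient manifold and x is locally the restriction of a smooth
   map defined on an open subset of the ambient manifold.  S is an embedded
   submanifold exactly when these charts cover S. *)
Definition submanifold_atlas (T : topologicalType) (E F : normedModType K)
    (A : set (chart T E)) (S : set T) : set (chart S F) :=
  [set x | [/\ is_chart x,
      morphism_on (@smooth_on _ F E) (@model_atlas F) A (cim x)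
        (fun u => set_val (cinv x u))
    & forall p, cdom x p -> exists W : set T, exists h : T -> F,
        [/\ open W, W (set_val p),
            morphism_on (@smooth_on _ E F) A (@model_atlas F) W h
          & forall q, cdom x q -> W (set_val q) -> cmap x q = h (set_val q)]]].

End Manifolds.

(* A tangent vector at p is given, in each chart at p, by a vector of the model
   space; the chart representatives are related by the derivatives of the
   changes of charts.  Accordingly a tensor field is given by its components
   [t x p] in each chart [x] of the atlas and at each point [p] of [cdom x]
   (other values are irrelevant). *)

Section Tensors.
Context (R : realType).

(* The differential of f at p in the charts x at p and y at f p. *)
Definition dmap (T T' : Type) (E E' : normedModType R)
    (x : chart T E) (y : chart T' E') (f : T -> T') (p : T) (v : E) : E' :=
  'D_v (cmap y \o f \o cinv x) (cmap x p).

Definition velocity (T : Type) (E : normedModType R) (x : chart T E)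
    (gamma : R -> T) (t : R) : E :=
  derive1 (cmap x \o gamma) t.

Definition is_one_form (T : topologicalType) (E : normedModType R)
    (A : set (chart T E)) (phi : chart T E -> T -> E -> R) : Prop :=
  [/\ forall x p a u v, A x -> cdom x p ->
        phi x p (a *: u + v) = a * phi x p u + phi x p v,
      forall x y p v, A x -> A y -> cdom x p -> cdom y p ->
        phi y p (dmap x y id p v) = phi x p v
    & forall x v, A x -> smooth_on (cim x) (fun u => phi x (cinv x u) v)].

Definition is_riemannian_metric (T : topologicalType) (E : normedModType R)
    (A : set (chart T E)) (g : chart T E -> T -> E -> E -> R) : Prop :=
  [/\ forall x p a u v w, A x -> cdom x p ->
        g x p (a *: u + v) w = a * g x p u w + g x p v w,
      forall x p u v, A x -> cdom x p -> g x p u v = g x p v u,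
      forall x p v, A x -> cdom x p -> v != 0 -> 0 < g x p v v,
      forall x y p u v, A x -> A y -> cdom x p -> cdom y p ->
        g y p (dmap x y id p u) (dmap x y id p v) = g x p u v
    & forall x u v, A x -> smooth_on (cim x) (fun w => g x (cinv x w) u v)].

Definition is_almost_complex (T : topologicalType) (E : normedModType R)
    (A : set (chart T E)) (J : chart T E -> T -> E -> E) : Prop :=
  [/\ forall x p a u v, A x -> cdom x p ->
        J x p (a *: u + v) = a *: J x p u + J x p v,
      forall x p v, A x -> cdom x p -> J x p (J x p v) = - v,
      forall x y p v, A x -> A y -> cdom x p -> cdom y p ->
        J y p (dmap x y id p v) = dmap x y id p (J x p v)
    & forall x v, A x -> smooth_on (cim x) (fun u => J x (cinv x u) v)].

Definition realify (T : Type) (x : chart T (C R)) : chart T (R * R)%type :=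
  Chart (cdom x)
        (fun p => (complex.Re (cmap x p), complex.Im (cmap x p)))
        (fun u => cinv x (u.1 +i* u.2)).

(* The J-holomorphic charts, i.e. the complex-valued smooth charts in which J is
   the multiplication by i.  The atlas A is meant to be maximal. *)
Definition holo_atlas (T : topologicalType)
    (A : set (chart T (R * R)%type))
    (J : chart T (R * R)%type -> T -> R * R -> R * R) : set (chart T (C R)) :=
  [set x | A (realify x) /\
     forall p v, cdom x p -> J (realify x) p v = (- v.2, v.1)].

Definition is_complex_structure (T : topologicalType)
    (A : set (chart T (R * R)%type))
    (J : chart T (R * R)%type -> T -> R * R -> R * R) : Prop :=
  is_almost_complex A J /\
  is_manifold (@holomorphic_on R) (holo_atlas A J).

End Tensors.

Section Circle.
Context (R : realType).

Definition S1_set : set (C R) := [set z | `|z| = 1].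
Definition S1 : topologicalType := set_type S1_set.

Lemma S1_oneP : (1 : C R) \in S1_set.
Proof. by rewrite inE /S1_set/= normr1. Qed.

Lemma S1_mulP (z w : S1) : (set_val z * set_val w : C R) \in S1_set.
Proof.
by rewrite inE /S1_set/= normrM (set_valP z) (set_valP w) mulr1.
Qed.

Lemma S1_expiP (t : R) : (cos t +i* sin t : C R) \in S1_set.
Proof.
by rewrite inE /S1_set/= normc_def/= cos2Dsin2 sqrtr1.
Qed.

Definition S1_one : S1 := SigSub S1_oneP.
Definition S1_mul (z w : S1) : S1 := SigSub (S1_mulP z w).
Definition expi (t : R) : S1 := SigSub (S1_expiP t).

Definition S1_atlas : set (chart S1 R) := section_atlas expi.

Definition is_torus (T : topologicalType) (A : set (chart T (R * R)%type)) :
    Prop :=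
  isomorphic (@smooth_on _ _ _) A (prod_atlas S1_atlas S1_atlas).

Definition lattice (w1 w2 : C R) : {pred C R} :=
  fun z => `[< exists m n : int, z = w1 *~ m + w2 *~ n >].

Lemma lattice_zmod_closed (w1 w2 : C R) : zmod_closed (lattice w1 w2).
Proof.
split; first by apply/asboolP; exists 0, 0; rewrite !mulr0z addr0.
move=> _ _ /asboolP[m [n ->]] /asboolP[m' [n' ->]].
by apply/asboolP; exists (m - m'), (n - n'); rewrite !mulrzBr opprD addrACA.
Qed.

HB.instance Definition _ (w1 w2 : C R) :=
  GRing.isZmodClosed.Build (C R) (lattice w1 w2) (lattice_zmod_closed w1 w2).

Definition C_mod (w1 w2 : C R) : topologicalType :=
  quotient_topology (@Quotient.quot (C R) (lattice w1 w2)).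

Definition C_mod_atlas (w1 w2 : C R) : set (chart (C_mod w1 w2) (C R)) :=
  section_atlas (\pi_(quotient_topology (@Quotient.quot (C R) (lattice w1 w2))))%qT.

End Circle.

Section Bundles.
Context (R : realType) (M P : topologicalType) (E F : normedModType R).
Variables (AM : set (chart M E)) (AP : set (chart P F)).
Variables (prj : P -> M) (act : P -> S1 R -> P).

Definition is_principal_S1_bundle : Prop :=
  [/\ morphism_on (@smooth_on _ _ _) AP AM setT prj,
      morphism_on (@smooth_on _ _ _) (prod_atlas AP (@S1_atlas R)) AP setT
        (fun pz => act pz.1 pz.2),
      (forall p, act p (S1_one R) = p) /\
      (forall p z w, act (act p z) w = act p (S1_mul z w)),
      (forall p z, prj (act p z) = prj p)
    & forall m, exists U : set M, exists Phi : P -> M * S1 R,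
      exists Psi : M * S1 R -> P,
      [/\ open U, U m,
          morphism_on (@smooth_on _ _ _) AP (prod_atlas AM (@S1_atlas R))
            (prj @^-1` U) Phi,
          morphism_on (@smooth_on _ _ _) (prod_atlas AM (@S1_atlas R)) AP
            (U `*` setT) Psi
        & [/\ forall p, U (prj p) -> (Phi p).1 = prj p,
              forall p, U (prj p) -> Psi (Phi p) = p,
              forall q z, U q -> prj (Psi (q, z)) = q /\
                                 Phi (Psi (q, z)) = (q, z)
            & forall p w, U (prj p) ->
                Phi (act p w) = (prj p, S1_mul (Phi p).2 w)]]].

Definition is_connection (phi : chart P F -> P -> F -> R) : Prop :=
  [/\ is_one_form AP phi,
      forall x p, AP x -> cdom x p ->
        phi x p (velocity x (fun t => act p (expi t)) 0) = 1
    & forall x y p z v, AP x -> AP y -> cdom x p -> cdom y (act p z) ->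
        phi y (act p z) (dmap x y (act^~ z) p v) = phi x p v].

(* A smooth Jordan curve [0, L] -> M is represented by its L-periodic
   extension. *)
Definition is_smooth_jordan_curve (L : R) (c : R -> M) : Prop :=
  [/\ 0 < L,
      forall t, c (t + L) = c t,
      forall s t, 0 <= s < L -> 0 <= t < L -> c s = c t -> s = t
    & morphism_on (@smooth_on _ _ _) (@model_atlas _ R) AM setT c].

Definition is_unit_speed (g : chart M E -> M -> E -> E -> R) (c : R -> M) :
    Prop :=
  forall x t, AM x -> cdom x (c t) ->
    g x (c t) (velocity x c t) (velocity x c t) = 1.

(* A smooth curve on [0, L] is given by a smooth extension to R, of which only
   the restriction to [0, L] is constrained. *)
Definition is_horizontal_lift (phi : chart P F -> P -> F -> R) (L : R)
    (c : R -> M) (eta : R -> P) : Prop :=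
  [/\ morphism_on (@smooth_on _ _ _) (@model_atlas _ R) AP setT eta,
      forall t, 0 <= t <= L -> prj (eta t) = c t
    & forall x t, 0 <= t <= L -> AP x -> cdom x (eta t) ->
        phi x (eta t) (velocity x eta t) = 0].

Definition is_holonomy_angle (phi : chart P F -> P -> F -> R) (L : R)
    (c : R -> M) (alpha : R) : Prop :=
  exists2 eta, is_horizontal_lift phi L c eta
    & eta L = act (eta 0) (expi alpha).

Definition pullback_space (L : R) (c : R -> M) : set P :=
  prj @^-1` (c @` [set t | 0 <= t <= L]).

Definition pullback_atlas (L : R) (c : R -> M) :
    set (chart (pullback_space L c) (R * R)%type) :=
  submanifold_atlas AP (S := pullback_space L c).
Arguments pullback_atlas L c : clear implicits.

(* J d_theta = h and J h = - d_theta, where the tangent vectors v = d_theta and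
   h = horizontal lift of c' of the total space at p are characterized by their
   images under the differentials of the inclusion into P and of the
   projection. *)
Definition is_induced_structure (phi : chart P F -> P -> F -> R) (L : R)
    (c : R -> M)
    (J : chart (pullback_space L c) (R * R)%type -> pullback_space L c ->
         R * R -> R * R) : Prop :=
  forall x p t, pullback_atlas L c x -> cdom x p ->
    prj (set_val p) = c t ->
    exists v h : R * R,
      [/\ forall y, AP y -> cdom y (set_val p) ->
            dmap x y set_val p v =
            velocity y (fun s => act (set_val p) (expi s)) 0,
          forall y, AM y -> cdom y (c t) ->
            dmap x y (prj \o set_val) p h = velocity y c t,
          forall y, AP y -> cdom y (set_val p) ->
            phi y (set_val p) (dmap x y set_val p h) = 0,
          J x p v = h
        & J x p h = - v].

End Bundles.

Arguments pullback_atlas {R M P F} AP prj L c.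

(* Main.v *)
Require Import Defs.
From HB Require Import structures.
From mathcomp Require Import all_boot all_order all_algebra ring_quotient.
From mathcomp Require Import all_classical all_reals all_analysis.
From mathcomp Require Import complex.
From mathcomp Require Import ring lra.

(** Let [eta : R -> P] be a horizontal lift of the periodic extension of [c], and
    put [Q u = eta u.2 * e^{i u.1}] (the map [param]).  Everything follows from
    three properties of this map from the plane to the total space of the pullback.

    It is onto, since the circle acts transitively on the fibres.

    Its fibres are the cosets of Lambda.  If [Q u = Q v] then [c] takes the same
    value at [u.2] and [v.2], so these differ by [n L] for an integer [n], because
    [c] is a Jordan curve.  By uniqueness of horizontal lifts, [eta (t + n L)] is
    [eta t] rotated by [n alpha]; as the action is free, [u.1 - v.1] is then
    [- n alpha] up to a multiple of [2 pi] ([param_eq]).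

    It is a local diffeomorphism onto an embedded surface
    ([pullback_local_charts]).  Unit speed makes [c] an immersion, and [c] is
    injective on a compact circle, so [c] has local smooth left inverses defined on
    [M] ([jordan_left_inverse]).  Near a point this recovers [u.2] from the
    projection to [M], and then [u.1] from the angle relative to [eta] in a
    trivialization ([param_left_inverse]).

    Hence the total space is the quotient of the plane by Lambda, with local
    sections of [Q] as charts.  Any two of these differ by a translation, so the
    multiplication by [i] of the plane descends to a complex structure for which
    [Q] induces a biholomorphism from [C / Lambda]; holomorphic charts are
    recognized by the Cauchy-Riemann equations.  A real-linear map taking Lambda to
    [2 pi Z^2] gives the diffeomorphism with the torus.  This part is done for an
    arbitrary surface with such a map, in the section [ParametrizedSurface].

    The partial derivatives of [Q] are the vertical field and the horizontal lift
    of [c'], so [J] is the structure induced by the connection.  Uniqueness of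
    [J] holds because the inclusion into [P], the projection to [M] and the
    connection form determine these two vectors, which form a basis.

    The lift [eta] comes from solving a first order equation for the angle in a
    trivialization, where an integral suffices since the circle is abelian
    ([local_lift]), and from continuing the local solutions ([global_lift]). *)

Set Implicit Arguments.
Unset Strict Implicit.
Unset Printing Implicit Defensive.

Import Order.TTheory GRing.Theory Num.Theory.
Import numFieldNormedType.Exports.

Local Open Scope classical_set_scope.
Local Open Scope ring_scope.
Local Open Scope complex_scope.

(** * Calculus in finite dimension *)

Section Findim.
Context {R : realType}.

(** Smoothness is tested on directional derivatives only; coordinates are what
    turns this into Frechet differentiability. *)
Class findim (V : normedModType R) : Prop := Findim {
  findimP : exists m (e : 'I_m -> V) (l : 'I_m -> {linear V -> R}),
    (forall i, continuous (l i)) /\ forall v, v = \sum_i l i v *: e i }.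

#[global] Instance findim_real : findim R.
Proof.
split; exists 1, (fun=> 1), (fun=> idfun); split; first by move=> i x.
by move=> v; rewrite big_ord1 [RHS]mulr1.
Qed.

#[global] Instance findim_rV n : findim 'rV[R]_n.
Proof.
have lin (i : 'I_n) : linear (fun v : 'rV[R]_n => v ord0 i : R).
  by move=> a u v; rewrite !mxE.
pose l i : {linear 'rV[R]_n -> R} := HB.pack (fun v : 'rV[R]_n => v ord0 i : R)
  (GRing.isLinear.Build _ _ _ _ _ (lin i)).
split; exists n, (fun i => delta_mx ord0 i), l; split.
  by move=> i; exact: coord_continuous.
by move=> v; rewrite [LHS]row_sum_delta.
Qed.

#[global] Instance findim_prod (V W : normedModType R) :
  findim V -> findim W -> findim (V * W)%type.
Proof.
move=> [[m [e [l [cl el]]]]] [[n [e' [l' [cl' el']]]]].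
have lin1 i : linear (fun v : V * W => l i v.1).
  by move=> a u v; rewrite /= linearP.
have lin2 i : linear (fun v : V * W => l' i v.2).
  by move=> a u v; rewrite /= linearP.
pose L1 i : {linear (V * W)%type -> R} := HB.pack (fun v : V * W => l i v.1)
  (GRing.isLinear.Build _ _ _ _ _ (lin1 i)).
pose L2 i : {linear (V * W)%type -> R} := HB.pack (fun v : V * W => l' i v.2)
  (GRing.isLinear.Build _ _ _ _ _ (lin2 i)).
split; exists (m + n)%N,
  (fun i => match fintype.split i with inl j => (e j, 0) | inr j => (0, e' j) end),
  (fun i => match fintype.split i with inl j => L1 j | inr j => L2 j end); split.
  move=> i; case: (fintype.split i) => j x /=.
    by apply: (@continuous_comp _ _ _ fst (l j)); [exact: cvg_fst|exact: cl].
  by apply: (@continuous_comp _ _ _ snd (l' j)); [exact: cvg_snd|exact: cl'].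
move=> v; rewrite big_split_ord /=.
under eq_bigr do rewrite (unsplitK (inl _)).
under [X in _ + X]eq_bigr do rewrite (unsplitK (inr _)).
rewrite [LHS]surjective_pairing; congr pair.
  rewrite /= !raddf_sum /= [X in _ + X]big1 ?addr0; last by move=> *; rewrite scaler0.
  by rewrite -el.
rewrite /= !raddf_sum /= [X in X + _]big1 ?add0r; last by move=> *; rewrite scaler0.
by rewrite -el'.
Qed.

End Findim.

Section Differentiability.
Context {R : realType}.

Lemma differentiable_at (V W : normedModType R) (f : V -> W) x
    (df : {linear V -> W}) : continuous df ->
    (forall e, 0 < e ->
      \forall h \near 0, `|f (h + x) - (f x + df h)| <= e * `|h|) ->
  differentiable f x.
Proof.
move=> dfc dfP.
have dxf : f \o shift x = cst (f x) + df +o_ 0 id by apply/eqaddoP => e /dfP.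
by apply/diff_locallyP; rewrite (diff_unique dfc dxf).
Qed.

Lemma is_derive_line (V W : normedModType R) (f : V -> W) (a v : V) (t : R) :
  derivable f (a + t *: v) v ->
  is_derive t 1 (fun s => f (a + s *: v)) ('D_v f (a + t *: v)).
Proof.
have E : (fun h : R => h^-1 *: (((fun s => f (a + s *: v)) \o shift t) (h *: 1)
          - f (a + t *: v))) =
         (fun h => h^-1 *: ((f \o shift (a + t *: v)) (h *: v) - f (a + t *: v))).
  apply/funext => h /=; congr (_ *: (f _ - _)).
  by rewrite [h *: 1]mulr1 scalerDl addrCA.
by move=> df; split; rewrite /derivable /derive E.
Qed.

Lemma mean_value_line (V : normedModType R) (f : V -> R) (a v : V) (s d e : R) :
  (forall t : R, `|t| <= `|s| -> derivable f (a + t *: v) v) ->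
  (forall t : R, `|t| <= `|s| -> `|'D_v f (a + t *: v) - d| <= e) ->
  `|f (a + s *: v) - f a - s * d| <= e * `|s|.
Proof.
move=> df dd.
pose F t := f (a + (t * s) *: v) - (t * s) * d.
have sub (t : R) : t \in `[0, 1] -> `|t * s| <= `|s|.
  rewrite in_itv /= => /andP[t0 t1].
  by rewrite normrM ger0_norm // ler_piMl.
have dF (t : R) : t \in `[0, 1] -> is_derive t 1 F (s * ('D_v f (a + (t * s) *: v) - d)).
  move=> /sub ts.
  have d1 := is_derive_line (df _ ts).
  have d2 : is_derive t (1:R) (fun t : R => t * s) s.
    change (is_derive t (1:R) ((@id R) * cst s) s).
    by apply: is_derive_eq; rewrite scaler0 add0r [_ *: _]mulr1.
  have d3 := @is_derive1_comp _ (fun x => f (a + x *: v)) (fun t => t * s) t _ _ d1 d2.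
  have d4 : is_derive t (1:R) (fun t : R => t * s * d) (d * s).
    change (is_derive t (1:R) ((fun t : R => t * s) * cst d) (d * s)).
    by apply: is_derive_eq; rewrite scaler0 add0r.
  have := @is_deriveB _ _ _ _ _ t 1 _ _ d3 d4.
  by rewrite -mulrBl mulrC.
have [c c01 ->] : exists2 c, c \in `[0, 1] &
    f (a + s *: v) - f a - s * d = s * ('D_v f (a + (c * s) *: v) - d).
  have cF : {within `[0, 1], continuous F}.
    apply: derivable_within_continuous => t t01.
    by have [] := dF t t01.
  have [c c01 E] := @MVT_segment R F _ 0 1 ler01
    (fun t t01 => dF t (subset_itv_oo_cc t01)) cF.
  exists c => //; move: E.
  by rewrite /F subr0 mulr1 !mul1r !mul0r scale0r addr0 subr0 => <-; rewrite addrAC.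
by rewrite normrM mulrC ler_wpM2r // dd // sub.
Qed.

(** Continuity of the partial derivatives controls the increments of [f] along
    one coordinate at a time; adding these increments gives the Frechet
    derivative. *)
Lemma differentiable_C1_real (V : normedModType R) {fV : findim V} (U : set V)
    (f : V -> R) u : open U -> Ck 1 U f -> U u -> differentiable f u.
Proof.
move=> oU [_ [df cdf]] Uu.
have [m [e [l [cl el]]]] := @findimP _ _ fV.
have lin : linear (fun v => \sum_i l i v * 'D_(e i) f u).
  move=> a x y; rewrite scaler_sumr -big_split /=; apply: eq_bigr => i _.
  by rewrite linearP mulrDl; congr (_ + _); exact: esym (mulrA _ _ _).
pose L : {linear V -> R} := HB.pack (fun v => \sum_i l i v * 'D_(e i) f u)
  (GRing.isLinear.Build _ _ _ _ _ lin).
apply: (@differentiable_at _ _ _ _ L).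
  move=> x; rewrite /continuous_at /L /=.
  apply: cvg_big => [|i _]; first exact: add_continuous.
  apply: cvgMr_tmp; exact: cl.
move=> eps eps0.
have [C C0 lC] : exists2 C, 0 < C & forall i v, `|l i v| <= C * `|v|.
  pose C i := sval (cid2 (linear_lipschitz (cl i))).
  have CP i : 0 < C i /\ forall v, `|l i v| <= C i * `|v|.
    by rewrite /C; case: cid2.
  exists (1 + \sum_i C i).
    by rewrite ltr_wpDr // sumr_ge0 // => i _; apply/ltW/(CP i).1.
  move=> i v; apply: (le_trans ((CP i).2 v)); rewrite ler_wpM2r //.
  rewrite (bigD1 i) //= addrCA lerDl addr_ge0 // sumr_ge0 // => j _.
  exact/ltW/(CP j).1.
pose B := 1 + \sum_i `|e i|.
have B0 : 0 < B by rewrite ltr_wpDr // sumr_ge0.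
pose D := C * (1 + m%:R).
have D0 : 0 < D by rewrite mulr_gt0 // ltr_wpDr.
have [d d0 dP] : exists2 d, 0 < d & forall v, `|v| < d -> U (u + v) /\
    forall i, `|'D_(e i) f (u + v) - 'D_(e i) f u| <= eps / D.
  have /nbhs0P : \forall w \near u, U w /\
      forall i, `|'D_(e i) f w - 'D_(e i) f u| <= eps / D.
    apply: filterI; first exact: open_nbhs_nbhs.
    apply: filter_forall => i.
    have := (cdf (e i)).1 u Uu; move/cvgrPdist_le => /(_ (eps / D)).
    rewrite divr_gt0 // => /(_ isT).
    by apply: filterS => w; rewrite distrC.
  move=> /nbhs_ballP[d /= d0 H]; exists d => // v vd; apply: H.
  by rewrite -ball_normE /= sub0r normrN.
near=> h.
have hd : C * B * `|h| < d.
  rewrite -ltr_pdivlMl ?mulr_gt0 //; near: h.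
  by apply: nbhs0_lt; rewrite mulr_gt0 // invr_gt0 mulr_gt0.
(* the coordinates are switched on one at a time *)
pose w k : V := \sum_(i < m | (i < k)%N) l i h *: e i.
have wS k (km : (k < m)%N) : w k.+1 = w k + l (Ordinal km) h *: e (Ordinal km).
  rewrite /w (bigD1 (Ordinal km)) //= addrC; congr (_ + _); apply: eq_bigl => i.
  by rewrite ltnS [RHS]ltn_neqAle andbC.
have main k : (k <= m)%N ->
  `|f (u + w k) - f u - \sum_(i < m | (i < k)%N) l i h * 'D_(e i) f u|
    <= k%:R * (eps / D * (C * `|h|)).
  elim: k => [_|k IH km].
    by rewrite /w !big_pred0_eq addr0 !subrr normr0 mul0r.
  rewrite wS (bigD1 (Ordinal km)) //=.
  rewrite (eq_bigl (fun i : 'I_m => (i < k)%N)); last first.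
    by move=> i; rewrite ltnS [RHS]ltn_neqAle andbC.
  set i := Ordinal km; set S := \sum_(_ < m | _) _; rewrite addrA.
  have -> : f (u + w k + l i h *: e i) - f u - (l i h * 'D_(e i) f u + S) =
    (f (u + w k + l i h *: e i) - f (u + w k) - l i h * 'D_(e i) f u) +
    (f (u + w k) - f u - S) by ring.
  rewrite -[k.+1]addn1 natrD mulrDl mul1r addrC.
  apply: (le_trans (ler_normD _ _)); apply: lerD; first exact/IH/ltnW.
  have small t : `|t| <= `|l i h| -> `|w k + t *: e i| < d.
    move=> tl; apply: le_lt_trans hd.
    have -> : C * B * `|h| = C * `|h| + \sum_j C * `|h| * `|e j|.
      by rewrite -mulr_sumr -[X in X + _]mulr1 -mulrDr -/B mulrAC.
    rewrite (bigD1 i) //= addrCA addrC.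
    apply: (le_trans (ler_normD _ _)); apply: lerD; last first.
      rewrite normrZ ler_wpM2r //; exact: le_trans tl (lC _ _).
    apply: (@le_trans _ _ (\sum_(j < m | (j < k)%N) C * `|h| * `|e j|)).
      apply: (le_trans (ler_norm_sum _ _ _)); apply: ler_sum => j _.
      by rewrite normrZ ler_wpM2r.
    rewrite -[leLHS]add0r lerD ?mulr_ge0 //; first exact: ltW.
    rewrite [leLHS]big_mkcond [leRHS]big_mkcond; apply: ler_sum => j _.
    case: ifP => [jk|_]; last first.
      by case: ifP => // _; rewrite !mulr_ge0 // ltW.
    by rewrite ifT // neq_ltn jk.
  apply: (@le_trans _ _ (eps / D * `|l i h|)); last first.
    by apply: ler_wpM2l; [apply: divr_ge0; exact: ltW|exact: lC].
  apply: mean_value_line => t tl; rewrite -addrA.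
    exact/df/(dP _ (small t tl)).1.
  exact: (dP _ (small t tl)).2.
have -> : f (h + u) - (f u + L h) =
    f (u + w m) - f u - \sum_(i < m | (i < m)%N) l i h * 'D_(e i) f u.
  rewrite opprD addrA; congr (f _ - _ - _).
    rewrite addrC; congr (_ + _); rewrite [LHS]el; apply: eq_bigl => i.
    by rewrite ltn_ord.
  by rewrite /L /=; apply: eq_bigl => i; rewrite ltn_ord.
apply: (le_trans (main m (leqnn m))).
have m1 : 0 < 1 + m%:R :> R by rewrite ltr_wpDr.
have -> : m%:R * (eps / D * (C * `|h|)) = eps * `|h| * (m%:R / (1 + m%:R)).
  by rewrite /D; field; rewrite !gt_eqF.
rewrite ler_piMr //; first by rewrite mulr_ge0 // ltW.
by rewrite ler_pdivrMr // mul1r lerDr.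
Unshelve. all: by end_near. Qed.

Lemma is_deriveP (V W : normedModType R) (f : V -> W) u v df :
  is_derive u v f df <->
  h^-1 *: (f (h *: v + u) - f u) @[h --> 0^'] --> df.
Proof.
split=> [[fuv <-]|fc]; first exact: fuv.
by split; [exact: cvgP fc|exact: cvg_lim].
Qed.

Lemma is_derive_lin (V W X : normedModType R) (l : {linear W -> X})
    (f : V -> W) u v df :
  continuous l -> is_derive u v f df -> is_derive u v (l \o f) (l df).
Proof.
move=> cl /is_deriveP fd; apply/is_deriveP.
rewrite (_ : (fun h => _) =
  l \o (fun h => h^-1 *: (f (h *: v + u) - f u))); last first.
  by apply/funext => h; rewrite [RHS]linearZZ [in RHS]linearB.
by apply: continuous_cvg => //; exact: cl.
Qed.

Lemma is_derive_comp (V W X : normedModType R) (g : W -> X) (f : V -> W)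
    u v df :
  is_derive u v f df -> differentiable g (f u) ->
  is_derive u v (g \o f) ('d g (f u) df).
Proof.
move=> [fuv <-] dg.
pose F (h : R) := f (h *: v + u).
have F0 : F 0 = f u by rewrite /F scale0r add0r.
have E (Y : normedModType R) (k : V -> Y) :
    'D_v k u = 'D_(1 : R) (fun h : R => k (h *: v + u)) 0.
  rewrite /derive; set k1 := fun h => _; set k2 := fun h => _.
  suff -> : k1 = k2 by [].
  by apply/funext => h; rewrite /k1 /k2 /= addr0 scale0r add0r [h *: 1]mulr1.
have dF : differentiable F 0.
  by apply/derivable1_diffP; exact: (derivable1P f u v).1 fuv.
have dgF : differentiable (g \o F) 0.
  by apply: differentiable_comp => //; rewrite F0.
split; first by apply: (derivable1P _ _ _).2; exact/derivable1_diffP.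
rewrite E -/(g \o F) deriveE // diff_comp ?F0 //= E -/F.
by rewrite deriveE // F0.
Qed.

Lemma is_derive_scale (V W : normedModType R) (a : V -> R) (b : V -> W)
    u v da db :
  is_derive u v a da -> is_derive u v b db ->
  is_derive u v (fun x => a x *: b x) (a u *: db + da *: b u).
Proof.
move=> /is_deriveP ad /is_deriveP bd; apply/is_deriveP.
have ac : a (h *: v + u) @[h --> 0^'] --> a u.
  apply: (@cvg_trans _ ((a u + h * (h^-1 *: (a (h *: v + u) - a u)))
      @[h --> (0 : R)^'])).
    apply: near_eq_cvg; near=> h.
    have h0 : h != 0 by near: h; exact: nbhs_dnbhs_neq.
    by rewrite -[_^-1 *: _]/(_^-1 * _) mulVKf // addrC subrK.
  rewrite (_ : nbhs (a u) = nbhs (a u + 0 * (da : R))); last first.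
    by rewrite mul0r addr0.
  apply: cvgD; first exact: cvg_cst.
  by apply: cvgM => //; exact: nbhs_dnbhs.
rewrite (_ : (fun h => _) = (fun h => a (h *: v + u) *:
    (h^-1 *: (b (h *: v + u) - b u)) + (h^-1 *: (a (h *: v + u) - a u)) *: b u)).
  by apply: cvgD; [exact: cvgZ|exact: cvgZr_tmp].
apply/funext => h; rewrite scalerA mulrC -!scalerA -scalerDr; congr (_ *: _).
by rewrite scalerBr scalerBl addrA subrK.
Unshelve. all: by end_near. Qed.

End Differentiability.

(** * Maps of class C^k on open sets *)

Lemma continuous_near_eq (T T' : topologicalType) (f g : T -> T') u :
  (\forall v \near u, f v = g v) ->
  {for u, continuous f} -> {for u, continuous g}.
Proof.
move=> fg cf; rewrite /prop_for /continuous_at -(nbhs_singleton fg).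
by apply: cvg_trans cf; apply: near_eq_cvg.
Qed.

Lemma continuous_for_comp (T1 T2 T3 : topologicalType) (f : T1 -> T2)
    (g : T2 -> T3) u : {for u, continuous f} -> {for f u, continuous g} ->
  {for u, continuous (g \o f)}.
Proof. by move=> cf cg; exact: continuous_comp. Qed.

Section Ck.
Context {R : realType}.
Implicit Types V W X : normedModType R.

Lemma Ck_continuous V W k (U : set V) (f : V -> W) u :
  Ck k U f -> U u -> {for u, continuous f}.
Proof. by case: k => [|k] [cf _]; exact: cf. Qed.

Lemma CkW V W k (U : set V) (f : V -> W) : Ck k.+1 U f -> Ck k U f.
Proof.
elim: k f => [|k IH] f [cf [df Df]]; first by split.
by split=> //; split=> // v; apply: IH.
Qed.

Lemma Ck_subset V W k (U U' : set V) (f : V -> W) :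
  U' `<=` U -> Ck k U f -> Ck k U' f.
Proof.
move=> sU; elim: k f => [|k IH] f; first by move=> [cf _]; split=> // u /sU /cf.
move=> [cf [df Df]]; split; first by move=> u /sU /cf.
by split=> [u v /sU Uu|v]; [exact: df|exact/IH/Df].
Qed.

Lemma Ck_eq V W k (U : set V) (f g : V -> W) :
  open U -> (forall u, U u -> f u = g u) -> Ck k U f -> Ck k U g.
Proof.
move=> oU; have near_in (h h' : V -> W) u : (forall u, U u -> h u = h' u) ->
    U u -> \forall v \near u, h v = h' v.
  by move=> hh' Uu; apply: filterS hh' _; exact: open_nbhs_nbhs.
elim: k f g => [|k IH] f g fg.
  by move=> [cf _]; split=> // u Uu; exact/continuous_near_eq/cf/Uu/near_in.
move=> [cf [df Df]]; split.
  by move=> u Uu; exact/continuous_near_eq/cf/Uu/near_in.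
split=> [u v Uu|v]; first exact/near_eq_derivable/df/Uu/near_in.
by apply: IH (Df v) => u Uu; exact/near_eq_derive/near_in.
Qed.

Lemma Ck_local V W k (U : set V) (f : V -> W) :
  (forall u, U u -> exists U', [/\ open U', U' u & Ck k U' f]) -> Ck k U f.
Proof.
elim: k f => [|k IH] f H; split=> //.
- by move=> u /H[U' [_ U'u [cf _]]]; exact: cf.
- by move=> u /H[U' [_ U'u [cf _]]]; exact: cf.
split=> [u v /H[U' [_ U'u [_ [df _]]]]|v]; first exact: df.
apply: IH => u /H[U' [oU' U'u [_ [_ Df]]]]; exists U'; split=> //.
exact: Df.
Qed.

Lemma Ck_cst V W k (U : set V) (a : W) : Ck k U (cst a).
Proof.
elim: k a => [|k IH] a; split=> //; do ?[by move=> u _; exact: cvg_cst].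
split=> [u v _|v]; first exact: derivable_cst.
rewrite (_ : 'D_v _ = cst 0); first exact: IH.
by apply/funext => u; exact: derive_cst.
Qed.

Lemma Ck_lin V W X k (U : set V) (l : {linear W -> X}) (f : V -> W) :
  open U -> continuous l -> Ck k U f -> Ck k U (l \o f).
Proof.
move=> oU cl; elim: k f => [|k IH] f [cf]; split=> //.
- by move=> u Uu; apply: continuous_for_comp; [exact: cf|exact: cl].
- by move=> u Uu; apply: continuous_for_comp; [exact: cf|exact: cl].
case: b => df Df; split=> [u v Uu|v].
  by have [] := is_derive_lin cl (derivableP (df u v Uu)).
apply: Ck_eq oU _ (IH _ (Df v)) => u Uu /=.
by have [] := is_derive_lin cl (derivableP (df u v Uu)).
Qed.

Lemma Ck_linear V W k (U : set V) (l : {linear V -> W}) :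
  open U -> continuous l -> Ck k U l.
Proof.
move=> oU cl; apply: (@Ck_lin _ _ _ _ _ l id) => //.
case: k => [|k]; split=> //; do ?[by move=> u _; exact: cvg_id].
split=> [u v _|v]; first exact: derivable_id.
rewrite (_ : 'D_v _ = cst v); first exact: Ck_cst.
by apply/funext => u; exact: derive_id.
Qed.

Lemma Ck_add V W k (U : set V) (f g : V -> W) :
  open U -> Ck k U f -> Ck k U g -> Ck k U (fun u => f u + g u).
Proof.
move=> oU; elim: k f g => [|k IH] f g [cf Hf] [cg Hg]; split=> //.
- by move=> u Uu; apply: cvgD; [exact: cf|exact: cg].
- by move=> u Uu; apply: cvgD; [exact: cf|exact: cg].
case: Hf Hg => df Df [dg Dg]; split=> [u v Uu|v].
  exact: (derivableD (df u v Uu) (dg u v Uu)).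
apply: Ck_eq oU _ (IH _ _ (Df v) (Dg v)) => u Uu /=.
exact: esym (deriveD (df u v Uu) (dg u v Uu)).
Qed.

Lemma Ck_scale V W k (U : set V) (a : V -> R) (b : V -> W) :
  open U -> Ck k U a -> Ck k U b -> Ck k U (fun u => a u *: b u).
Proof.
move=> oU; elim: k a b => [|k IH] a b [ca Ha] [cb Hb]; split=> //.
- by move=> u Uu; apply: cvgZ; [exact: ca|exact: cb].
- by move=> u Uu; apply: cvgZ; [exact: ca|exact: cb].
have ka : Ck k U a by apply: CkW; split.
have kb : Ck k U b by apply: CkW; split.
case: Ha Hb => da Da [db Db]; split=> [u v Uu|v].
  by have [] := is_derive_scale (derivableP (da u v Uu)) (derivableP (db u v Uu)).
apply: Ck_eq oU _ (Ck_add oU (IH _ _ ka (Db v)) (IH _ _ (Da v) kb)) => u Uu /=.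
by have [] := is_derive_scale (derivableP (da u v Uu)) (derivableP (db u v Uu)).
Qed.

Lemma Ck_sum V W k (U : set V) m (f : 'I_m -> V -> W) : open U ->
  (forall i, Ck k U (f i)) -> Ck k U (fun u => \sum_i f i u).
Proof.
move=> oU; elim: m f => [|m IH] f fk.
  by apply: Ck_eq oU _ (Ck_cst _ _ 0) => u _; rewrite big_ord0.
apply: Ck_eq oU _ (Ck_add oU (fk ord0) (IH _ (fun i => fk (lift ord0 i)))) => u _.
by rewrite big_ord_recl.
Qed.

(** The coordinates of a map with values in a finite-dimensional space reduce
    the statement to real-valued maps. *)
Lemma differentiable_C1 V W {fV : findim V} {fW : findim W}
    (U : set V) (f : V -> W) u :
  open U -> Ck 1 U f -> U u -> differentiable f u.
Proof.
move=> oU kf Uu; have [m [e [l [cl el]]]] := @findimP _ _ fW.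
have -> : f = \sum_i (fun v => l i (f v) *: e i).
  by apply/funext => v; rewrite [LHS]el fct_sumE.
apply: differentiable_sum => i; apply: differentiableZl.
exact: differentiable_C1_real oU (Ck_lin oU (cl i) kf) Uu.
Qed.

Lemma Ck_comp V W X {fW : findim W} {fX : findim X} k (U : set V) (U' : set W)
    (f : V -> W) (g : W -> X) :
  open U -> open U' -> (forall u, U u -> U' (f u)) ->
  Ck k U f -> Ck k U' g -> Ck k U (g \o f).
Proof.
move=> oU oU' UU'; elim: k f g UU' => [|k IH] f g UU' kf kg.
  split=> // u Uu.
  by apply: continuous_for_comp; [exact: kf.1|exact/kg.1/UU'].
have [m [e [l [cl el]]]] := @findimP _ _ fW.
have dg w : U' w -> differentiable g w.
  apply: differentiable_C1 => //; elim: k {IH kf} kg => // k IH kg.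
  exact/IH/CkW.
have fk := CkW kf; have [cg [_ Dg]] := kg; case: kf => cf [df Df].
split.
  by move=> u Uu; apply: continuous_for_comp; [exact: cf|exact/cg/UU'].
have D u v : U u -> is_derive u v (g \o f) ('d g (f u) ('D_v f u)).
  by move=> Uu; apply: is_derive_comp (derivableP (df u v Uu)) (dg _ (UU' _ Uu)).
split=> [u v Uu|v]; first by have [] := D u v Uu.
apply: Ck_eq oU _ (Ck_sum oU (fun i => Ck_scale oU (Ck_lin oU (cl i) (Df v))
  (IH f ('D_(e i) g) UU' fk (Dg (e i))))) => u Uu /=.
have [_ ->] := D u v Uu.
rewrite [X in 'd g _ X]el linear_sum; apply: eq_bigr => i _.
by rewrite linearZ (@deriveE _ _ _ g) //; exact: dg (UU' _ Uu).
Qed.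

End Ck.

Section CkReal.
Context {R : realType}.
Implicit Types V W X : normedModType R.

Lemma Ck_pair V W X k (U : set V) (f : V -> W) (g : V -> X) : open U ->
  Ck k U f -> Ck k U g -> Ck k U (fun u => (f u, g u)).
Proof.
move=> oU kf kg.
have lin1 : linear (fun w : W => (w, 0 : X)).
  by move=> a u v; congr pair; rewrite /= scaler0 addr0.
have lin2 : linear (fun w : X => (0 : W, w)).
  by move=> a u v; congr pair; rewrite /= scaler0 addr0.
pose l1 : {linear W -> (W * X)%type} := HB.pack (fun w : W => (w, 0 : X))
  (GRing.isLinear.Build _ _ _ _ _ lin1).
pose l2 : {linear X -> (W * X)%type} := HB.pack (fun w : X => (0 : W, w))
  (GRing.isLinear.Build _ _ _ _ _ lin2).
have c1 : continuous l1 by move=> w; apply: cvg_pair; [exact: cvg_id|exact: cvg_cst].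
have c2 : continuous l2 by move=> w; apply: cvg_pair; [exact: cvg_cst|exact: cvg_id].
apply: Ck_eq oU _ (Ck_add oU (Ck_lin oU c1 kf) (Ck_lin oU c2 kg)) => u _.
by congr pair; rewrite /= ?addr0 ?add0r.
Qed.

Lemma Ck_opp V W k (U : set V) (f : V -> W) :
  open U -> Ck k U f -> Ck k U (fun u => - f u).
Proof.
move=> oU kf; apply: Ck_eq oU _ (Ck_scale oU (@Ck_cst _ _ R k U (-1)) kf).
by move=> u _; rewrite scaleN1r.
Qed.

Lemma is_derive_direction V (f : R -> V) (u v : R) df :
  is_derive u 1 f df -> is_derive u v f (v *: df).
Proof.
move=> [d1 <-]; have dif : differentiable f u by exact/derivable1_diffP.
split; first exact: diff_derivable.
by rewrite !deriveE // -[X in 'd f u X = _]mulr1 [LHS]linearZZ.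
Qed.

(** A function is one degree smoother than its derivative. *)
Lemma Ck_primitive V k (U : set R) (f f' : R -> V) : open U ->
  (forall u, U u -> is_derive u 1 f (f' u)) -> Ck k U f' -> Ck k.+1 U f.
Proof.
move=> oU df kf'; split.
  move=> u Uu; apply: differentiable_continuous; apply/derivable1_diffP.
  by have [] := df u Uu.
split=> [u v Uu|v]; first by have [] := is_derive_direction v (df u Uu).
apply: Ck_eq oU _ (Ck_scale oU (Ck_cst k U v) kf') => u Uu /=.
by have [_ ->] := is_derive_direction v (df u Uu).
Qed.

Lemma Ck_inv k : Ck k [set x : R | x != 0] (fun x => x^-1).
Proof.
have oU : open [set x : R | x != 0].
  exact: open_neq.
elim: k => [|k IH].
  by split=> // x /= x0; exact: inv_continuous.
apply: (@Ck_primitive _ _ _ _ (fun x => (- 1 : R) *: (x^-1 *: x^-1))) => //.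
  move=> u u0; have := @is_deriveV _ id u 1 1 u0 (is_derive_id u 1).
  move/is_derive_eq; apply; rewrite [LHS]mulr1 -exprVn expr2.
  by rewrite scaleN1r.
exact: Ck_scale (Ck_cst _ _ _) (Ck_scale oU IH IH).
Qed.

Lemma primitive_exists (f : R -> R) (a b : R) : a < b ->
  (forall x, x \in `[a, b] -> {for x, continuous f}) ->
  exists F : R -> R, forall x, x \in `]a, b[ -> is_derive x 1 F (f x).
Proof.
move=> ab cf.
have cfw : {within `[a, b], continuous f}.
  by apply: continuous_in_subspaceT => x /set_mem; exact: cf.
have int := continuous_compact_integrable (@segment_compact _ a b) cfw.
exists (fun x => \int[lebesgue_measure]_(t in `[a, x]) f t)%R.
move=> x xab; have /andP[ax xb] : a < x < b by move: xab; rewrite in_itv.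
have [||d1 d2] := @continuous_FTC1_closed _ f a x b xb int.
- exact: ax.
- by apply: cf; rewrite in_itv /= !ltW.
exact: DeriveDef d1 (etrans (esym (derive1E _ _)) d2).
Qed.

(** A smooth function with nonzero derivative at a point is strictly monotone
    there; its inverse [g] has derivative [1 / (f' \o g)], which makes it as
    smooth as [f]. *)
Lemma local_inverse (f : R -> R) (U : set R) t0 : open U -> U t0 ->
  smooth_on U f -> 'D_1 f t0 != 0 ->
  exists (V W : set R) (g : R -> R), [/\ open V, V t0, open W,
    forall t, V t -> W (f t) /\ g (f t) = t & smooth_on W g].
Proof.
wlog f0 : f / 0 < 'D_1 f t0.
  move=> wl oU Ut0 sf; rewrite neq_lt => /orP[fN|f0]; last first.
    by apply: (wl f) => //; rewrite gt_eqF.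
  have sN : smooth_on U (fun t => - f t).
    by move=> k; exact: Ck_opp.
  have dN : 0 < 'D_1 (fun t => - f t) t0.
    by rewrite deriveN ?oppr_gt0 //; apply: (sf 1%N).2.1.
  have [|V [W [g [oV Vt0 oW gP sg]]]] := wl _ dN oU Ut0 sN; first by rewrite gt_eqF.
  exists V, [set w | W (- w)], (fun w => g (- w)); split => //.
  - have c : continuous (fun w : R => - w) by exact: opp_continuous.
    by move/continuousP: c => /(_ _ oW).
  - move=> k; apply: (@Ck_comp _ _ _ _ _ _ _ _ W (fun w : R => - w)) => //.
      have c : continuous (fun w : R => - w) by exact: opp_continuous.
      by move/continuousP: c => /(_ _ oW).
    have c : continuous (-%R : R -> R) by exact: opp_continuous.
    apply: (@Ck_linear _ _ _ _ _ (-%R : {linear R -> R})) => //.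
    by move/continuousP: c => /(_ _ oW).
move=> oU Ut0 sf _.
have [e e0 eP] : exists2 e, 0 < e &
    forall t, `|t - t0| <= e -> U t /\ 0 < 'D_1 f t.
  have : \forall t \near t0, U t /\ 0 < 'D_1 f t.
    apply: filterI; first exact: open_nbhs_nbhs.
    have := ((sf 1%N).2.2 1).1 t0 Ut0.
    move=> /cvgrPdist_lt /(_ _ f0); apply: filterS => t.
    by rewrite ltr_distlC subrr => /andP[].
  move=> /nbhs_ballP[d /= d0 H]; exists (d / 2); first by rewrite divr_gt0.
  move=> t td; apply: H; rewrite -ball_normE /= distrC (le_lt_trans td) //.
  by rewrite ltr_pdivrMr // ltr_pMr // ltr1n.
pose a := t0 - e; pose b := t0 + e.
have ab t : t \in `[a, b] = (`|t - t0| <= e) by rewrite in_itv /= ler_distl.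
have abP t : t \in `[a, b] -> U t /\ 0 < 'D_1 f t by rewrite ab => /eP.
have df t : t \in `[a, b] -> derivable f t 1.
  by move=> /abP[Ut _]; exact: (sf 1%N).2.1.
have cfw : {within `[a, b], continuous f} by exact: derivable_within_continuous.
have inc : {in `[a, b] &, {homo f : x y / x < y}}.
  apply: gtr0_derive1_lt_cc => // x xab; first exact/df/subset_itv_oo_cc.
  by rewrite derive1E; apply: (abP _ (subset_itv_oo_cc xab)).2.
have inj : {in `[a, b] &, injective f}.
  move=> x y xab yab E; apply/eqP; rewrite eq_le !leNgt.
  by apply/andP; split; apply/negP => /inc; rewrite E ltxx => /(_ _ _)-/(_ _ _) H;
    have := H _ _; rewrite ?xab ?yab => /(_ isT isT).
have aab : a \in `[a, b] by rewrite ab /a addrAC subrr sub0r normrN gtr0_norm.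
have bab : b \in `[a, b] by rewrite ab /b addrAC subrr add0r gtr0_norm.
have altb : a < b by rewrite ltrD2l gtrN.
pose g w := get [set t | t \in `[a, b] /\ f t = w].
have gK t : t \in `[a, b] -> g (f t) = t.
  move=> tab; have [gab fg] : [set s | s \in `[a, b] /\ f s = f t] (g (f t)).
    exact: (@getI _ _ t).
  exact: inj.
exists `]a, b[%classic, `]f a, f b[%classic, g.
have Wg w : w \in `]f a, f b[ -> exists2 t, t \in `]a, b[ & f t = w.
  move=> wab; have [t tab fw] : exists2 t, t \in `[a, b] & f t = w.
    apply: IVT => //; first exact: ltW.
    have fab := inc a b aab bab altb.
    move: wab; rewrite in_itv /= (min_idPl (ltW fab)) (max_idPr (ltW fab)).
    by move=> /andP[/ltW -> /ltW ->].
  exists t => //; move: wab; rewrite -fw !in_itv /= => /andP[fa fb].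
  move: tab; rewrite in_itv /= !le_eqVlt => /andP[/orP[/eqP E|->] /orP[/eqP E'|->]] //.
  - by rewrite -E ltxx in fa.
  - by rewrite -E ltxx in fa.
  - by rewrite E' ltxx in fb.
have nearI t : t \in `]a, b[ -> \forall s \near t, s \in `]a, b[.
  by move=> tab; apply: near_in_itvoo.
have dg w : w \in `]f a, f b[ -> is_derive w 1 g ('D_1 f (g w))^-1.
  move=> /Wg[t tab <-]; rewrite gK ?subset_itv_oo_cc //.
  apply: is_derive_inverse.
  - by apply: filterS (nearI t tab) => s sab; exact/gK/subset_itv_oo_cc.
  - apply: filterS (nearI t tab) => s sab; apply: differentiable_continuous.
    exact/derivable1_diffP/df/subset_itv_oo_cc.
  - exact/derivableP/df/subset_itv_oo_cc.
  - by rewrite gt_eqF //; exact: (abP _ (subset_itv_oo_cc tab)).2.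
split.
- exact: interval_open.
- by rewrite /= in_itv /= /a /b gtrBl ltrDl e0.
- exact: interval_open.
- move=> t /= tab; split; last exact/gK/subset_itv_oo_cc.
  rewrite /= in_itv /=; have tab' := subset_itv_oo_cc tab.
  by move: tab; rewrite in_itv /= => /andP[ta tb]; rewrite !inc.
have oW : open `]f a, f b[%classic by exact: interval_open.
elim=> [|k IH].
  split=> // w wab; apply: differentiable_continuous; apply/derivable1_diffP.
  by have [] := dg w wab.
apply: (Ck_primitive oW dg).
apply: (@Ck_comp _ _ _ _ _ _ _ _ [set x : R | x != 0] _ (fun x => x^-1)) => //.
- move=> w /= /Wg[t tab <-]; rewrite gK ?subset_itv_oo_cc // gt_eqF //.
  exact: (abP _ (subset_itv_oo_cc tab)).2.
- apply: (@Ck_comp _ _ _ _ _ _ _ _ U g ('D_1 f)) => //; last exact: (sf k.+1).2.2.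
  move=> w /= /Wg[t tab <-]; rewrite gK ?subset_itv_oo_cc //.
  exact: (abP _ (subset_itv_oo_cc tab)).1.
- exact: Ck_inv.
Qed.

End CkReal.

Lemma near_open (T : topologicalType) (u : T) (P : set T) :
  nbhs u P <-> exists U, [/\ open U, U u & U `<=` P].
Proof.
rewrite nbhsE; split; first by move=> [U [oU Uu] UP]; exists U.
by move=> [U [oU Uu UP]]; exists U.
Qed.

Section Smooth.
Context {R : realType}.
Implicit Types V W X : normedModType R.

Lemma smooth_on_subset V W (U U' : set V) (f : V -> W) :
  U' `<=` U -> smooth_on U f -> smooth_on U' f.
Proof. by move=> sU sf k; exact: Ck_subset (sf k). Qed.

Lemma smooth_on_eq V W (U : set V) (f g : V -> W) :
  open U -> (forall u, U u -> f u = g u) -> smooth_on U f -> smooth_on U g.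
Proof. by move=> oU fg sf k; exact: Ck_eq (sf k). Qed.

Lemma smooth_on_derive V W (U : set V) (f : V -> W) v :
  smooth_on U f -> smooth_on U ('D_v f).
Proof. by move=> sf k; exact: (sf k.+1).2.2. Qed.

Lemma smooth_on_differentiable V W {fV : findim V} {fW : findim W}
    (U : set V) (f : V -> W) u :
  open U -> smooth_on U f -> U u -> differentiable f u.
Proof. by move=> oU sf; exact: differentiable_C1 oU (sf 1%N). Qed.

(** Smoothness at a point, in the sense of germs: the form in which smoothness
    is composed, restricted and transported through charts. *)
Definition smooth_at V W (u : V) (f : V -> W) :=
  exists U, [/\ open U, U u & smooth_on U f].

Lemma smooth_onP V W (U : set V) (f : V -> W) : open U ->
  smooth_on U f <-> forall u, U u -> smooth_at u f.
Proof.
move=> oU; split; first by move=> sf u Uu; exists U.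
by move=> sf k; apply: Ck_local => u /sf[U' [? ? s]]; exists U'; split.
Qed.

Lemma smooth_at_near V W (u : V) (f g : V -> W) :
  (\forall v \near u, f v = g v) -> smooth_at u f -> smooth_at u g.
Proof.
move=> /near_open[U' [oU' U'u fg]] [U [oU Uu sf]].
exists (U `&` U'); split => //; first exact: openI.
apply: (@smooth_on_eq _ _ _ f); first exact: openI.
  by move=> v [_ /fg].
exact: smooth_on_subset sf.
Qed.

Lemma smooth_at_continuous V W (u : V) (f : V -> W) :
  smooth_at u f -> {for u, continuous f}.
Proof. by move=> [U [_ Uu sf]]; exact: Ck_continuous (sf 0%N) Uu. Qed.

Lemma smooth_at_open V W (u : V) (f : V -> W) :
  smooth_at u f -> \forall v \near u, smooth_at v f.
Proof.
move=> [U [oU Uu sf]]; apply/near_open; exists U; split=> //.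
by move=> v Uv; exists U.
Qed.

Lemma smooth_at_comp V W X {fW : findim W} {fX : findim X}
    (u : V) (f : V -> W) (g : W -> X) :
  smooth_at u f -> smooth_at (f u) g -> smooth_at u (g \o f).
Proof.
move=> [U [oU Uu sf]] [U' [oU' U'u sg]].
have oUU' : open (U `&` f @^-1` U').
  rewrite openE => v [Uv U'v]; apply: filterI; first exact: open_nbhs_nbhs.
  by apply: (Ck_continuous (sf 0%N) Uv); exact: open_nbhs_nbhs.
exists (U `&` f @^-1` U'); split => // k.
apply: (@Ck_comp _ _ _ _ _ _ _ _ U') => //; first by move=> v [].
by apply: smooth_on_subset sf _ => v [].
Qed.

Lemma smooth_at_cst V W (u : V) (a : W) : smooth_at u (cst a).
Proof. by exists setT; split => //; [exact: openT|move=> k; exact: Ck_cst]. Qed.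

Lemma smooth_at_linear V W (l : {linear V -> W}) (u : V) :
  continuous l -> smooth_at u l.
Proof.
by move=> cl; exists setT; split => //; [exact: openT|move=> k; exact/Ck_linear/cl/openT].
Qed.

Lemma smooth_at_id V (u : V) : smooth_at u id.
Proof. by apply: (@smooth_at_linear _ _ idfun) => v; exact: cvg_id. Qed.

Let smooth_at2 V W X (Y : normedModType R) (u : V)
    (f : V -> W) (g : V -> X) (h : V -> Y) :
  (forall k U, open U -> Ck k U f -> Ck k U g -> Ck k U h) ->
  smooth_at u f -> smooth_at u g -> smooth_at u h.
Proof.
move=> H [U [oU Uu sf]] [U' [oU' U'u sg]].
exists (U `&` U'); split => //; first exact: openI.
move=> k; apply: H; first exact: openI.
  by apply: smooth_on_subset sf _ => v [].
by apply: smooth_on_subset sg _ => v [].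
Qed.

Lemma smooth_at_add V W (u : V) (f g : V -> W) :
  smooth_at u f -> smooth_at u g -> smooth_at u (fun v => f v + g v).
Proof. by apply: smooth_at2 => k U; exact: Ck_add. Qed.

Lemma smooth_at_scale V W (u : V) (a : V -> R) (f : V -> W) :
  smooth_at u a -> smooth_at u f -> smooth_at u (fun v => a v *: f v).
Proof. by apply: smooth_at2 => k U; exact: Ck_scale. Qed.

Lemma smooth_at_pair V W X (u : V) (f : V -> W) (g : V -> X) :
  smooth_at u f -> smooth_at u g -> smooth_at u (fun v => (f v, g v)).
Proof. by apply: smooth_at2 => k U; exact: Ck_pair. Qed.

Lemma smooth_at_sum V W m (u : V) (f : 'I_m -> V -> W) :
  (forall i, smooth_at u (f i)) -> smooth_at u (fun v => \sum_i f i v).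
Proof.
elim: m f => [|m IH] f sf.
  by apply: smooth_at_near (smooth_at_cst u 0); near=> v; rewrite big_ord0.
apply: smooth_at_near
  (smooth_at_add (sf ord0) (IH _ (fun i => sf (lift ord0 i)))).
by near=> v; rewrite big_ord_recl.
Unshelve. all: by end_near. Qed.

Lemma smooth_at_opp V W (u : V) (f : V -> W) :
  smooth_at u f -> smooth_at u (fun v => - f v).
Proof.
by move=> [U [oU Uu sf]]; exists U; split => // k; exact: Ck_opp.
Qed.

Lemma smooth_at_fst V W (u : V * W) : smooth_at u fst.
Proof. by apply: (@smooth_at_linear _ _ (fst : {linear _ -> _})) => v; exact: cvg_fst. Qed.

Lemma smooth_at_snd V W (u : V * W) : smooth_at u snd.
Proof. by apply: (@smooth_at_linear _ _ (snd : {linear _ -> _})) => v; exact: cvg_snd. Qed.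

Lemma smooth_at_derive V W (u v : V) (f : V -> W) :
  smooth_at u f -> smooth_at u ('D_v f).
Proof.
by move=> [U [oU Uu sf]]; exists U; split => //; exact: smooth_on_derive.
Qed.

Lemma smooth_at_differentiable V W {fV : findim V} {fW : findim W}
    (u : V) (f : V -> W) : smooth_at u f -> differentiable f u.
Proof. by move=> [U [oU Uu sf]]; exact: smooth_on_differentiable sf Uu. Qed.

Lemma smooth_at_derivable V W (u v : V) (f : V -> W) :
  smooth_at u f -> derivable f u v.
Proof. by move=> [U [oU Uu sf]]; exact: (sf 1%N).2.1. Qed.

Lemma derive_comp V W X {fW : findim W} {fX : findim X}
    (u v : V) (f : V -> W) (g : W -> X) :
  smooth_at u f -> smooth_at (f u) g ->
  'D_v (g \o f) u = 'D_('D_v f u) g (f u).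
Proof.
move=> sf /smooth_at_differentiable dg; rewrite [RHS]deriveE //.
by have [] := is_derive_comp (derivableP (@smooth_at_derivable _ _ u v f sf)) dg.
Qed.

Lemma derive_linear V W {fV : findim V} {fW : findim W} (u : V) (f : V -> W) :
  smooth_at u f -> linear (fun v => 'D_v f u).
Proof.
move=> /smooth_at_differentiable df a x y.
by rewrite !deriveE // linearP.
Qed.

End Smooth.

(** * Smooth maps between manifolds, point by point *)

Section Charts.
Context {T E : topologicalType}.
Implicit Types x : chart T E.

Lemma chart_dom x p : is_chart x -> cdom x p -> nbhs p (cdom x).
Proof. by move=> [ox _ _ _ _] xp; exact: open_nbhs_nbhs. Qed.

Lemma chart_cim x p : cdom x p -> cim x (cmap x p).
Proof. by move=> xp; exists p. Qed.

Lemma chart_im x p : is_chart x -> cdom x p -> nbhs (cmap x p) (cim x).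
Proof.
by move=> [_ ox _ _ _] xp; apply: open_nbhs_nbhs; split=> //; exact: chart_cim.
Qed.

Lemma chartK x p : is_chart x -> cdom x p -> cinv x (cmap x p) = p.
Proof. by move=> [_ _ xK _ _]; exact: xK. Qed.

Lemma chart_invK x u : is_chart x -> cim x u -> cmap x (cinv x u) = u.
Proof. by move=> cx [p xp <-]; rewrite chartK. Qed.

Lemma chart_inv_dom x u : is_chart x -> cim x u -> cdom x (cinv x u).
Proof. by move=> cx [p xp <-]; rewrite chartK. Qed.

Lemma chart_map_continuous x p :
  is_chart x -> cdom x p -> {for p, continuous (cmap x)}.
Proof. by move=> [_ _ _ cx _]; exact: cx. Qed.

Lemma chart_inv_continuous x p :
  is_chart x -> cdom x p -> {for cmap x p, continuous (cinv x)}.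
Proof. by move=> [_ _ _ _ cx] xp; apply: cx; exact: chart_cim. Qed.

Lemma chart_near x p (Q : set T) : is_chart x -> cdom x p ->
  nbhs p Q -> nbhs (cmap x p) (cinv x @^-1` Q).
Proof.
by move=> cx xp Qp; apply: (chart_inv_continuous cx xp); rewrite chartK.
Qed.

Lemma chart_open_image x (O : set T) : is_chart x -> open O ->
  open (cmap x @` (O `&` cdom x)).
Proof.
move=> cx oO; rewrite openE => _ [p [Op xp] <-].
have nO : nbhs p (O `&` cdom x).
  by apply: filterI; [exact: open_nbhs_nbhs|exact: chart_dom].
apply: filterS2 (chart_near cx xp nO) (chart_im cx xp) => u /= Ou xu.
by exists (cinv x u) => //; rewrite chart_invK.
Qed.

End Charts.

Section SmoothMaps.
Context {R : realType}.

Lemma smooth_at_comp_at (V W X : normedModType R) {fW : findim W}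
    {fX : findim X} (u : V) (w : W) (f : V -> W) (g : W -> X) :
  f u = w -> smooth_at u f -> smooth_at w g -> smooth_at u (g \o f).
Proof. by move=> <-; exact: smooth_at_comp. Qed.

(** The part of the notion of a manifold on which the calculus relies. *)
Definition smooth_atlas (T : topologicalType) (E : normedModType R)
    (A : set (chart T E)) : Prop :=
  [/\ findim E, forall x, A x -> is_chart x,
      forall p, exists2 x, A x & cdom x p
    & forall x y p, A x -> A y -> cdom x p -> cdom y p ->
        smooth_at (cmap x p) (cmap y \o cinv x)].

Lemma transition_open (T E : topologicalType) (x y : chart T E) :
  is_chart x -> is_chart y -> open (cmap x @` (cdom x `&` cdom y)).
Proof.
by move=> cx [oy _ _ _ _]; rewrite setIC; exact: chart_open_image.
Qed.

Lemma manifold_smooth_atlas (T : topologicalType) (E : normedModType R)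
    {fE : findim E} (A : set (chart T E)) :
  is_manifold (@smooth_on _ _ _) A -> smooth_atlas A.
Proof.
move=> [_ _ cA covA tA]; split=> // x y p Ax Ay xp yp.
exists (cmap x @` (cdom x `&` cdom y)); split; last exact: tA.
  by apply: transition_open; exact: cA.
by exists p.
Qed.

Lemma smooth_atlas_transition (T : topologicalType) (E : normedModType R)
    (A : set (chart T E)) x y : smooth_atlas A -> A x -> A y ->
  smooth_on (cmap x @` (cdom x `&` cdom y)) (cmap y \o cinv x).
Proof.
move=> [_ cA _ tA] Ax Ay; apply/smooth_onP.
  by apply: transition_open; exact: cA.
by move=> _ [p [xp yp] <-]; exact: tA.
Qed.

Lemma is_chart_id (E : topologicalType) : is_chart (Chart setT id id : chart E E).
Proof.
split => //=; do ?exact: openT; last by move=> u _; exact: cvg_id.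
  by rewrite /cim /= image_id; exact: openT.
by move=> u _; exact: cvg_id.
Qed.

Lemma model_smooth_atlas (E : normedModType R) {fE : findim E} :
  smooth_atlas (@model_atlas _ E).
Proof.
split=> //.
- by move=> x ->; exact: is_chart_id.
- by move=> p; exists (Chart setT id id).
- by move=> x y p -> -> _ _; exact: smooth_at_id.
Qed.

Section Maps.
Context {T1 T2 : topologicalType} {E1 E2 : normedModType R}.
Variables (A1 : set (chart T1 E1)) (A2 : set (chart T2 E2)).
Hypotheses (hA1 : smooth_atlas A1) (hA2 : smooth_atlas A2).

(** One pair of charts is enough because transition maps are smooth
    ([msmooth_at_chart]). *)
Definition msmooth_at (f : T1 -> T2) (p : T1) : Prop :=
  {for p, continuous f} /\
  exists x y, [/\ A1 x, A2 y, cdom x p, cdom y (f p)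
    & smooth_at (cmap x p) (cmap y \o f \o cinv x)].

Lemma msmooth_at_chart (f : T1 -> T2) p x y : msmooth_at f p ->
  A1 x -> A2 y -> cdom x p -> cdom y (f p) ->
  smooth_at (cmap x p) (cmap y \o f \o cinv x).
Proof.
move=> [cf [x0 [y0 [Ax0 Ay0 x0p y0p s0]]]] Ax Ay xp yp.
have [fE1 cA1 _ tA1] := hA1; have [fE2 cA2 _ tA2] := hA2.
have sx := tA1 x x0 p Ax Ax0 xp x0p.
have sy := tA2 y0 y (f p) Ay0 Ay y0p yp.
have cx := cA1 x Ax; have cx0 := cA1 x0 Ax0; have cy0 := cA2 y0 Ay0.
have s1 : smooth_at (cmap x p) ((cmap y0 \o f \o cinv x0) \o (cmap x0 \o cinv x)).
  by apply: smooth_at_comp_at sx s0; rewrite /= chartK.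
have s2 : smooth_at (cmap x p) ((cmap y \o cinv y0) \o
    ((cmap y0 \o f \o cinv x0) \o (cmap x0 \o cinv x))).
  by apply: smooth_at_comp_at s1 sy; rewrite /= !chartK.
apply: smooth_at_near s2.
apply: filterS (chart_near cx xp (filterI (chart_dom cx0 x0p)
  (cf _ (chart_dom cy0 y0p)))) => u /= [x0u y0u].
by rewrite !chartK.
Qed.

Lemma morphism_onP (U : set T1) (f : T1 -> T2) : open U ->
  morphism_on (@smooth_on _ _ _) A1 A2 U f <-> forall p, U p -> msmooth_at f p.
Proof.
move=> oU; have [_ cA1 covA1 _] := hA1; have [_ cA2 covA2 _] := hA2.
have op x y : A1 x -> A2 y -> (forall p, U p -> {for p, continuous f}) ->
    open (cmap x @` (U `&` cdom x `&` f @^-1` cdom y)).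
  move=> /cA1 cx /cA2 [oy _ _ _ _] cf.
  rewrite setIAC; apply: chart_open_image => //.
  rewrite openE => p [Up yp]; apply: filterI; first exact: open_nbhs_nbhs.
  by apply: cf => //; exact: open_nbhs_nbhs.
split=> [[cf sf] p Up|sf].
  split; first exact: cf.
  have [x Ax xp] := covA1 p; have [y Ay yp] := covA2 (f p).
  exists x, y; split => //.
  exists (cmap x @` (U `&` cdom x `&` f @^-1` cdom y)); split; first exact: op.
    by exists p.
  exact: sf.
have cf p : U p -> {for p, continuous f} by move=> /sf[].
split => // x y Ax Ay; apply/smooth_onP; first exact: op.
by move=> _ [p [[Up xp] yp] <-]; exact: msmooth_at_chart (sf p Up) _ _ _ _.
Qed.

Lemma msmooth_at_near (f g : T1 -> T2) p :
  (\forall q \near p, f q = g q) -> msmooth_at f p -> msmooth_at g p.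
Proof.
move=> fg [cf [x [y [Ax Ay xp yp s]]]].
split; first exact: continuous_near_eq cf.
exists x, y; split => //; first by rewrite -(nbhs_singleton fg).
have [_ cA1 _ _] := hA1; have cx := cA1 x Ax.
apply: smooth_at_near s.
by apply: filterS (chart_near cx xp fg) => u /= ->.
Qed.

End Maps.

Lemma msmooth_at_comp (T1 T2 T3 : topologicalType) (E1 E2 E3 : normedModType R)
    (A1 : set (chart T1 E1)) (A2 : set (chart T2 E2)) (A3 : set (chart T3 E3))
    (hA1 : smooth_atlas A1) (hA2 : smooth_atlas A2) (hA3 : smooth_atlas A3)
    (f : T1 -> T2) (g : T2 -> T3) p :
  msmooth_at A1 A2 f p -> msmooth_at A2 A3 g (f p) ->
  msmooth_at A1 A3 (g \o f) p.
Proof.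
move=> sf sg; have [cf [x [y [Ax Ay xp yp s]]]] := sf.
split; first by apply: continuous_for_comp => //; exact: sg.1.
have [_ cA1 _ _] := hA1; have [fE2 cA2 _ _] := hA2.
have [fE3 _ covA3 _] := hA3.
have [z Az zp] := covA3 (g (f p)).
exists x, z; split => //.
have cx := cA1 x Ax; have cy := cA2 y Ay.
have s' : smooth_at (cmap y (f p)) (cmap z \o g \o cinv y).
  exact (msmooth_at_chart hA2 hA3 sg Ay Az yp zp).
have s2 : smooth_at (cmap x p) ((cmap z \o g \o cinv y) \o (cmap y \o f \o cinv x)).
  by apply: smooth_at_comp_at s s'; rewrite /= chartK.
apply: smooth_at_near s2.
apply: filterS (chart_near cx xp (cf _ (chart_dom cy yp))) => u /= yu.
by rewrite chartK.
Qed.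

Lemma msmooth_at_id (T : topologicalType) (E : normedModType R)
    (A : set (chart T E)) p : smooth_atlas A -> msmooth_at A A id p.
Proof.
move=> [_ cA covA tA]; split; first exact: cvg_id.
by have [x Ax xp] := covA p; exists x, x; split => //; exact: tA.
Qed.

Lemma msmooth_at_cst (T T' : topologicalType) (E E' : normedModType R)
    (A : set (chart T E)) (A' : set (chart T' E')) (q : T') p :
  smooth_atlas A -> smooth_atlas A' -> msmooth_at A A' (cst q) p.
Proof.
move=> [_ cA covA tA] [_ cA' covA' tA']; split; first exact: cvg_cst.
have [x Ax xp] := covA p; have [y Ay yp] := covA' q; exists x, y; split => //.
exact: (smooth_at_cst (cmap x p) (cmap y q)).
Qed.

Lemma msmooth_at_model (E E' : normedModType R) (f : E -> E') u :
  msmooth_at (@model_atlas _ E) (@model_atlas _ E') f u <-> smooth_at u f.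
Proof.
split=> [[_ [x [y [-> -> _ _ s]]]]//|sf].
split; first exact: smooth_at_continuous.
by exists (Chart setT id id), (Chart setT id id); split.
Qed.

Lemma msmooth_at_cmap (T : topologicalType) (E : normedModType R)
    (A : set (chart T E)) (x : chart T E) p : smooth_atlas A -> A x ->
  cdom x p -> msmooth_at A (@model_atlas _ E) (cmap x) p.
Proof.
move=> [_ cA _ tA] Ax xp; split; first exact: chart_map_continuous (cA x Ax) xp.
by exists x, (Chart setT id id); split => //; exact: tA.
Qed.

Lemma msmooth_at_cinv (T : topologicalType) (E : normedModType R)
    (A : set (chart T E)) (x : chart T E) p : smooth_atlas A -> A x ->
  cdom x p -> msmooth_at (@model_atlas _ E) A (cinv x) (cmap x p).
Proof.
move=> [_ cA _ tA] Ax xp; split; first exact: chart_inv_continuous (cA x Ax) xp.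
exists (Chart setT id id), x; split => //; first by rewrite chartK //; exact: cA.
exact: tA.
Qed.

Lemma msmooth_at_model_pair (T : topologicalType) (E V W : normedModType R)
    {fV : findim V} {fW : findim W}
    (A : set (chart T E)) (f : T -> V) (g : T -> W) p :
  smooth_atlas A -> msmooth_at A (@model_atlas _ V) f p ->
  msmooth_at A (@model_atlas _ W) g p ->
  msmooth_at A (@model_atlas _ (V * W)%type) (fun q => (f q, g q)) p.
Proof.
move=> sA sf sg; have [_ _ covA _] := sA; have [x Ax xp] := covA p.
have sV : smooth_atlas (@model_atlas _ V) by exact: model_smooth_atlas.
have sW : smooth_atlas (@model_atlas _ W) by exact: model_smooth_atlas.
split; first by apply: cvg_pair; [exact: sf.1|exact: sg.1].
exists x, (Chart setT id id); split => //; apply: smooth_at_pair.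
  exact (msmooth_at_chart sA sV sf Ax (y := Chart setT id id) erefl xp I).
exact (msmooth_at_chart sA sW sg Ax (y := Chart setT id id) erefl xp I).
Qed.

Section Products.
Context {T T' : topologicalType} {E E' : normedModType R}.
Variables (A : set (chart T E)) (A' : set (chart T' E')).
Hypotheses (hA : smooth_atlas A) (hA' : smooth_atlas A').

Lemma is_chart_prod (x : chart T E) (y : chart T' E') :
  is_chart x -> is_chart y -> is_chart (prod_chart x y).
Proof.
move=> cx cy; have [ox oix _ _ _] := cx; have [oy oiy _ _ _] := cy.
have oX (S S' : topologicalType) (B : set S) (B' : set S') :
    open B -> open B' -> open (B `*` B').
  move=> oB oB'; rewrite openE => -[p q] [Bp Bq]; exists (B, B') => //.
  by split; exact: open_nbhs_nbhs.
have E0 : cim (prod_chart x y) = cim x `*` cim y.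
  apply/seteqP; split=> [_ [[p q] [xp yq] <-]|[u v] /= [[p xp <-] [q yq <-]]].
    by split; [exists p|exists q].
  by exists (p, q).
split.
- exact: oX.
- by rewrite E0; exact: oX.
- by move=> [p q] [xp yq]; rewrite /= !chartK.
- move=> [p q] [xp yq]; apply: cvg_pair.
    apply: (@continuous_comp _ _ _ fst (cmap x)); first exact: cvg_fst.
    exact: chart_map_continuous.
  apply: (@continuous_comp _ _ _ snd (cmap y)); first exact: cvg_snd.
  exact: chart_map_continuous.
- rewrite E0 => -[u v] /= [[p xp <-] [q yq <-]]; apply: cvg_pair.
    apply: (@continuous_comp _ _ _ fst (cinv x)); first exact: cvg_fst.
    exact: chart_inv_continuous.
  apply: (@continuous_comp _ _ _ snd (cinv y)); first exact: cvg_snd.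
  exact: chart_inv_continuous.
Qed.

Lemma prod_smooth_atlas : smooth_atlas (prod_atlas A A').
Proof.
have [fE cA covA tA] := hA; have [fE' cA' covA' tA'] := hA'.
split.
- exact: findim_prod.
- by move=> _ [x [y [Ax Ay ->]]]; apply: is_chart_prod; [exact: cA|exact: cA'].
- move=> [p q]; have [x Ax xp] := covA p; have [y Ay yq] := covA' q.
  by exists (prod_chart x y) => //; exists x, y.
move=> _ _ [p q] [x [y [Ax Ay ->]]] [x' [y' [Ax' Ay' ->]]] [xp yq] [x'p y'q].
apply: smooth_at_pair => /=.
  apply: (@smooth_at_comp _ _ _ _ _ _ _ fst (cmap x' \o cinv x)).
    exact: smooth_at_fst.
  exact: tA.
apply: (@smooth_at_comp _ _ _ _ _ _ _ snd (cmap y' \o cinv y)).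
  exact: smooth_at_snd.
exact: tA'.
Qed.

Lemma msmooth_at_snd p : msmooth_at (prod_atlas A A') A' snd p.
Proof.
have [_ _ covA tA] := hA; have [fE' _ covA' tA'] := hA'.
case: p => p q; have [x Ax xp] := covA p; have [y Ay yq] := covA' q.
split; first exact: cvg_snd.
exists (prod_chart x y), y; split => //; first by exists x, y.
apply: (@smooth_at_comp _ _ _ _ _ _ _ snd (cmap y \o cinv y)).
  exact: smooth_at_snd.
exact: tA'.
Qed.

Lemma msmooth_at_pair (T0 : topologicalType) (E0 : normedModType R)
    (A0 : set (chart T0 E0)) (hA0 : smooth_atlas A0)
    (f : T0 -> T) (g : T0 -> T') p :
  msmooth_at A0 A f p -> msmooth_at A0 A' g p ->
  msmooth_at A0 (prod_atlas A A') (fun q => (f q, g q)) p.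
Proof.
move=> sf sg.
have [_ _ covA _] := hA; have [_ _ covA' _] := hA'; have [_ _ covA0 _] := hA0.
have [x0 Ax0 x0p] := covA0 p.
have [x Ax xp] := covA (f p); have [y Ay yp] := covA' (g p).
split; first by apply: cvg_pair; [exact: sf.1|exact: sg.1].
exists x0, (prod_chart x y); split => //; first by exists x, y.
apply: smooth_at_pair.
  exact (msmooth_at_chart hA0 hA sf Ax0 Ax x0p xp).
exact (msmooth_at_chart hA0 hA' sg Ax0 Ay x0p yp).
Qed.

End Products.

Section Differentials.
Context {T1 T2 T3 : topologicalType} {E1 E2 E3 : normedModType R}.
Variables (A1 : set (chart T1 E1)) (A2 : set (chart T2 E2)).
Variables (A3 : set (chart T3 E3)).
Hypotheses (hA1 : smooth_atlas A1) (hA2 : smooth_atlas A2).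
Hypotheses (hA3 : smooth_atlas A3).

Lemma dmap_comp (f : T1 -> T2) (g : T2 -> T3) p x y z v :
  A1 x -> A2 y -> A3 z -> cdom x p -> cdom y (f p) -> cdom z (g (f p)) ->
  msmooth_at A1 A2 f p -> msmooth_at A2 A3 g (f p) ->
  dmap x z (g \o f) p v = dmap y z g (f p) (dmap x y f p v).
Proof.
move=> Ax Ay Az xp yp zp sf sg.
have [_ cA1 _ _] := hA1; have [fE2 cA2 _ _] := hA2.
have [fE3 _ _ _] := hA3; have cx := cA1 x Ax; have cy := cA2 y Ay.
have s1 : smooth_at (cmap x p) (cmap y \o f \o cinv x).
  exact (msmooth_at_chart hA1 hA2 sf Ax Ay xp yp).
have s2 : smooth_at (cmap y (f p)) (cmap z \o g \o cinv y).
  exact (msmooth_at_chart hA2 hA3 sg Ay Az yp zp).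
have E0 : (cmap y \o f \o cinv x) (cmap x p) = cmap y (f p) by rewrite /= chartK.
rewrite /dmap -[in RHS]E0 -derive_comp ?E0 //.
apply: near_eq_derive.
apply: filterS (chart_near cx xp (sf.1 _ (chart_dom cy yp))) => u /= yu.
by rewrite chartK.
Qed.

Lemma dmap_linear (f : T1 -> T2) p x y : msmooth_at A1 A2 f p ->
  A1 x -> A2 y -> cdom x p -> cdom y (f p) ->
  linear (dmap x y f p).
Proof.
move=> sf Ax Ay xp yp.
have [fE1 _ _ _] := hA1; have [fE2 _ _ _] := hA2.
exact: derive_linear (msmooth_at_chart hA1 hA2 sf Ax Ay xp yp).
Qed.

Lemma dmap_id p (x : chart T1 E1) v : is_chart x -> cdom x p ->
  dmap x x id p v = v.
Proof.
move=> cx xp; rewrite /dmap.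
have -> : 'D_v (cmap x \o id \o cinv x) (cmap x p) = 'D_v id (cmap x p).
  apply: near_eq_derive.
  by apply: filterS (chart_im cx xp) => u xu /=; rewrite chart_invK.
exact: derive_id.
Qed.

Lemma velocityE (gamma : R -> T1) (x : chart T1 E1) t :
  velocity x gamma t = dmap (Chart setT id id : chart R R) x gamma t 1.
Proof. by rewrite /velocity derive1E. Qed.

End Differentials.

End SmoothMaps.

(** * Subspaces, products and quotients by translations *)

Lemma subspace_open (T : topologicalType) (S : set T) (B : set T) :
  open B -> open (set_val @^-1` B : set S).
Proof. by move=> oB; exists B. Qed.

Lemma set_val_continuous (T : topologicalType) (S : set T) :
  continuous (set_val : S -> T).
Proof. exact: initial_continuous. Qed.

Lemma subspace_continuous (T T' : topologicalType) (S : set T)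
    (f : T' -> S) p : {for p, continuous (set_val \o f)} ->
  {for p, continuous f}.
Proof.
move=> cf A; rewrite /= => -[_ [[B oB <-] /= Bp BA]].
apply: (filterS (fun q => BA (f q))); apply: cf.
exact: open_nbhs_nbhs.
Qed.

Lemma cluster_image (T T' : topologicalType) (f : T -> T') p q :
  hausdorff_space T' -> continuous f -> cluster (nbhs p) q -> f p = f q.
Proof.
move=> hT cf pq; apply: hT => A B /cf Ap /cf Bq.
by have [r [Ar Br]] := pq _ _ Ap Bq; exists (f r).
Qed.

Lemma subspace_hausdorff (T : topologicalType) (S : set T) :
  hausdorff_space T -> hausdorff_space S.
Proof.
move=> hT p q pq; apply: val_inj.
by apply: (cluster_image hT _ pq) => x; exact: set_val_continuous.
Qed.

Lemma subspace_second_countable (T : topologicalType) (S : set T) :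
  @second_countable T -> @second_countable S.
Proof.
move=> [B cB [oB nB]]; exists [set set_val @^-1` b | b in B].
  exact: sub_countable (card_image_le _ _) cB.
split; first by move=> _ [b /oB ob <-]; exact: subspace_open.
move=> p A [_ [[C oC <-] /= Cp CA]].
have [b [Bb bp] bC] := nB (set_val p) C (open_nbhs_nbhs (conj oC Cp)).
exists (set_val @^-1` b); first by split => //; exists b.
by move=> r br; exact/CA/bC.
Qed.

Lemma real_second_countable (R : realType) : @second_countable R.
Proof.
exists (range (fun ab : rat * rat => `]ratr ab.1, ratr ab.2[%classic : set R)).
  exact: sub_countable (card_image_le _ _) (countableP _).
split; first by move=> _ [ab _ <-]; exact: interval_open.
move=> x A /nbhs_ballP[e /= e0 eA].
have [a /andP[a1 a2]] : exists q, (x - e < ratr q < x).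
  by have [q] := @rat_in_itvoo R (x - e) x ltac:(by rewrite gtrBl); rewrite in_itv; exists q.
have [b /andP[b1 b2]] : exists q, (x < ratr q < x + e).
  by have [q] := @rat_in_itvoo R x (x + e) ltac:(by rewrite ltrDl); rewrite in_itv; exists q.
exists `]ratr a, ratr b[%classic.
  by split; [exists (a, b)|rewrite /= in_itv /= a2 b1].
move=> y /=; rewrite in_itv /= => /andP[ay yb]; apply: eA.
rewrite -ball_normE /= ltr_distlC (lt_trans a1 ay) /=.
exact: lt_trans yb b2.
Qed.

Lemma prod_second_countable (T T' : topologicalType) :
  @second_countable T -> @second_countable T' ->
  @second_countable (T * T')%type.
Proof.
move=> [B cB [oB nB]] [B' cB' [oB' nB']].
exists [set bb.1 `*` bb.2 | bb in B `*` B'].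
  exact: sub_countable (card_image_le _ _) (countableX cB cB').
split.
  move=> _ [[b b'] [/oB ob /oB' ob'] <-]; rewrite openE => -[p q] [bp bq].
  by exists (b, b') => //; split; exact: open_nbhs_nbhs.
move=> [p q] A [[C C'] [Cp C'q] CA].
have [b [Bb bp] bC] := nB _ _ Cp; have [b' [Bb' bq] bC'] := nB' _ _ C'q.
exists (b `*` b'); first by split => //; exists (b, b').
by move=> [r r'] [br br']; apply: CA; split; [exact: bC|exact: bC'].
Qed.

(** The structure shared by t |-> e^{it}, by the projection of C onto C / Lambda
    and by the parametrization of c^*P: a map with continuous local sections
    whose fibres are the cosets of a subset of the model space. *)

Section Coverings.
Context {K : numFieldType} {E : normedModType K} {T : topologicalType}.

Definition has_sections (q : E -> T) :=
  forall u, exists2 x, section_atlas q x & cim x u.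

Lemma section_cdom (q : E -> T) (x : chart T E) u :
  section_atlas q x -> cim x u -> cdom x (q u) /\ cmap x (q u) = u.
Proof.
move=> [cx xq] xu; rewrite -xq //; split; first exact: chart_inv_dom.
exact: chart_invK.
Qed.

Lemma section_cmap (q : E -> T) (x : chart T E) p :
  section_atlas q x -> cdom x p -> q (cmap x p) = p.
Proof. by move=> [cx xq] xp; rewrite -xq ?chartK //; exact: chart_cim. Qed.

Lemma has_sections_continuous (q : E -> T) : has_sections q -> continuous q.
Proof.
move=> hq u; have [x qx xu] := hq u.
have [cx xq] := qx; have [_ oi _ _ ci] := cx.
apply: continuous_near_eq (ci u xu).
by apply: filterS xq _; exact: open_nbhs_nbhs.
Qed.

Lemma has_sections_nbhs (q : E -> T) u (A : set E) : has_sections q ->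
  nbhs u A -> nbhs (q u) (q @` A).
Proof.
move=> hq Au; have [x qx xu] := hq u; have [cx xq] := qx.
have [xp xqu] := section_cdom qx xu.
have := chart_map_continuous cx xp; rewrite /prop_for /continuous_at xqu.
move=> c; have nA : nbhs (q u) (cmap x @^-1` A) := c _ Au.
apply: filterS2 nA (chart_dom cx xp) => p /= Ap xp'.
by exists (cmap x p) => //; exact: section_cmap qx xp'.
Qed.

Lemma has_sections_open (q : E -> T) (A : set E) : has_sections q ->
  open A -> open (q @` A).
Proof.
move=> hq oA; rewrite openE => _ [u Au <-].
by apply: has_sections_nbhs => //; exact: open_nbhs_nbhs.
Qed.

Lemma has_sections_second_countable (q : E -> T) : has_sections q ->
  (forall p, exists u, q u = p) -> @second_countable E ->
  @second_countable T.
Proof.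
move=> hq sq [B cB [oB nB]]; exists [set q @` b | b in B].
  exact: sub_countable (card_image_le _ _) cB.
split; first by move=> _ [b /oB ob <-]; exact: has_sections_open.
move=> p A; have [u <-] := sq p => Aq.
have [b [Bb bu] bA] := nB _ _ (has_sections_continuous hq Aq).
exists (q @` b); first by split; [exists b|exists u].
by move=> _ [v bv <-]; exact: bA.
Qed.

End Coverings.

(** A map covered by [F] between two such quotients is, in local sections, [F]
    followed by a translation. *)
Lemma section_lift (K : numFieldType) (E E' : normedModType K)
    (T T' : topologicalType) (q : E -> T) (q' : E' -> T') (Lam : set E')
    (F : E -> E') (f : T -> T') (x : chart T E) (y : chart T' E') p :
  has_sections q' -> (forall u v, q' u = q' v <-> Lam (u - v)) ->
  section_atlas q x -> section_atlas q' y -> cdom x p -> cdom y (f p) ->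
  (forall u, f (q u) = q' (F u)) ->
  {for cmap x p, continuous F} -> {for p, continuous f} ->
  \forall v \near cmap x p,
    (cmap y \o f \o cinv x) v = F v + (cmap y (f p) - F (cmap x p)).
Proof.
move=> hq' qP' qx qy xp yp fq cF cf.
have [cx xq] := qx; have [cy yq] := qy.
set u0 := cmap x p; set w := _ - _.
have Lw : Lam w.
  apply/qP'; rewrite (section_cmap qy yp) -fq; congr f.
  exact/esym/section_cmap.
have E0 : F u0 + w = cmap y (f p) by rewrite addrC subrK.
have n1 : \forall v \near u0, cim y (F v + w).
  have c : {for u0, continuous (fun v => F v + w)}.
    by apply: cvgD; [exact: cF|exact: cvg_cst].
  by apply: c; rewrite /= E0; exact: chart_im.
have n2 : \forall v \near u0, cdom y (f (cinv x v)).
  have : nbhs p (f @^-1` cdom y) by apply: cf; exact: chart_dom.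
  exact: chart_near.
apply: filterS3 n1 n2 (chart_im cx xp) => v n1v n2v xv /=.
have -> : f (cinv x v) = cinv y (F v + w).
  rewrite yq // xq // fq; apply/qP'.
  rewrite opprD addrA subrr sub0r.
  have := (qP' (F u0) (cmap y (f p))).1.
  rewrite -opprB -/w; apply.
  by rewrite (section_cmap qy yp) -fq section_cmap.
exact: chart_invK.
Qed.

Lemma section_transition (K : numFieldType) (E : normedModType K)
    (T : topologicalType) (q : E -> T) (Lam : set E) (x y : chart T E) p :
  has_sections q -> (forall u v, q u = q v <-> Lam (u - v)) ->
  section_atlas q x -> section_atlas q y -> cdom x p -> cdom y p ->
  \forall v \near cmap x p,
    (cmap y \o cinv x) v = v + (cmap y p - cmap x p).
Proof.
move=> hq qP qx qy xp yp.
exact: (@section_lift _ _ _ _ _ q q Lam id id x y p hq qP qx qy xp yp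
  (fun=> erefl) cvg_id cvg_id).
Qed.

Lemma section_fun_continuous (K : numFieldType) (E : normedModType K)
    (T T' : topologicalType) (q : E -> T) (f : T -> T') u :
  has_sections q -> {for u, continuous (f \o q)} ->
  {for q u, continuous f}.
Proof.
move=> hq cfq A Aq; have := cfq A Aq => /= nA.
have := has_sections_nbhs hq nA.
by apply: filterS => _ [v Av <-].
Qed.

Section SmoothCoverings.
Context {R : realType} {E : normedModType R} {T : topologicalType}.
Context {fE : findim E}.
Variables (q : E -> T) (Lam : set E).
Hypotheses (hq : has_sections q) (qP : forall u v, q u = q v <-> Lam (u - v)).
Hypothesis sq : forall p, exists u, q u = p.

Lemma section_smooth_atlas : smooth_atlas (section_atlas q).
Proof.
split => //; first by move=> x [].
  move=> p; have [u <-] := sq p; have [x qx xu] := hq u.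
  by exists x => //; exact: (section_cdom qx xu).1.
move=> x y p qx qy xp yp.
apply: smooth_at_near (smooth_at_add (smooth_at_id (cmap x p))
  (smooth_at_cst (cmap x p) (cmap y p - cmap x p))).
near do apply: esym.
exact: section_transition hq qP qx qy xp yp.
Unshelve. all: by end_near. Qed.

Lemma section_smooth u : msmooth_at (@model_atlas _ E) (section_atlas q) q u.
Proof.
have [x qx xu] := hq u; have [xp xqu] := section_cdom qx xu.
split; first exact: has_sections_continuous.
exists (Chart setT id id), x; split => //=.
have [cx xq] := qx; have [_ oi _ _ _] := cx.
apply: smooth_at_near (smooth_at_id u).
apply: filterS (open_nbhs_nbhs (conj oi xu)) => v xv /=.
exact/esym/(section_cdom qx xv).2.
Qed.

End SmoothCoverings.

(** * The complex plane and the circle *)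

Section Plane.
Context {R : realType}.

Definition cplx (u : R * R) : C R := u.1 +i* u.2.
Definition creal (z : C R) : R * R := (complex.Re z, complex.Im z).

Lemma cplxK : cancel cplx creal.
Proof. by case. Qed.

Lemma crealK : cancel creal cplx.
Proof. by case. Qed.

Lemma cplxD u v : cplx (u + v) = cplx u + cplx v.
Proof. by []. Qed.

Lemma cplxB u v : cplx (u - v) = cplx u - cplx v.
Proof. by []. Qed.

Lemma crealB z w : creal (z - w) = creal z - creal w.
Proof. by case: z w => a b [a' b']. Qed.

Lemma creal_norm z : (`|creal z|)%:C <= `|z|.
Proof.
case: z => a b; rewrite normc_def /= lecR /creal /=.
rewrite prod_normE /= ge_max; apply/andP; split.
  by rewrite -sqrtr_sqr ler_sqrt ?addr_ge0 ?sqr_ge0 // lerDl sqr_ge0.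
by rewrite -sqrtr_sqr ler_sqrt ?addr_ge0 ?sqr_ge0 // lerDr sqr_ge0.
Qed.

Lemma cplx_norm u : `|cplx u| <= (2 * `|u|)%:C.
Proof.
case: u => a b; rewrite normc_def /= lecR prod_normE /=.
set m := Num.max _ _.
have am : `|a| <= m by rewrite le_max lexx.
have bm : `|b| <= m by rewrite le_max lexx orbT.
have m0 : 0 <= m by exact: le_trans am.
rewrite -[leRHS]ger0_norm ?mulr_ge0 // -sqrtr_sqr ler_sqrt ?sqr_ge0 //.
rewrite -(real_normK (num_real a)) -(real_normK (num_real b)).
have := lerD (ler_pM (normr_ge0 a) (normr_ge0 a) am am)
  (ler_pM (normr_ge0 b) (normr_ge0 b) bm bm).
by rewrite -!expr2; nra.
Qed.

Lemma creal_continuous : continuous creal.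
Proof.
move=> z A /nbhs_ballP[e /= e0 eA]; apply/nbhs_ballP; exists e%:C => /=.
  by rewrite ltcR.
move=> w; rewrite -ball_normE /= => zw; apply: eA; rewrite -ball_normE /=.
by rewrite -crealB -ltcR; exact: le_lt_trans (creal_norm _) zw.
Qed.

Lemma gtc0_real (e : R[i]) : 0 < e -> exists2 d : R, 0 < d & e = d%:C.
Proof.
by case: e => a b; rewrite ltcE /= => /andP[/eqP -> a0]; exists a.
Qed.

Lemma cplx_continuous : continuous cplx.
Proof.
move=> u A /nbhs_ballP[e /= /gtc0_real[d d0 ->] eA].
apply/nbhs_ballP; exists (d / 2) => /=; first by rewrite divr_gt0.
move=> v; rewrite -ball_normE /= => uv; apply: eA; rewrite -ball_normE /=.
rewrite -cplxB; apply: le_lt_trans (cplx_norm _) _.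
by rewrite ltcR mulrC -ltr_pdivlMr.
Qed.

Lemma plane_second_countable : @second_countable (C R).
Proof.
have [B cB [oB nB]] := prod_second_countable (@real_second_countable R)
  (@real_second_countable R).
exists [set cplx @` b | b in B].
  exact: sub_countable (card_image_le _ _) cB.
have E (b : set (R * R)) : cplx @` b = creal @^-1` b.
  apply/seteqP; split=> [_ [u bu <-]|z bz]; first by rewrite /= cplxK.
  by exists (creal z) => //; rewrite crealK.
split.
  move=> _ [b /oB ob <-]; rewrite E.
  by move/continuousP: creal_continuous; apply.
move=> z A; rewrite -[z]crealK => /cplx_continuous /nB[b [Bb bz] bA].
exists (cplx @` b); first by split; [exists b|exists (creal z)].
by move=> _ [u bu <-]; exact: bA.
Qed.

End Plane.

Section Circle.
Context {R : realType}.

Lemma cos_eq1 (t : R) : cos t = 1 -> exists m : int, t = (2 * pi) *~ m.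
Proof.
move=> ct; have pi0 := pi_gt0 R; have tpi0 : 0 < 2 * pi :> R by rewrite mulr_gt0.
pose m := Num.floor (t / (2 * pi)); exists m.
pose s := t - (2 * pi) *~ m.
have cs : cos s = 1.
  rewrite -ct -[in RHS](subrK ((2 * pi) *~ m) t) -/s.
  have P k (a : R) : cos (a + (2 * pi) *+ k) = cos a.
    by apply: (periodicn _ (T := 2 * pi)) => u; rewrite mulr_natl; exact: cosD2pi.
  case: m @s => k s; first by rewrite -pmulrn P.
  by rewrite NegzE mulrNz -pmulrn -{1}(subrK ((2 * pi) *+ k.+1) s) P.
have /andP[s0 s2] : 0 <= s < 2 * pi.
  have := floor_itv (t / (2 * pi)); rewrite -/m ler_pdivlMr // ltr_pdivrMr //.
  have -> : (m + 1)%:~R * (2 * pi) = (2 * pi) *~ m + 2 * pi :> R.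
    by rewrite -[(2 * pi) *~ m]mulrzl intrD [LHS]mulrDl mul1r.
  by rewrite mulrzl /s subr_ge0 ltrBlDl.
suff : s = 0 by move/eqP; rewrite subr_eq0 => /eqP.
have [spi|pis] := leP s pi.
  by apply: cos_inj; rewrite ?in_itv /= ?s0 ?lexx ?spi ?pi_ge0 ?cs ?cos0.
have : 2 * pi - s = 0.
  apply: cos_inj; rewrite ?in_itv /= ?lexx ?pi_ge0 //.
    by move: pis s2; lra.
  by rewrite mulr_natl addrC cosD2pi cosN cs cos0.
by move=> /eqP; rewrite subr_eq0 => /eqP E; rewrite E ltxx in s2.
Qed.

Lemma S1_eq (z w : S1 R) : set_val z = set_val w :> C R -> z = w.
Proof. exact: val_inj. Qed.

Lemma set_val_expi (t : R) : set_val (expi t) = cos t +i* sin t :> C R.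
Proof. by []. Qed.

Lemma expi_eq (u v : R) :
  expi u = expi v <-> exists m : int, u - v = (2 * pi) *~ m.
Proof.
split.
  move=> /(congr1 set_val) /= [cuv suv]; apply: cos_eq1.
  by rewrite cosB cuv suv -!expr2 cos2Dsin2.
move=> [m /eqP]; rewrite subr_eq => /eqP ->.
apply: S1_eq; rewrite !set_val_expi.
have P k (a : R) : (cos (a + (2 * pi) *+ k) = cos a) *
    (sin (a + (2 * pi) *+ k) = sin a).
  split; apply: (periodicn _ (T := 2 * pi)) => b; rewrite mulr_natl.
    exact: cosD2pi.
  exact: sinD2pi.
case: m => k; first by rewrite -pmulrn addrC !P.
rewrite NegzE mulrNz -pmulrn addrC.
by rewrite -[in RHS](subrK ((2 * pi) *+ k.+1) v) !P.
Qed.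

Lemma expiD (u v : R) : expi (u + v) = S1_mul (expi u) (expi v).
Proof.
apply: S1_eq; rewrite [RHS]/= !set_val_expi cosD sinD.
by congr (_ +i* _); rewrite addrC.
Qed.

Lemma expi0 : expi 0 = S1_one R.
Proof. by apply: S1_eq; rewrite set_val_expi cos0 sin0. Qed.

Lemma S1_norm (z : S1 R) :
  complex.Re (set_val z) ^+ 2 + complex.Im (set_val z) ^+ 2 = 1.
Proof.
have E : `|set_val z : C R| = 1 := set_valP z.
case: (set_val z) E => a b; rewrite normc_def /= => -[E].
have : Num.sqrt (a ^+ 2 + b ^+ 2) ^+ 2 = 1 by rewrite E expr1n.
by rewrite sqr_sqrtr ?addr_ge0 ?sqr_ge0.
Qed.

Lemma expi_surj (z : S1 R) : exists t, expi t = z.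
Proof.
have := S1_norm z; set a := complex.Re _; set b := complex.Im _ => ab1.
have a1 : -1 <= a <= 1.
  rewrite -ler_norml -(@ler_pXn2r _ 2) ?nnegrE // expr1n real_normK ?num_real //.
  by rewrite -ab1 lerDl sqr_ge0.
have sb : Num.sqrt (1 - a ^+ 2) = `|b| by rewrite -ab1 addrAC subrr add0r sqrtr_sqr.
have [b0|b0] := leP 0 b.
  exists (acos a); apply: S1_eq; rewrite set_val_expi.
  rewrite acosK ?in_itv // sin_acos // sb ger0_norm //.
  by rewrite /a /b; case: (set_val z).
exists (- acos a); apply: S1_eq; rewrite set_val_expi.
rewrite cosN sinN acosK ?in_itv // sin_acos // sb ltr0_norm // opprK.
by rewrite /a /b; case: (set_val z).
Qed.

Lemma expi_continuous : continuous (@expi R).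
Proof.
move=> t; apply: subspace_continuous.
rewrite (_ : _ \o _ = cplx \o (fun s => (cos s, sin s))) //.
apply: continuous_comp; last exact: cplx_continuous.
exact: (cvg_pair (@continuous_cos R t) (@continuous_sin R t)).
Qed.

(** The real and imaginary parts of [z * e^{- i u}]. *)
Let re_rot (u : R) (z : C R) : R :=
  complex.Re z * cos u + complex.Im z * sin u.
Let im_rot (u : R) (z : C R) : R :=
  complex.Im z * cos u - complex.Re z * sin u.

Let lin_continuous (a b : R) : continuous (fun v : R * R => v.1 * a + v.2 * b).
Proof.
move=> v; apply: (@cvgD _ _ _ _ _ (fun v : R * R => v.1 * a) (fun v => v.2 * b)).
  by apply: (@cvgMr_tmp _ _ _ _ (fst : R * R -> R)); exact: cvg_fst.
by apply: (@cvgMr_tmp _ _ _ _ (snd : R * R -> R)); exact: cvg_snd.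
Qed.

Let re_rot_continuous u : continuous (re_rot u).
Proof.
move=> z; apply: (@continuous_comp _ _ _ creal
    (fun v : R * R => v.1 * cos u + v.2 * sin u)).
  exact: creal_continuous.
exact: lin_continuous.
Qed.

Let im_rot_continuous u : continuous (im_rot u).
Proof.
have -> : im_rot u = (fun v : R * R => v.1 * (- sin u) + v.2 * cos u) \o creal.
  by apply/funext => z; rewrite /im_rot /= mulrN addrC.
move=> z; apply: continuous_comp; first exact: creal_continuous.
exact: lin_continuous.
Qed.

Let rot_norm u (z : S1 R) :
  re_rot u (set_val z) ^+ 2 + im_rot u (set_val z) ^+ 2 = 1.
Proof.
rewrite -(S1_norm z) /re_rot /im_rot -[RHS]mulr1 -(cos2Dsin2 u).
by ring.
Qed.

(** The branch of the argument with values in (u - pi/2, u + pi/2). *)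
Let arg_chart (u : R) : chart (S1 R) R :=
  Chart [set z | 0 < re_rot u (set_val z)]
        (fun z => u + asin (im_rot u (set_val z))) (@expi R).

Let arg_cdom u v : `|v - u| < pi / 2 ->
  cdom (arg_chart u) (expi v) /\ cmap (arg_chart u) (expi v) = v.
Proof.
move=> vu; have vu' : - (pi / 2) < v - u < pi / 2 by rewrite -ltr_norml.
have E : re_rot u (set_val (expi v)) = cos (v - u) by rewrite cosB.
have E' : im_rot u (set_val (expi v)) = sin (v - u) by rewrite sinB.
split; first by rewrite /= E cos_gt0_pihalf.
rewrite /= E' sinK ?subrKC // ?addrCA ?subrr ?addr0 //.
by rewrite in_itv /=; case/andP: vu' => /ltW -> /ltW ->.
Qed.

Let im_rot_bound u (z : S1 R) : cdom (arg_chart u) z ->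
  -1 < im_rot u (set_val z) < 1.
Proof.
move=> /= r0; rewrite -ltr_norml -(@ltr_pXn2r _ 2) ?nnegrE // expr1n.
rewrite real_normK ?num_real // -(rot_norm u z) ltrDr.
by rewrite exprn_gt0.
Qed.

Let arg_cim u : cim (arg_chart u) = [set v | `|v - u| < pi / 2].
Proof.
apply/seteqP; split=> [_ [z zd <-]|v vu]; last first.
  by have [vd vE] := arg_cdom vu; exists (expi v).
have /andP[b1 b2] := im_rot_bound zd.
rewrite /= addrAC subrr add0r ltr_norml asin_gtNpi2 ?asin_ltpi2 //.
  by apply/andP; split; [exact: ltW|].
by apply/andP; split; [|exact: ltW].
Qed.

Let arg_cinvK u z : cdom (arg_chart u) z ->
  expi (cmap (arg_chart u) z) = z.
Proof.
move=> zd; have /andP[b1 b2] := im_rot_bound zd; have n1 := rot_norm u z.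
have bb : -1 <= im_rot u (set_val z) <= 1 by apply/andP; split; exact: ltW.
apply: S1_eq; rewrite set_val_expi cosD sinD cos_asin // asinK ?in_itv //.
have -> : Num.sqrt (1 - im_rot u (set_val z) ^+ 2) = re_rot u (set_val z).
  by rewrite -n1 addrK sqrtr_sqr ger0_norm // ltW.
rewrite /re_rot /im_rot; case: (set_val z) => a b /=.
have cs := cos2Dsin2 u.
congr (_ +i* _).
  rewrite -[RHS]mulr1 -cs; ring.
rewrite -[RHS]mulr1 -cs; ring.
Qed.

Let arg_is_chart u : is_chart (arg_chart u).
Proof.
split.
- rewrite (_ : cdom _ = set_val @^-1` [set z | 0 < re_rot u z]) //.
  apply: subspace_open.
  have c := (continuousP _).1 (@re_rot_continuous u).
  exact: (c [set t | 0 < t] (@open_gt R 0)).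
- rewrite arg_cim (_ : [set _ | _] = ball u (pi / 2)); first exact: ball_open.
  by rewrite -ball_normE; apply/seteqP; split=> v; rewrite /= distrC.
- by move=> z zd; exact: arg_cinvK.
- move=> z zd; have c1 : {for z, continuous (im_rot u \o (set_val : S1 R -> C R))}.
    by apply: continuous_for_comp; [exact: set_val_continuous|exact: im_rot_continuous].
  have c2 := continuous_for_comp c1 (@continuous_asin R _ (im_rot_bound zd)).
  apply: (@continuous_for_comp _ _ _ _ (fun t : R => u + t) _ c2).
  exact: (cvgD (cvg_cst u) (@cvg_id _ _)).
- by move=> v _; exact: expi_continuous.
Qed.

Lemma expi_has_sections : has_sections (@expi R).
Proof.
move=> u; exists (arg_chart u); first by split; [exact: arg_is_chart|].
by rewrite arg_cim /= subrr normr0 divr_gt0 // pi_gt0.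
Qed.

Lemma expi_fibers (u v : R) :
  expi u = expi v <-> [set t | exists m : int, t = (2 * pi) *~ m] (u - v).
Proof. exact: expi_eq. Qed.

Lemma S1_smooth_atlas : smooth_atlas (@S1_atlas R).
Proof.
exact: section_smooth_atlas expi_has_sections expi_fibers expi_surj.
Qed.

Lemma expi_smooth (t : R) :
  msmooth_at (@model_atlas _ R) (@S1_atlas R) (@expi R) t.
Proof. exact: section_smooth expi_has_sections _. Qed.

Lemma smooth_atlas_manifold (T : topologicalType) (E : normedModType R)
    (A : set (chart T E)) : hausdorff_space T -> @second_countable T ->
  smooth_atlas A -> is_manifold (@smooth_on _ _ _) A.
Proof.
move=> hT cT sA; have [_ cA covA tA] := sA; split => // x y Ax Ay.
exact (smooth_atlas_transition sA Ax Ay).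
Qed.

Lemma torus_manifold : is_manifold (@smooth_on _ _ _)
  (prod_atlas (@S1_atlas R) (@S1_atlas R)).
Proof.
have hS : hausdorff_space (S1 R).
  by apply: subspace_hausdorff; exact: (@norm_hausdorff _ (C R)).
have cS : @second_countable (S1 R).
  by apply: subspace_second_countable; exact: plane_second_countable.
apply: smooth_atlas_manifold.
- move=> [p p'] [q q'] pq; congr pair.
    by apply: (@cluster_image _ _ fst _ _ hS _ pq) => x; exact: cvg_fst.
  by apply: (@cluster_image _ _ snd _ _ hS _ pq) => x; exact: cvg_snd.
- exact: prod_second_countable.
- exact: prod_smooth_atlas S1_smooth_atlas S1_smooth_atlas.
Qed.

End Circle.

(** * Complex structures on quotients of the plane *)

Section CauchyRiemann.
Context {R : realType}.

(** Multiplication by i, in real coordinates. *)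
Definition rot90 (v : R * R) : R * R := (- v.2, v.1).

Lemma rot90_linear : linear rot90.
Proof. by move=> a u v; congr pair; rewrite /= opprD scalerN. Qed.

Lemma rot90K v : rot90 (rot90 v) = - v.
Proof. by []. Qed.

Lemma cplx_rot90 v : cplx (rot90 v) = 'i%C * cplx v.
Proof. by apply/eqP; rewrite eq_complex /=; apply/andP; split; apply/eqP; ring. Qed.

(** A real-linear map commuting with the multiplication by i is the
    multiplication by a complex number; hence the Cauchy-Riemann equations give
    complex differentiability. *)
Lemma cauchy_riemann (g : R * R -> R * R) (z : C R) :
  differentiable g (creal z) ->
  (forall v, 'd g (creal z) (rot90 v) = rot90 ('d g (creal z) v)) ->
  derivable (cplx \o g \o creal : C R -> C R) z 1.
Proof.
move=> dg CR; set u := creal z in dg CR *.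
pose lam := cplx ('d g u (1, 0)).
have dE v : cplx ('d g u v) = cplx v * lam.
  have -> : v = v.1 *: (1, 0) + v.2 *: rot90 (1, 0).
    case: v => a b; congr pair; rewrite /= -?[_ *: _]/(_ * _).
      by rewrite oppr0 mulr1 mulr0 addr0.
    by rewrite mulr0 mulr1 add0r.
  rewrite linearD !linearZ /= CR.
  have cZ (a : R) (w : R * R) : cplx (a *: w) = a%:C * cplx w.
    by apply/eqP; rewrite eq_complex /=; apply/andP; split; apply/eqP;
      rewrite -?[_ *: _]/(_ * _); ring.
  have c1 : cplx (1, 0) = 1 :> C R by [].
  by rewrite !cplxD !cZ !cplx_rot90 -/lam c1; ring.
have /eqaddoP gE := diff_locally dg.
apply: (@cvgP _ _ lam); apply/cvgrPdist_lt => e /gtc0_real[d d0 ->].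
have d4 : 0 < d / 4 by rewrite divr_gt0.
have nE : \forall h \near (0 : C R),
    `|g (creal h + u) - (g u + 'd g u (creal h))| <= d / 4 * `|creal h|.
  have c0 : creal (0 : C R) = 0 by [].
  have n0 : nbhs (creal (0 : C R))
      (fun k => `|g (k + u) - (g u + 'd g u k)| <= d / 4 * `|k|).
    by rewrite c0; exact: gE d4.
  exact: (creal_continuous n0).
rewrite near_withinE; apply: filterS nE => h hE h0.
have -> : lam - h^-1 *: ((((cplx \o g) \o creal) \o shift z) (h *: 1) -
    ((cplx \o g) \o creal) z) =
    - (h^-1 * cplx (g (creal h + u) - (g u + 'd g u (creal h)))).
  rewrite /= -?[_ *: _]/(_ * _) mulr1.
  have -> : creal (h + z) = creal h + u by rewrite /u; case: (h) (z) => a b [].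
  rewrite opprD addrA cplxB [cplx (_ - _)]cplxB dE crealK.
  rewrite [X in _ = - X]mulrBr opprB; congr (_ - _).
  exact: esym (mulKf h0 lam).
rewrite normrN normrM normfV ltr_pdivrMl ?normr_gt0 //.
apply: (le_lt_trans (cplx_norm _)).
apply: (@le_lt_trans _ _ ((d / 2)%:C * `|h|)).
  apply: (@le_trans _ _ ((d / 2 * `|creal h|)%:C)).
    by rewrite lecR; move: hE; lra.
  rewrite rmorphM /= ler_wpM2l ?creal_norm //.
  by rewrite lecR divr_ge0 // ltW.
by rewrite mulrC ltr_pM2l ?normr_gt0 // ltcR ltr_pdivrMr // ltr_pMr // ltr1n.
Qed.

End CauchyRiemann.

Section Parametrized.
Context {R : realType} {T : topologicalType} {E : normedModType R}.
Context {T' : topologicalType} {E' : normedModType R}.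
Variables (A : set (chart T E)) (A' : set (chart T' E')).
Hypotheses (hA : smooth_atlas A) (hA' : smooth_atlas A').
Variable q : E -> T.

(** Local diffeomorphisms, expressed through their local sections. *)
Definition local_charts := forall u, exists x,
  [/\ A x, section_atlas q x & cim x u].

Hypothesis hq : local_charts.

Lemma local_charts_sections : has_sections q.
Proof. by move=> u; have [x [_ qx xu]] := hq u; exists x. Qed.

Lemma local_charts_smooth u : msmooth_at (@model_atlas _ E) A q u.
Proof.
have [x [Ax qx xu]] := hq u; have [xp xqu] := section_cdom qx xu.
have [fE _ _ _] := hA.
have := msmooth_at_cinv hA Ax xp; rewrite xqu.
apply: msmooth_at_near; first exact: model_smooth_atlas.
have [cx xq] := qx; have [_ oi _ _ _] := cx.
by apply: filterS xq _; exact: open_nbhs_nbhs.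
Qed.

Lemma local_charts_msmooth (f : T -> T') u :
  msmooth_at (@model_atlas _ E) A' (f \o q) u -> msmooth_at A A' f (q u).
Proof.
move=> sfq; have [x [Ax qx xu]] := hq u; have [xp xqu] := section_cdom qx xu.
have [fE _ _ _] := hA.
have sx := msmooth_at_cmap hA Ax xp.
have hE : smooth_atlas (@model_atlas _ E) by exact: model_smooth_atlas.
have s : msmooth_at A A' ((f \o q) \o cmap x) (q u).
  by apply: (msmooth_at_comp hA hE hA' sx); rewrite xqu.
apply: msmooth_at_near s => //.
have [cx xq] := qx.
by apply: filterS (chart_dom cx xp) => p xp' /=; rewrite (section_cmap qx xp').
Qed.

End Parametrized.

Section Lattice.
Context {R : realType}.

Lemma cplxMz (u : R * R) (n : int) : cplx (u *~ n) = cplx u *~ n.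
Proof.
have P k : cplx (u *+ k) = cplx u *+ k.
  by elim: k => [|k IH]; rewrite ?mulr0n // !mulrSr cplxD IH.
case: n => k; first by rewrite -!pmulrn P.
by rewrite NegzE !mulrNz -!pmulrn -P.
Qed.

Lemma lattice_coord (alpha L : R) (w : R * R) :
  lattice (2 * pi)%:C (- alpha +i* L) (cplx w) <->
  exists m n : int, w.1 = (2 * pi) *~ m - alpha *~ n /\ w.2 = L *~ n.
Proof.
have E (m n : int) : (2 * pi)%:C *~ m + (- alpha +i* L) *~ n =
    cplx ((2 * pi) *~ m - alpha *~ n, L *~ n).
  rewrite -[(2 * pi)%:C]/(cplx (2 * pi, 0)) -[_ +i* L]/(cplx (- alpha, L)).
  rewrite -!cplxMz -cplxD; congr cplx.
  rewrite [LHS]surjective_pairing; congr pair; rewrite /= !raddfMz /=.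
    by rewrite mulNrz.
  by rewrite mul0rz add0r.
split=> [/asboolP[m [n]]|[m [n [e1 e2]]]].
  by rewrite E => /(can_inj cplxK) ->; exists m, n.
by apply/asboolP; exists m, n; rewrite E -e1 -e2 -surjective_pairing.
Qed.

End Lattice.

Lemma derive_linear_basis (R : realType) (W : normedModType R) {fW : findim W}
    (u v : R * R) (f : R * R -> W) : smooth_at u f ->
  'D_v f u = v.1 *: 'D_(1, 0) f u + v.2 *: 'D_(0, 1) f u.
Proof.
move=> sf; have fR2 : findim (R * R)%type by exact: findim_prod.
have dl := @derive_linear _ _ _ fR2 fW _ _ sf.
have vE : v = v.1 *: (1, 0) + (v.2 *: (0, 1) + 0).
  case: v => a b; congr pair; rewrite /= addr0 -?[_ *: _]/(_ * _).
    by rewrite mulr1 mulr0 addr0.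
  by rewrite mulr0 mulr1 add0r.
rewrite [in LHS]vE; apply: (etrans (dl v.1 (1, 0) _)); congr (_ + _).
by apply: (etrans (dl v.2 (0, 1) 0)); rewrite /= derive0 addr0.
Qed.

Section ParametrizedSurface.
Context {R : realType} {S : topologicalType}.
Variables (A : set (chart S (R * R)%type)) (Q : R * R -> S).
Variables (w1 w2 : C R).
Hypotheses (hA : smooth_atlas A) (hS : hausdorff_space S).
Hypothesis cS : @second_countable S.
Hypothesis hQ : local_charts A Q.
Hypothesis QP : forall u v, Q u = Q v <-> lattice w1 w2 (cplx (u - v)).
Hypothesis sQ : forall p, exists u, Q u = p.

Let hQs : has_sections Q := local_charts_sections hQ.

Let QP' u v : Q u = Q v <-> [set w | lattice w1 w2 (cplx w)] (u - v).
Proof. exact: QP. Qed.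

(** ** The torus *)

Lemma parametrized_manifold : is_manifold (@smooth_on _ _ _) A.
Proof. exact: smooth_atlas_manifold. Qed.

Let E2 (v : R * R) : S1 R * S1 R := (expi v.1, expi v.2).

Let E2_local_charts : local_charts (prod_atlas (@S1_atlas R) (@S1_atlas R)) E2.
Proof.
move=> [a b]; have [x qx xa] := @expi_has_sections R a.
have [y qy yb] := @expi_has_sections R b.
have [cx xq] := qx; have [cy yq] := qy.
exists (prod_chart x y); split.
- by exists x, y.
- split; first exact: is_chart_prod.
  move=> _ [[p p'] [xp yp'] <-] /=.
  by rewrite /E2 /= xq ?yq //; exact: chart_cim.
- case: xa => p xp pa; case: yb => p' yp' pb; exists (p, p') => //=.
  by rewrite pa pb.
Qed.

Let E2_surj w : exists v, E2 v = w.
Proof.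
by case: w => z z'; have [a <-] := expi_surj z; have [b <-] := expi_surj z';
  exists (a, b).
Qed.

(** The vectors (2 pi, 0) and (- alpha, L) form a basis of the plane, and a linear
    map takes them to (2 pi, 0) and (0, 2 pi), the generators of the periods of
    the covering of the torus by [E2]. *)
Lemma parametrized_torus (alpha L : R) : 0 < L ->
  w1 = (2 * pi)%:C -> w2 = - alpha +i* L -> is_torus A.
Proof.
move=> L0 w1E w2E; have pi0 := pi_gt0 R.
have L00 : L != 0 by rewrite gt_eqF.
(* [field] would unfold [pi] *)
have [tp tpE tp0] : exists2 tp : R, tp = 2 * pi & tp != 0.
  by exists (2 * pi); rewrite ?mulf_neq0 ?gt_eqF.
(* the linear map taking the basis of the lattice to (2 pi, 0), (0, 2 pi) *)
pose F (u : R * R) : R * R := (u.1 + alpha / L * u.2, tp / L * u.2).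
pose G (u : R * R) : R * R := (u.1 - alpha / tp * u.2, L / tp * u.2).
have FK : cancel F G.
  by case=> a b; rewrite /F /G /=; congr pair; field; rewrite ?L00 ?tp0.
have GK : cancel G F.
  by case=> a b; rewrite /F /G /=; congr pair; field; rewrite ?L00 ?tp0.
have sF u : smooth_at u F.
  apply: smooth_at_pair; last first.
    by apply: smooth_at_scale; [exact: smooth_at_cst|exact: smooth_at_snd].
  apply: smooth_at_add; first exact: smooth_at_fst.
  by apply: smooth_at_scale; [exact: smooth_at_cst|exact: smooth_at_snd].
have sG u : smooth_at u G.
  apply: smooth_at_pair; last first.
    by apply: smooth_at_scale; [exact: smooth_at_cst|exact: smooth_at_snd].
  apply: smooth_at_add; first exact: smooth_at_fst.
  apply: smooth_at_opp.
  by apply: smooth_at_scale; [exact: smooth_at_cst|exact: smooth_at_snd].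
have F1 u v : (F u).1 - (F v).1 = (u - v).1 + alpha / L * (u - v).2.
  by case: u v => a b [a' b']; rewrite /F /=; ring.
have F2 u v : (F u).2 - (F v).2 = tp / L * (u - v).2.
  by case: u v => a b [a' b']; rewrite /F /=; ring.
have key u v : Q u = Q v <-> E2 (F u) = E2 (F v).
  apply: iff_trans (QP u v) _; rewrite w1E w2E.
  apply: iff_trans (lattice_coord _ _ _) _; rewrite -tpE.
  have H : E2 (F u) = E2 (F v) <-> exists m n : int,
      (F u).1 - (F v).1 = tp *~ m /\ (F u).2 - (F v).2 = tp *~ n.
    rewrite tpE; split=> [E|[m [n [Em En]]]].
      have [m Em] := (expi_eq _ _).1 (congr1 fst E).
      have [n En] := (expi_eq _ _).1 (congr1 snd E).
      by exists m, n.
    by congr pair; apply/expi_eq; [exists m|exists n].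
  apply: iff_trans _ (iff_sym H); rewrite F1 F2; case: (u - v) => a b /=.
  split=> -[m [n [E1 E2']]]; exists m, n.
    rewrite E1 E2' -[tp *~ m]mulrzl -[tp *~ n]mulrzl -[alpha *~ n]mulrzl.
    rewrite -[L *~ n]mulrzl; move: (m%:~R) (n%:~R) => p r.
    by split; field.
  have E3 : b = L *~ n.
    have -> : b = L / tp * (tp / L * b) by field; rewrite L00 tp0.
    rewrite E2' -[tp *~ n]mulrzl -[L *~ n]mulrzl; move: (n%:~R) => r.
    by field.
  split => //; have -> : a = tp *~ m - alpha / L * b by rewrite -E1 addrK.
  rewrite E3 -[tp *~ m]mulrzl -[L *~ n]mulrzl -[alpha *~ n]mulrzl.
  by move: (m%:~R) (n%:~R) => r r'; field.
have hT : smooth_atlas (prod_atlas (@S1_atlas R) (@S1_atlas R)).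
  exact: prod_smooth_atlas S1_smooth_atlas S1_smooth_atlas.
have hM : smooth_atlas (@model_atlas _ (R * R)%type) by exact: model_smooth_atlas.
pose cS' p := sval (cid (sQ p)); have cSP p : Q (cS' p) = p by rewrite /cS'; case: cid.
pose cT w := sval (cid (E2_surj w)); have cTP w : E2 (cT w) = w by rewrite /cT; case: cid.
pose f p := E2 (F (cS' p)); pose g w := Q (G (cT w)).
have fQ u : f (Q u) = E2 (F u) by apply/key; rewrite cSP.
have gE u : g (E2 u) = Q (G u) by apply/key; rewrite !GK cTP.
split; [exact: parametrized_manifold|exact: torus_manifold|exists f, g; split].
- by move=> p; rewrite -[p in f p]cSP fQ gE FK cSP.
- by move=> w; rewrite -[w in g w]cTP gE fQ GK cTP.
- apply/(morphism_onP hA hT f openT) => p _; rewrite -(cSP p).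
  apply: (local_charts_msmooth hA hT hQ).
  apply: (@msmooth_at_near _ _ _ _ _ _ _ hM (E2 \o F)).
    by near=> u; rewrite /= fQ.
  apply: (msmooth_at_comp hM hM hT); first exact/msmooth_at_model.
  exact: (local_charts_smooth hT E2_local_charts).
- apply/(morphism_onP hT hA g openT) => w _; rewrite -(cTP w).
  apply: (local_charts_msmooth hT hA E2_local_charts).
  apply: (@msmooth_at_near _ _ _ _ _ _ _ hM (Q \o G)).
    by near=> u; rewrite /= gE.
  apply: (msmooth_at_comp hM hM hA); first exact/msmooth_at_model.
  exact: (local_charts_smooth hA hQ).
Unshelve. all: by end_near. Qed.

(** ** The complex structure *)

Definition section_chart (p : S) (k : chart S (R * R)%type) :=
  [/\ A k, section_atlas Q k & cdom k p].

Lemma section_chart_exists p : exists k, section_chart p k.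
Proof.
have [u <-] := sQ p; have [x [Ax qx xu]] := hQ u.
by exists x; split => //; exact: (section_cdom qx xu).1.
Qed.

Definition local_section p := sval (cid (section_chart_exists p)).

Lemma local_sectionP p : section_chart p (local_section p).
Proof. by rewrite /local_section; case: cid. Qed.

(** The multiplication by i in the coordinates given by a local section of [Q];
    the choice of the section does not matter ([quotient_JE]). *)
Definition quotient_J (x : chart S (R * R)%type) (p : S) (v : R * R) : R * R :=
  dmap (local_section p) x id p (rot90 (dmap x (local_section p) id p v)).

Let fR2 : findim (R * R)%type. Proof. exact: findim_prod. Qed.

Let id_smooth p : msmooth_at A A id p.
Proof. exact: msmooth_at_id. Qed.

(** Two sections of [Q] differ by a translation. *)
Lemma dmap_section k k' p v : section_chart p k -> section_chart p k' ->
  dmap k k' id p v = v.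
Proof.
move=> [Ak qk kp] [Ak' qk' kp']; rewrite /dmap -[RHS](derive_id (cmap k p) v).
have -> : 'D_v id (cmap k p) =
    'D_v (id + cst (cmap k' p - cmap k p)) (cmap k p).
  rewrite deriveD; [|exact: derivable_id|exact: derivable_cst].
  by rewrite derive_cst addr0.
apply: near_eq_derive.
exact: section_transition hQs QP' qk qk' kp kp'.
Qed.

Lemma dmap_trans x y z p v : A x -> A y -> A z ->
  cdom x p -> cdom y p -> cdom z p ->
  dmap y z id p (dmap x y id p v) = dmap x z id p v.
Proof.
move=> Ax Ay Az xp yp zp; apply: esym.
exact (@dmap_comp _ _ _ _ _ _ _ _ _ _ hA hA hA id id p x y z v Ax Ay Az xp yp zp
  (id_smooth p) (id_smooth p)).
Qed.

Lemma dmap_idE x p v : A x -> cdom x p -> dmap x x id p v = v.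
Proof. by move=> Ax xp; apply: dmap_id => //; have [_ cA _ _] := hA; exact: cA. Qed.

Lemma quotient_JE x p v k : A x -> cdom x p -> section_chart p k ->
  quotient_J x p v = dmap k x id p (rot90 (dmap x k id p v)).
Proof.
move=> Ax xp sk; have [Ak qk kp] := sk; rewrite /quotient_J.
have sk' := local_sectionP p; have [Ak' qk' kp'] := sk'.
set k' := local_section p in sk' Ak' qk' kp' *.
have -> : dmap x k id p v = dmap x k' id p v.
  exact (etrans (esym (dmap_trans v Ax Ak' Ak xp kp' kp))
    (dmap_section (dmap x k' id p v) sk' sk)).
set w := rot90 _; rewrite -(dmap_trans w Ak' Ak Ax kp' kp xp).
by rewrite (dmap_section w sk' sk).
Qed.

Let dmapN x y p v : A x -> A y -> cdom x p -> cdom y p ->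
  dmap x y id p (- v) = - dmap x y id p v.
Proof.
move=> Ax Ay xp yp; have := dmap_linear hA hA (id_smooth p) Ax Ay xp yp (-1) v 0.
have d0 : dmap x y id p 0 = 0 by exact: derive0.
by rewrite !scaleN1r !addr0 d0 addr0.
Qed.

Lemma quotient_J_almost_complex : is_almost_complex A quotient_J.
Proof.
split.
- move=> x p a u v Ax xp; have [Ak qk kp] := local_sectionP p.
  rewrite /quotient_J (dmap_linear hA hA (id_smooth p) Ax Ak xp kp) rot90_linear.
  exact: (dmap_linear hA hA (id_smooth p) Ak Ax kp xp).
- move=> x p v Ax xp; have [Ak qk kp] := local_sectionP p.
  rewrite /quotient_J (dmap_trans _ Ak Ax Ak kp xp kp) (dmap_idE _ Ak kp) rot90K.
  by rewrite (dmapN _ Ak Ax kp xp) (dmap_trans _ Ax Ak Ax xp kp xp) (dmap_idE _ Ax xp).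
- move=> x y p v Ax Ay xp yp; have [Ak qk kp] := local_sectionP p.
  rewrite /quotient_J (dmap_trans _ Ax Ay Ak xp yp kp).
  by rewrite (dmap_trans _ Ak Ax Ay kp xp yp).
move=> x v Ax; have [_ cA _ tA] := hA; have cx := cA x Ax.
apply/smooth_onP; first by case: cx.
move=> _ [p xp <-].
have sk := local_sectionP p; set k := local_section p in sk *.
have [Ak qk kp] := sk; have ck := cA k Ak.
(* in the chart [x], the structure is [D H \o rot90 \o D K] *)
pose H := cmap x \o cinv k; pose K := cmap k \o cinv x.
have sK : smooth_at (cmap x p) K by exact: tA.
have sH : smooth_at (cmap k p) H by exact: tA.
have KE : K (cmap x p) = cmap k p by rewrite /K /= chartK.
pose w u := rot90 ('D_v K u).
have sw : smooth_at (cmap x p) w.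
  have sD : smooth_at (cmap x p) ('D_v K) by exact: smooth_at_derive.
  apply: smooth_at_pair.
    apply: smooth_at_opp.
    by apply: (smooth_at_comp sD); exact: smooth_at_snd.
  by apply: (smooth_at_comp sD); exact: smooth_at_fst.
have sHK e : smooth_at (cmap x p) ('D_e H \o K).
  by apply: (smooth_at_comp sK); rewrite KE; exact: smooth_at_derive.
have s : smooth_at (cmap x p) (fun u =>
    (w u).1 *: ('D_(1, 0) H \o K) u + (w u).2 *: ('D_(0, 1) H \o K) u).
  apply: smooth_at_add; apply: smooth_at_scale => //.
    by apply: (smooth_at_comp sw); exact: smooth_at_fst.
  by apply: (smooth_at_comp sw); exact: smooth_at_snd.
apply: smooth_at_near s.
have n1 := chart_near cx xp (chart_dom ck kp).
have n2 : \forall u \near cmap x p, smooth_at (K u) H.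
  have := smooth_at_continuous sK; rewrite /prop_for /continuous_at KE => cK.
  exact: cK (smooth_at_open sH).
apply: filterS3 n1 n2 (chart_im cx xp) => u ku sHu [p' xp' pE].
move: ku sHu; rewrite -pE /= chartK // => kp' sHu.
rewrite (@quotient_JE x p' v k) //.
apply: (etrans (esym (@derive_linear_basis _ _ fR2 _ (w (cmap x p')) _ sHu))).
by rewrite /dmap /w /K /= chartK.
Qed.

Definition complexify (k : chart S (R * R)%type) : chart S (C R) :=
  Chart (cdom k) (cplx \o cmap k) (cinv k \o creal).

Lemma complexifyK k : realify (complexify k) = k.
Proof.
case: k => d m i; rewrite /realify /=; congr Chart.
  by apply/funext => p /=; case: (m p).
by apply/funext; case.
Qed.

Lemma realify_chart (x : chart S (C R)) : is_chart (realify x) -> is_chart x.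
Proof.
move=> [od oi K cm ci].
have iE : cim x = creal @^-1` cim (realify x).
  apply/seteqP; split=> [_ [p xp <-]|z [p xp pE]]; first by exists p.
  by exists p => //; apply: (can_inj crealK).
split => //.
- by rewrite iE; apply: (continuousP _).1 oi; exact: creal_continuous.
- move=> p xp; have := K p xp; rewrite /=.
  by case: (cmap x p).
- move=> p xp; have c := continuous_for_comp (cm p xp) (@cplx_continuous R _).
  rewrite (_ : cmap x = cplx \o cmap (realify x)) //.
  by apply/funext => q; rewrite /= -[LHS]crealK.
- rewrite iE => z zi.
  have c := continuous_for_comp (@creal_continuous R z) (ci _ zi).
  rewrite (_ : cinv x = cinv (realify x) \o creal) //.
  by apply/funext; case.
Qed.

Let HA : set (chart S (C R)) := holo_atlas A quotient_J.

Lemma holo_chart x : HA x -> is_chart x.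
Proof. by move=> [Ax _]; apply: realify_chart; have [_ cA _ _] := hA; exact: cA. Qed.

Lemma holo_section p k : section_chart p k -> HA (complexify k).
Proof.
move=> [Ak qk _]; split; rewrite ?complexifyK // => q v kq.
have sk : section_chart q k by split.
by rewrite (quotient_JE v Ak kq sk) !(dmap_section _ sk sk).
Qed.

(** The transition map commutes with the multiplication by i because [J] is
    compatible with changes of charts. *)
Lemma holo_transition x y p : HA x -> HA y -> cdom x p -> cdom y p ->
  derivable (cmap y \o cinv x) (cmap x p) 1.
Proof.
move=> [Ax Jx] [Ay Jy] xp yp; have [_ cA _ tA] := hA.
pose g := cmap (realify y) \o cinv (realify x).
have sg : smooth_at (cmap (realify x) p) g by exact: tA.
have -> : cmap y \o cinv x = cplx \o g \o creal.
  apply/funext => z; rewrite /g /= -[RHS]/(cplx (creal _)) crealK.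
  by case: z.
have dg : differentiable g (cmap (realify x) p).
  exact (@smooth_at_differentiable _ _ _ fR2 fR2 _ _ sg).
apply: cauchy_riemann => // v.
have D w : 'd g (creal (cmap x p)) w = dmap (realify x) (realify y) id p w.
  by rewrite /dmap deriveE.
rewrite !D; have [_ _ JA _] := quotient_J_almost_complex.
by have := JA _ _ p v Ax Ay xp yp; rewrite Jx // Jy.
Qed.

Lemma holo_cover p : exists2 x, HA x & cdom x p.
Proof.
have sk := local_sectionP p; exists (complexify (local_section p)).
  exact: holo_section sk.
by case: sk.
Qed.

Lemma quotient_J_complex : is_complex_structure A quotient_J.
Proof.
split; first exact: quotient_J_almost_complex.
split => //; [exact: holo_chart|exact: holo_cover|].
move=> x y Ax Ay _ [p [xp yp] <-]; exact: holo_transition.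
Qed.

(** ** Uniformization *)

Let piL : C R -> C_mod w1 w2 :=
  \pi_(quotient_topology (@Quotient.quot (C R) (lattice w1 w2)))%qT.

Let piP z w : piL z = piL w <-> lattice w1 w2 (z - w).
Proof.
have -> : lattice w1 w2 (z - w) = ((z - w) \in lattice w1 w2) by [].
by rewrite Quotient.idealrBE; split=> [E|/eqP E]; [apply/eqP|]; exact: E.
Qed.

Let pi_surj w : exists z, piL z = w.
Proof. by exists (repr w); exact: reprK. Qed.

Let lift (p : S) : R * R := sval (cid (sQ p)).
Let liftP p : Q (lift p) = p.
Proof. by rewrite /lift; case: cid. Qed.

Let f (p : S) : C_mod w1 w2 := piL (cplx (lift p)).
Let g (w : C_mod w1 w2) : S := Q (creal (repr w)).

Let fQ u : f (Q u) = piL (cplx u).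
Proof. by apply/piP; rewrite -cplxB; apply/QP; rewrite liftP. Qed.

Let gpi z : g (piL z) = Q (creal z).
Proof.
by apply/QP; rewrite -crealB crealK; apply/piP; exact: reprK.
Qed.

Let fK : cancel f g.
Proof. by move=> p; rewrite /f gpi cplxK liftP. Qed.

Let gK : cancel g f.
Proof. by move=> w; have [z <-] := pi_surj w; rewrite gpi fQ crealK. Qed.

Let f_continuous : continuous f.
Proof.
move=> p; rewrite -(liftP p); apply: section_fun_continuous => //.
rewrite (_ : f \o Q = piL \o cplx); last by apply/funext => u; rewrite /= fQ.
apply: continuous_for_comp; first exact: cplx_continuous.
exact: pi_continuous.
Qed.

Let g_continuous : continuous g.
Proof.
apply/quotient_continuous => z.
rewrite (_ : g \o _ = Q \o creal); last by apply/funext => w; rewrite /= gpi.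
apply: continuous_for_comp; first exact: creal_continuous.
exact: has_sections_continuous.
Qed.

(** The homeomorphism [g] carries the local sections of [Q] to local sections of
    the projection onto C / Lambda. *)
Let pi_sections : has_sections piL.
Proof.
move=> z; have [k [Ak qk ku]] := hQ (creal z).
have [ck kq] := qk; have [od oi _ _ _] := ck.
pose X : chart (C_mod w1 w2) (C R) :=
  Chart (g @^-1` cdom k) (cplx \o cmap k \o g) piL.
have iE : cim X = creal @^-1` cim k.
  apply/seteqP; split=> [_ [w kw <-]|v kv].
    by rewrite /= cplxK; exact: chart_cim.
  have [vd vE] := section_cdom qk kv.
  by exists (piL v); rewrite /= gpi // vE crealK.
exists X; last by rewrite iE.
split => //; split.
- by apply: (continuousP _).1 od; exact: g_continuous.
- by rewrite iE; apply: (continuousP _).1 oi; exact: creal_continuous.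
- move=> w kw; rewrite /= -[RHS]gK -[in RHS](section_cmap qk kw) fQ.
  by [].
- move=> w kw; apply: (@continuous_for_comp _ _ _ g (cplx \o cmap k)).
    exact: g_continuous.
  apply: continuous_for_comp; first exact: chart_map_continuous.
  exact: cplx_continuous.
- by move=> v _; exact: pi_continuous.
Qed.

Let piP' z w : piL z = piL w <-> [set v | lattice w1 w2 v] (z - w).
Proof. exact: piP. Qed.

Let C_mod_manifold : is_manifold (@holomorphic_on R) (@C_mod_atlas R w1 w2).
Proof.
split.
- move=> p q pq; rewrite -[p]gK -[q]gK; congr f.
  by apply: (cluster_image hS _ pq); exact: g_continuous.
- apply: (has_sections_second_countable pi_sections pi_surj).
  exact: plane_second_countable.
- by move=> x [].
- move=> w; have [z <-] := pi_surj w; have [x qx xz] := pi_sections z.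
  by exists x => //; exact: (section_cdom qx xz).1.
move=> x y qx qy _ [p [xp yp] <-].
have n := section_transition pi_sections piP' qx qy xp yp.
apply: (@near_eq_derivable _ _ _ (id + cst (cmap y p - cmap x p))).
  by apply: filterS n => v vE; rewrite vE.
by apply: derivableD; [exact: derivable_id|exact: derivable_cst].
Qed.

(** Both [Q] and the projection onto C / Lambda have a section through a given
    point of the plane; arbitrary charts are compared with it. *)
Let holo_through z : exists k, HA k /\
  (forall v, cim k v -> cinv k v = g (piL v)) /\ cim k z.
Proof.
have [k [Ak qk ku]] := hQ (creal z); have [ku1 _] := section_cdom qk ku.
have sk : section_chart (Q (creal z)) k by split.
have iE v : cim (complexify k) v -> cim k (creal v).
  by move=> [p kp <-]; rewrite /= cplxK; exact: chart_cim.
exists (complexify k); split; first exact: holo_section sk.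
split.
  by move=> v /iE kv; rewrite gpi /=; case: qk => _; apply.
case: ku => p kp pE; exists p => //.
by rewrite /= pE crealK.
Qed.

(** [Q] and the projection onto C / Lambda identify the same points of the plane,
    and in sections of the two maps the induced bijection is a translation. *)
Lemma parametrized_uniformization :
  isomorphic (@holomorphic_on R) (holo_atlas A quotient_J) (@C_mod_atlas R w1 w2).
Proof.
split; [exact: quotient_J_complex.2|exact: C_mod_manifold|].
exists f, g; split; [exact: fK|exact: gK|split|split].
- by move=> p _; exact: f_continuous.
- move=> x y Ax qy _ [p [[_ xp] yp] <-].
  have cx := holo_chart Ax; have [cy yq] := qy.
  have [k [Ak [kg kz]]] := holo_through (cmap y (f p)).
  have ck := holo_chart Ak.
  have piE : piL (cmap y (f p)) = f p by exact: section_cmap qy yp.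
  have kE : cinv k (cmap y (f p)) = p by rewrite kg // piE fK.
  have kp : cdom k p by rewrite -kE; exact: chart_inv_dom.
  have kpE : cmap k p = cmap y (f p) by rewrite -[in LHS]kE chart_invK.
  apply: near_eq_derivable (holo_transition Ax Ak xp kp).
  have n1 : \forall q \near p, cim y (cmap k q).
    have := chart_map_continuous ck kp; rewrite /prop_for /continuous_at kpE.
    apply; exact: chart_im.
  apply: filterS (chart_near cx xp (filterI n1 (chart_dom ck kp))) => v /= [yv kv].
  have -> : f (cinv x v) = piL (cmap k (cinv x v)).
    by rewrite -[RHS]gK; congr f; rewrite -kg ?chartK //; exact: chart_cim.
  by rewrite (section_cdom qy yv).2.
- by move=> w _; exact: g_continuous.
move=> x y qx Ay _ [w [[_ xw] yw] <-].
have [cx xq] := qx; have cy := holo_chart Ay.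
have [k [Ak [kg kz]]] := holo_through (cmap x w).
have ck := holo_chart Ak.
have xwE : piL (cmap x w) = w by exact: section_cmap qx xw.
have kE : cinv k (cmap x w) = g w by rewrite kg // xwE.
have kp : cdom k (g w) by rewrite -kE; exact: chart_inv_dom.
have kpE : cmap k (g w) = cmap x w by rewrite -kE chart_invK.
have d := holo_transition Ak Ay kp yw; rewrite kpE in d.
apply: near_eq_derivable d.
have n1 : nbhs (cmap x w) (cim k) by rewrite -kpE; exact: chart_im.
apply: filterS2 n1 (chart_im cx xw) => v kv xv /=.
by rewrite kg // xq.
Qed.

End ParametrizedSurface.

(** * Horizontal lifts *)

Section PartialDerivatives.
Context {R : realType}.

Lemma derive_fst_var (W : normedModType R) (f : R * R -> W) u :
  derivable f u (1, 0) -> 'D_(1, 0) f u = 'D_1 (fun s => f (s, u.2)) u.1.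
Proof.
case: u => a b df.
have E : (a, b) = (0, b) + a *: (1, 0) :> R * R.
  congr pair; rewrite /= -?[_ *: _]/(_ * _) ?mulr1 ?mulr0 ?addr0 ?add0r //.
have := @is_derive_line _ _ _ f (0, b) (1, 0) a; rewrite -E => /(_ df) [_ <-].
congr ('D_1 _ a); apply/funext => s; congr f.
by congr pair; rewrite /= -?[_ *: _]/(_ * _) ?mulr1 ?mulr0 ?addr0 ?add0r.
Qed.

Lemma derive_snd_var (W : normedModType R) (f : R * R -> W) u :
  derivable f u (0, 1) -> 'D_(0, 1) f u = 'D_1 (fun s => f (u.1, s)) u.2.
Proof.
case: u => a b df.
have E : (a, b) = (a, 0) + b *: (0, 1) :> R * R.
  congr pair; rewrite /= -?[_ *: _]/(_ * _) ?mulr1 ?mulr0 ?addr0 ?add0r //.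
have := @is_derive_line _ _ _ f (a, 0) (0, 1) b; rewrite -E => /(_ df) [_ <-].
congr ('D_1 _ b); apply/funext => s; congr f.
by congr pair; rewrite /= -?[_ *: _]/(_ * _) ?mulr1 ?mulr0 ?addr0 ?add0r.
Qed.

Lemma is_derive_pair (V W : normedModType R) (f : R -> V) (g : R -> W) t v df dg :
  is_derive t v f df -> is_derive t v g dg ->
  is_derive t v (fun s => (f s, g s)) (df, dg).
Proof.
move=> /is_deriveP cf /is_deriveP cg; apply/is_deriveP.
exact: cvg_pair cf cg.
Qed.

Lemma derive_translate (W : normedModType R) (f : R -> W) (a b : R) :
  'D_1 (fun s => f (a + s)) b = 'D_1 f (a + b).
Proof.
rewrite /derive; set k1 := fun h => _; set k2 := fun h => _.
suff -> : k1 = k2 by [].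
by apply/funext => h; rewrite /k1 /k2 /= addrCA.
Qed.

End PartialDerivatives.

Section Bundle.
Context {R : realType} {M P : topologicalType} {E F : normedModType R}.
Variables (AM : set (chart M E)) (AP : set (chart P F)).
Hypotheses (sM : smooth_atlas AM) (sP : smooth_atlas AP).
Variables (prj : P -> M) (act : P -> S1 R -> P).
Hypothesis hprj : is_principal_S1_bundle AM AP prj act.
Variable phi : chart P F -> P -> F -> R.
Hypothesis hphi : is_connection AP act phi.

Let sS := @S1_smooth_atlas R.

Let sR : smooth_atlas (@model_atlas _ R).
Proof. exact: model_smooth_atlas. Qed.

Let sR2 : smooth_atlas (@model_atlas _ (R * R)%type).
Proof. by apply: model_smooth_atlas; exact: findim_prod. Qed.

Local Notation smooth_curve := (msmooth_at (@model_atlas _ R) AP).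

Lemma prj_smooth p : msmooth_at AP AM prj p.
Proof.
have [sp _ _ _ _] := hprj.
exact: ((morphism_onP sP sM prj openT).1 sp p I).
Qed.

Lemma act_smooth pz :
  msmooth_at (prod_atlas AP (@S1_atlas R)) AP (fun qw => act qw.1 qw.2) pz.
Proof.
have [_ sa _ _ _] := hprj.
exact: ((morphism_onP (prod_smooth_atlas sP sS) sP _ openT).1 sa pz I).
Qed.

Lemma prj_act p z : prj (act p z) = prj p.
Proof. by have [_ _ _ pa _] := hprj. Qed.

Lemma act_expi0 p : act p (expi 0) = p.
Proof. by have [_ _ [a1 _] _ _] := hprj; rewrite expi0. Qed.

Lemma act_expiD p s t : act (act p (expi s)) (expi t) = act p (expi (s + t)).
Proof. by have [_ _ [_ aM] _ _] := hprj; rewrite aM -expiD. Qed.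

Lemma trivialization m : exists U Phi Psi, [/\ open U, U m,
  (forall p, U (prj p) -> msmooth_at AP (prod_atlas AM (@S1_atlas R)) Phi p),
  (forall q z, U q -> msmooth_at (prod_atlas AM (@S1_atlas R)) AP Psi (q, z)) &
  [/\ forall p, U (prj p) -> (Phi p).1 = prj p,
      forall p, U (prj p) -> Psi (Phi p) = p,
      forall q z, U q -> prj (Psi (q, z)) = q &
      forall p w, U (prj p) ->
        Phi (act p w) = (prj p, S1_mul (Phi p).2 w)]].
Proof.
have [_ _ _ _ /(_ m)[U [Phi [Psi [oU Um sPhi sPsi [H1 H2 H3 H4]]]]]] := hprj.
have oprj : open (prj @^-1` U).
  rewrite openE => p Up; apply: (prj_smooth p).1; exact: open_nbhs_nbhs.
have oUT : open (U `*` [set: S1 R]).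
  rewrite openE => -[q z] [/= Uq _]; exists (U, setT) => //.
  by split; [exact: open_nbhs_nbhs|exact: filterT].
exists U, Phi, Psi; split=> //.
- exact: ((morphism_onP sP (prod_smooth_atlas sM sS) Phi oprj).1 sPhi).
- move=> q z Uq.
  exact: ((morphism_onP (prod_smooth_atlas sM sS) sP Psi oUT).1 sPsi).
- by split=> // q z Uq; exact: (H3 q z Uq).1.
Qed.

Lemma act_free p s t : act p (expi s) = act p (expi t) -> expi s = expi t.
Proof.
have [U [Phi [Psi [_ Up _ _ [_ _ _ H4]]]]] := trivialization (prj p).
move=> /(congr1 Phi); rewrite !H4 // => /(congr1 snd) /=.
have [r <-] := expi_surj (Phi p).2; rewrite -!expiD => /expi_eq[m mE].
by apply/expi_eq; exists m; rewrite -mE opprD addrACA subrr add0r.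
Qed.

Lemma act_transitive p p' : prj p = prj p' -> exists s, p' = act p (expi s).
Proof.
move=> pp'; have [U [Phi [Psi [_ Up _ _ [H1 H2 _ H4]]]]] := trivialization (prj p).
have [a Ea] := expi_surj (Phi p).2; have [b Eb] := expi_surj (Phi p').2.
exists (b - a); rewrite -[LHS]H2 -?pp' // -[RHS]H2 ?prj_act // H4 //.
have Up' : U (prj p') by rewrite -pp'.
by rewrite -Ea -expiD addrC subrK Eb pp' -(H1 p' Up') -surjective_pairing.
Qed.

Lemma act_expi_smooth (gamma : R -> P) (theta : R -> R) t :
  smooth_curve gamma t -> smooth_at t theta ->
  smooth_curve (fun s => act (gamma s) (expi (theta s))) t.
Proof.
move=> sg st.
apply: (@msmooth_at_comp _ _ _ _ _ _ _ _ _ _ sR (prod_smooth_atlas sP sS) sP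
  (fun s => (gamma s, expi (theta s))) (fun qw => act qw.1 qw.2)); last first.
  exact: act_smooth.
apply: msmooth_at_pair => //.
apply: (@msmooth_at_comp _ _ _ _ _ _ _ _ _ _ sR sR sS theta (@expi R)).
  exact/msmooth_at_model.
exact: expi_smooth.
Qed.

Lemma act_right_smooth z p : msmooth_at AP AP (act^~ z) p.
Proof.
apply: (@msmooth_at_comp _ _ _ _ _ _ _ _ _ _ sP (prod_smooth_atlas sP sS) sP
  (fun q => (q, z)) (fun qw => act qw.1 qw.2)); last exact: act_smooth.
by apply: msmooth_at_pair => //; [exact: msmooth_at_id|exact: msmooth_at_cst].
Qed.

(** ** The surface swept by a curve under the circle action *)

Definition sweep (gamma : R -> P) (u : R * R) : P := act (gamma u.2) (expi u.1).

Lemma sweep_smooth gamma u : smooth_curve gamma u.2 ->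
  msmooth_at (@model_atlas _ (R * R)%type) AP (sweep gamma) u.
Proof.
move=> sg.
apply: (@msmooth_at_comp _ _ _ _ _ _ _ _ _ _ sR2 (prod_smooth_atlas sP sS) sP
  (fun u => (gamma u.2, expi u.1)) (fun qw => act qw.1 qw.2)); last first.
  exact: act_smooth.
apply: msmooth_at_pair => //.
  exact (msmooth_at_comp sR2 sR sP ((msmooth_at_model _ _).2 (smooth_at_snd u)) sg).
exact (msmooth_at_comp sR2 sR sS ((msmooth_at_model _ _).2 (smooth_at_fst u))
  (expi_smooth u.1)).
Qed.

Lemma curve_chart gamma t y : smooth_curve gamma t -> AP y ->
  cdom y (gamma t) -> smooth_at t (cmap y \o gamma).
Proof.
move=> sg Ay yp.
exact (@msmooth_at_chart _ _ _ _ _ _ _ sR sP gamma t (Chart setT id id) y sg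
  erefl Ay I yp).
Qed.

Lemma sweep_chart gamma u y : smooth_curve gamma u.2 -> AP y ->
  cdom y (sweep gamma u) -> smooth_at u (cmap y \o sweep gamma).
Proof.
move=> /sweep_smooth sg Ay yp.
exact (@msmooth_at_chart _ _ _ _ _ _ _ sR2 sP _ u (Chart setT id id) y sg
  erefl Ay I yp).
Qed.

Lemma sweep_derive1 gamma u y : smooth_curve gamma u.2 -> AP y ->
  cdom y (sweep gamma u) ->
  'D_(1, 0) (cmap y \o sweep gamma) u =
  velocity y (fun s => act (sweep gamma u) (expi s)) 0.
Proof.
move=> sg Ay yp; have s1 := sweep_chart sg Ay yp.
rewrite derive_fst_var; last exact: smooth_at_derivable.
rewrite /velocity derive1E -[in LHS](addr0 u.1) -derive_translate.
rewrite (_ : (fun s => _) = cmap y \o (fun s => act (sweep gamma u) (expi s))) //.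
by apply/funext => s /=; rewrite /sweep /= act_expiD.
Qed.

Lemma sweep_derive2 gamma u x y : smooth_curve gamma u.2 -> AP x -> AP y ->
  cdom x (gamma u.2) -> cdom y (sweep gamma u) ->
  'D_(0, 1) (cmap y \o sweep gamma) u =
  dmap x y (act^~ (expi u.1)) (gamma u.2) (velocity x gamma u.2).
Proof.
move=> sg Ax Ay xp yp; have s1 := sweep_chart sg Ay yp.
rewrite derive_snd_var; last exact: smooth_at_derivable.
rewrite velocityE.
exact (@dmap_comp _ _ _ _ _ _ _ _ _ _ sR sP sP gamma (act^~ (expi u.1)) u.2
  (Chart setT id id) x y 1 erefl Ax Ay I xp yp sg (act_right_smooth _ _)).
Qed.

(** ** The connection form along a curve *)

Let phi_form : is_one_form AP phi.
Proof. by have [] := hphi. Qed.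

Let chart_at p := sval (cid2 (let: And4 _ _ cov _ := sP in cov p)).

Let chart_atP p : AP (chart_at p) /\ cdom (chart_at p) p.
Proof. by rewrite /chart_at; case: cid2. Qed.

(** [phi] on the velocity of a curve, computed in a chosen chart; the choice does
    not matter ([phi_dotE]). *)
Definition phi_dot (gamma : R -> P) (t : R) : R :=
  phi (chart_at (gamma t)) (gamma t) (velocity (chart_at (gamma t)) gamma t).

Lemma velocity_change gamma t x y : smooth_curve gamma t -> AP x -> AP y ->
  cdom x (gamma t) -> cdom y (gamma t) ->
  velocity y gamma t = dmap x y id (gamma t) (velocity x gamma t).
Proof.
move=> sg Ax Ay xp yp; rewrite !velocityE.
exact (@dmap_comp _ _ _ _ _ _ _ _ _ _ sR sP sP gamma id t
  (Chart setT id id) x y 1 erefl Ax Ay I xp yp sg (msmooth_at_id _ sP)).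
Qed.

Lemma phi_dotE gamma t x : smooth_curve gamma t -> AP x -> cdom x (gamma t) ->
  phi x (gamma t) (velocity x gamma t) = phi_dot gamma t.
Proof.
move=> sg Ax xp; have [Ay yp] := chart_atP (gamma t).
rewrite /phi_dot (velocity_change sg Ax Ay xp yp).
by have [_ inv _] := phi_form; rewrite inv.
Qed.

Lemma phi_dot_near gamma gamma' t : (\forall s \near t, gamma s = gamma' s) ->
  phi_dot gamma t = phi_dot gamma' t.
Proof.
move=> gg'; rewrite /phi_dot (nbhs_singleton gg'); congr (phi _ _ _).
rewrite /velocity !derive1E; apply: near_eq_derive.
by apply: filterS gg' => s /= ->.
Qed.

(** The gauge formula: the vertical part of the velocity contributes [theta'] as
    [phi] is 1 on the generator, the rest is transported by equivariance. *)
Lemma phi_dot_act gamma theta t : smooth_curve gamma t -> smooth_at t theta ->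
  phi_dot (fun s => act (gamma s) (expi (theta s))) t =
  phi_dot gamma t + 'D_1 theta t.
Proof.
move=> sg st; set eta := fun s => _; pose u := (theta t, t).
have [Ax xp] := chart_atP (gamma t); have [Ay yp] := chart_atP (eta t).
set x := chart_at _ in Ax xp; set y := chart_at _ in Ay yp.
have seta : smooth_curve eta t by exact: act_expi_smooth.
have s1 : smooth_at u (cmap y \o sweep gamma) by exact: sweep_chart.
have [lin inv _] := phi_form; have [_ vert equi] := hphi.
rewrite /phi_dot -/x -/y; have -> : velocity y eta t =
    'D_1 theta t *: 'D_(1, 0) (cmap y \o sweep gamma) u +
    'D_(0, 1) (cmap y \o sweep gamma) u.
  rewrite /velocity derive1E.
  have st2 : smooth_at t (fun s => (theta s, s)).
    by apply: smooth_at_pair => //; exact: smooth_at_id.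
  have fR2 : findim (R * R)%type by exact: findim_prod.
  have [fF _ _ _] := sP.
  have -> : 'D_1 (cmap y \o eta) t =
      'D_('D_1 (fun s => (theta s, s)) t) (cmap y \o sweep gamma) u.
    exact (@derive_comp _ _ _ _ fR2 fF t 1 (fun s => (theta s, s))
      (cmap y \o sweep gamma) st2 s1).
  have -> : 'D_1 (fun s => (theta s, s)) t = ('D_1 theta t, 1).
    have d1 := derivableP (@smooth_at_derivable _ _ _ t 1 theta st).
    by have [_ ->] := is_derive_pair d1 (is_derive_id t 1).
  rewrite (@derive_linear_basis _ _ fF u _ _ s1) /=.
  by rewrite scale1r.
rewrite lin // -[eta t]/(sweep gamma u).
rewrite (sweep_derive1 (u := u) sg Ay yp) vert // mulr1 addrC; congr (_ + _).
by rewrite (sweep_derive2 (u := u) sg Ax Ay xp yp) equi.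
Qed.

Lemma phi_dot_smooth gamma t0 : (\forall t \near t0, smooth_curve gamma t) ->
  smooth_at t0 (phi_dot gamma).
Proof.
move=> ng; have sg := nbhs_singleton ng.
have [fF cP _ _] := sP; have [lin _ sphi] := phi_form.
have [Ax xp] := chart_atP (gamma t0); set x := chart_at _ in Ax xp.
have cx := cP x Ax; have s1 := curve_chart sg Ax xp.
have [m [e [l [cl el]]]] := @findimP _ _ fF.
have sum q (a : 'I_m -> R) : cdom x q ->
    phi x q (\sum_i a i *: e i) = \sum_i a i * phi x q (e i).
  move=> xq; elim/big_rec2: _ => [|i y v _ <-]; last exact: lin.
  have := lin x q 1 0 0 Ax xq; rewrite scaler0 addr0 mul1r.
  by move=> /esym/(canRL (addrK _)); rewrite subrr.
have s2 : smooth_at t0 (fun t => \sum_i l i ('D_1 (cmap x \o gamma) t) *: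
    ((fun u => phi x (cinv x u) (e i)) \o (cmap x \o gamma)) t).
  apply: smooth_at_sum => i; apply: smooth_at_scale.
    apply: (@smooth_at_comp _ _ _ _ fF _ t0 ('D_1 (cmap x \o gamma)) (l i)).
      exact: smooth_at_derive.
    exact: smooth_at_linear.
  apply: (@smooth_at_comp _ _ _ _ fF _ t0 (cmap x \o gamma)) => //.
  exists (cim x); split; [by case: cx|exact: chart_cim|exact: sphi].
apply: smooth_at_near s2.
have nx : \forall t \near t0, cdom x (gamma t).
  by apply: sg.1; exact: chart_dom.
apply: filterS2 ng nx => t sgt xt.
rewrite -(phi_dotE sgt Ax xt) /velocity derive1E [X in phi _ _ X]el sum //.
by apply: eq_bigr => i _; rewrite /= chartK.
Qed.

Section Lifts.
Variable c : R -> M.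
Hypothesis sc : forall t, msmooth_at (@model_atlas _ R) AM c t.

Definition hlift (eta : R -> P) (t : R) : Prop :=
  [/\ smooth_curve eta t, prj (eta t) = c t & phi_dot eta t = 0].

Lemma near_ball (t : R) (A : set R) : nbhs t A ->
  exists2 e, 0 < e & forall s, `|s - t| < e -> A s.
Proof.
move=> /nbhs_ballP[e /= e0 eA]; exists e => // s se.
by apply: eA; rewrite -ball_normE /= distrC.
Qed.

Lemma ball_near (t e : R) : 0 < e -> \forall s \near t, `|s - t| < e.
Proof.
move=> e0; apply/nbhs_ballP; exists e => // s.
by rewrite -ball_normE /= distrC.
Qed.

Lemma hlift_near eta eta' t : (\forall s \near t, eta s = eta' s) ->
  hlift eta t -> hlift eta' t.
Proof.
move=> ee [s1 p1 d1]; split.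
- exact: msmooth_at_near ee s1.
- by rewrite -(nbhs_singleton ee).
- by rewrite -(phi_dot_near ee).
Qed.

Lemma hlift_act eta t s : hlift eta t -> hlift (fun r => act (eta r) (expi s)) t.
Proof.
move=> [s1 p1 d1]; split.
- by apply: act_expi_smooth => //; exact: smooth_at_cst.
- by rewrite prj_act.
- rewrite (@phi_dot_act eta (cst s)) ?d1 ?add0r //; last exact: smooth_at_cst.
  exact: derive_cst.
Qed.

(** In a trivialization the curve lifts to [sigma]; the lift rotated by an angle
    [theta] is horizontal when [theta' = - phi (sigma')], which an integral
    solves. *)
Lemma local_lift t0 p0 : prj p0 = c t0 -> exists2 e, 0 < e &
  exists eta, eta t0 = p0 /\ forall t, `|t - t0| < e -> hlift eta t.
Proof.
move=> p0c.
have [U [Phi [Psi [oU Up sPhi sPsi [H1 H2 H3 H4]]]]] := trivialization (c t0).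
pose sigma t := Psi (c t, (Phi p0).2).
have ss t : U (c t) -> smooth_curve sigma t.
  move=> Ut; apply: (@msmooth_at_comp _ _ _ _ _ _ _ _ _ _ sR
    (prod_smooth_atlas sM sS) sP (fun t => (c t, (Phi p0).2)) Psi).
    by apply: msmooth_at_pair => //; exact: msmooth_at_cst.
  exact: sPsi.
have nU : \forall t \near t0, U (c t).
  by apply: (sc t0).1; exact: open_nbhs_nbhs.
have [V [oV Vt0 sV]] : smooth_at t0 (phi_dot sigma).
  by apply: phi_dot_smooth; apply: filterS nU => t /ss.
have [e e0 eP] : exists2 e, 0 < e & forall t, `|t - t0| <= e -> V t /\ U (c t).
  have [d d0 dP] := near_ball (filterI (open_nbhs_nbhs (conj oV Vt0)) nU).
  exists (d / 2); first by rewrite divr_gt0.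
  move=> t td; apply: dP; apply: (le_lt_trans td).
  by rewrite ltr_pdivrMr // ltr_pMr // ltr1n.
have inI t : t \in `]t0 - e, t0 + e[ = (`|t - t0| < e) by rewrite in_itv /= ltr_distl.
have [A dA] : exists A : R -> R, forall t, t \in `]t0 - e, t0 + e[ ->
    is_derive t 1 A (phi_dot sigma t).
  apply: primitive_exists; first by rewrite ltrD2l gtrN.
  move=> t; rewrite in_itv /= -ler_distl => /eP[Vt _].
  exact: Ck_continuous (sV 0%N) Vt.
have sA : smooth_on [set t | `|t - t0| < e] A.
  move=> k; apply: CkW; apply: (@Ck_primitive _ _ _ _ A (phi_dot sigma)).
  - rewrite (_ : [set _ | _] = `]t0 - e, t0 + e[%classic); first exact: interval_open.
    by apply/seteqP; split=> t; rewrite /= inI.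
  - by move=> t /=; rewrite -inI; exact: dA.
  - by apply: Ck_subset (sV k) => t /ltW /eP[].
exists e => //; exists (fun t => act (sigma t) (expi (A t0 - A t))); split.
  rewrite subrr act_expi0 /sigma -p0c -H1 ?p0c // -surjective_pairing.
  by rewrite H2 // p0c.
move=> t te; have [Vt Ut] := eP t (ltW te).
have sAt : smooth_at t A.
  exists [set t | `|t - t0| < e]; split => //.
  rewrite (_ : [set _ | _] = `]t0 - e, t0 + e[%classic); first exact: interval_open.
  by apply/seteqP; split=> r; rewrite /= inI.
have st : smooth_at t (fun s => A t0 - A s).
  by apply: smooth_at_add; [exact: smooth_at_cst|exact: smooth_at_opp].
split.
- by apply: act_expi_smooth => //; exact: ss.
- by rewrite prj_act /sigma H3.
rewrite phi_dot_act //; last exact: ss.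
have dAt : is_derive t 1 A (phi_dot sigma t) by apply: dA; rewrite inI.
have dB : is_derive t (1 : R) (fun s => A t0 - A s) (- phi_dot sigma t).
  by have := is_deriveB (is_derive_cst (A t0) t 1) dAt; rewrite sub0r.
by have [_ ->] := dB; rewrite subrr.
Qed.

End Lifts.

(** [Q] holds on a set open and closed in the interval, which is connected. *)
Lemma locally_constant (a b : R) (Q : R -> Prop) :
  (forall t0, t0 \in `[a, b] -> exists2 e, 0 < e &
     forall s t, s \in `[a, b] -> t \in `[a, b] ->
       `|s - t0| < e -> `|t - t0| < e -> Q s -> Q t) ->
  forall s t, s \in `[a, b] -> t \in `[a, b] -> Q s -> Q t.
Proof.
move=> H s t sab tab Qs.
suff QE : [set r | r \in `[a, b] /\ Q r] = `[a, b]%classic.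
  have : `[a, b]%classic t by [].
  by rewrite -QE => -[].
apply: (@segment_connected _ a b).
- by exists s.
- exists (interior [set r | r \in `[a, b] -> Q r]); first exact: open_interior.
  apply/seteqP; split=> [r [rab Qr]|r [rab Ir]]; last first.
    by split => //; exact: (interior_subset Ir).
  split => //; have [e e0 eP] := H r rab.
  apply: filterS (ball_near r e0) => x xe xab.
  by apply: (eP r x) => //; rewrite subrr normr0.
- exists (~` (interior [set r | r \in `[a, b] -> ~ Q r])).
    by rewrite closedC; exact: open_interior.
  apply/seteqP; split=> [r [rab Qr]|r [rab Ir]].
    by split => // Ir; exact: (interior_subset Ir).
  split => //; apply: contrapT => nQ; apply: Ir.
  have [e e0 eP] := H r rab.
  apply: filterS (ball_near r e0) => x xe xab Qx; apply: nQ.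
  by apply: (eP x r) => //; rewrite subrr normr0.
Qed.

(** Two horizontal curves over the same curve differ by a rotation whose angle
    has zero derivative. *)
Lemma horizontal_unique (a b : R) (eta1 eta2 : R -> P) :
  (forall t, t \in `[a, b] -> [/\ smooth_curve eta1 t, smooth_curve eta2 t
     & prj (eta1 t) = prj (eta2 t)]) ->
  (forall t, t \in `]a, b[ -> phi_dot eta1 t = 0 /\ phi_dot eta2 t = 0) ->
  forall s t, s \in `[a, b] -> t \in `[a, b] ->
    eta1 s = eta2 s -> eta1 t = eta2 t.
Proof.
move=> H1 H2; apply: locally_constant => t0 t0ab.
have [s1 s2 p12] := H1 t0 t0ab.
have [U [Phi [Psi [oU Up sPhi sPsi [T1 T2 T3 T4]]]]] :=
  trivialization (prj (eta1 t0)).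
have Up2 : U (prj (eta2 t0)) by rewrite -p12.
have zsmooth eta : smooth_curve eta t0 -> U (prj (eta t0)) ->
    msmooth_at (@model_atlas _ R) (@S1_atlas R) (fun t => (Phi (eta t)).2) t0.
  move=> se Ue; have sPe := msmooth_at_comp sR sP (prod_smooth_atlas sM sS) se
    (sPhi _ Ue).
  exact (msmooth_at_comp sR (prod_smooth_atlas sM sS) sS sPe
    (msmooth_at_snd sM sS _)).
have angle eta : smooth_curve eta t0 -> U (prj (eta t0)) ->
    exists theta : R -> R, smooth_at t0 theta /\
      \forall t \near t0, expi (theta t) = (Phi (eta t)).2.
  move=> se Ue; have sz := zsmooth eta se Ue; have [_ cS1 covS1 _] := sS.
  have [w Aw wz] := covS1 (Phi (eta t0)).2.
  exists (fun t => cmap w (Phi (eta t)).2); split.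
    exact (@msmooth_at_chart _ _ _ _ _ _ _ sR sS _ t0 (Chart setT id id) w sz
      erefl Aw I wz).
  have nw : \forall t \near t0, cdom w (Phi (eta t)).2.
    exact: sz.1 _ (chart_dom (cS1 w Aw) wz).
  by apply: filterS nw => t; exact: section_cmap Aw.
have [th1 [sth1 nth1]] := angle eta1 s1 Up.
have [th2 [sth2 nth2]] := angle eta2 s2 Up2.
pose theta t := th2 t - th1 t.
have sth : smooth_at t0 theta by apply: smooth_at_add => //; exact: smooth_at_opp.
have nU : \forall t \near t0, U (prj (eta1 t)).
  have c1 : {for t0, continuous (prj \o eta1)}.
    by apply: continuous_for_comp; [exact: s1.1|exact: (prj_smooth _).1].
  by apply: c1; exact: open_nbhs_nbhs.
have [e e0 eP] := near_ball (filterI (filterI nth1 nth2)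
  (filterI nU (smooth_at_open sth))).
have rot t : t \in `[a, b] -> `|t - t0| < e ->
    eta2 t = act (eta1 t) (expi (theta t)).
  move=> tab /eP[[E1 E2'] [Ut _]]; have [_ _ pt] := H1 t tab.
  have Ut2 : U (prj (eta2 t)) by rewrite -pt.
  rewrite -[LHS]T2 // -[RHS]T2 ?prj_act // T4 // -E1 -expiD.
  by rewrite /theta addrC subrK E2' pt -(T1 (eta2 t) Ut2) -surjective_pairing.
have dth t : t \in `]a, b[ -> `|t - t0| < e -> is_derive t 1 theta 0.
  move=> tab te; have tab' := subset_itv_oo_cc tab.
  have [_ [_ sth_t]] := eP t te; have [s1t s2t _] := H1 t tab'.
  have nrot : \forall r \near t, eta2 r = act (eta1 r) (expi (theta r)).
    have n1 : \forall r \near t, r \in `]a, b[ by exact: near_in_itvoo.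
    have n2 : \forall r \near t, `|r - t0| < e.
      have := @ball_near t (e - `|t - t0|); rewrite subr_gt0 => /(_ te).
      apply: filterS => r; rewrite ltrBrDr; apply: le_lt_trans.
      by rewrite -[r - t0](subrKA t) ler_normD.
    by apply: filterS2 n1 n2 => r /subset_itv_oo_cc; exact: rot.
  have := phi_dot_near nrot; rewrite phi_dot_act //.
  have [-> ->] := H2 t tab; rewrite add0r => E0.
  by split; [exact: smooth_at_derivable|rewrite -E0].
exists e => // s t sab tab se te Es.
have th_const (x y : R) : x < y -> x \in `[a, b] -> y \in `[a, b] ->
    `|x - t0| < e -> `|y - t0| < e -> theta x = theta y.
  move=> xy; rewrite !in_itv /= => /andP[ax xb] /andP[ay yb].
  rewrite !ltr_distl => /andP[x1 x2] /andP[y1 y2].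
  have dxy r : r \in `]x, y[ -> is_derive r 1 theta 0.
    rewrite in_itv /= => /andP[xr ry]; apply: dth.
      by rewrite in_itv /= (le_lt_trans ax xr) (lt_le_trans ry yb).
    by rewrite ltr_distl (lt_trans x1 xr) (lt_trans ry y2).
  have cxy : {within `[x, y], continuous theta}.
    apply: continuous_in_subspaceT => r /set_mem /=; rewrite in_itv /= => /andP[xr ry].
    apply: smooth_at_continuous; apply: (eP r _).2.2.
    by rewrite ltr_distl (lt_le_trans x1 xr) (le_lt_trans ry y2).
  have [r _ E0] := MVT xy dxy cxy.
  by apply/eqP; rewrite eq_sym -subr_eq0 E0 mul0r.
have thst : theta s = theta t.
  have [st|ts|->//] := ltgtP s t; first exact: th_const.
  by apply: esym; exact: th_const.
have es : expi (theta s) = expi 0.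
  by apply: (@act_free (eta1 s)); rewrite -rot // act_expi0.
by rewrite [RHS]rot // -thst es act_expi0.
Qed.

Lemma fiber_nonempty m : exists p, prj p = m.
Proof.
have [U [Phi [Psi [_ Um _ _ [_ _ H3 _]]]]] := trivialization m.
by exists (Psi (m, S1_one R)); exact: H3.
Qed.

Section GlobalLift.
Variable c : R -> M.
Hypothesis sc : forall t, msmooth_at (@model_atlas _ R) AM c t.

Lemma hlift_unique eta1 eta2 (a b : R) :
  (forall t, t \in `[a, b] -> hlift c eta1 t /\ hlift c eta2 t) ->
  forall s t, s \in `[a, b] -> t \in `[a, b] ->
    eta1 s = eta2 s -> eta1 t = eta2 t.
Proof.
move=> H; apply: horizontal_unique => t tab.
  by have [[s1 p1 _] [s2 p2 _]] := H t tab; split; rewrite ?p1.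
by have [[_ _ d1] [_ _ d2]] := H t (subset_itv_oo_cc tab).
Qed.

Lemma hlift_agree eta1 eta2 (s t : R) :
  (forall r, Num.min s t <= r <= Num.max s t ->
     hlift c eta1 r /\ hlift c eta2 r) ->
  eta1 s = eta2 s -> eta1 t = eta2 t.
Proof.
move=> H; apply: (@hlift_unique _ _ (Num.min s t) (Num.max s t)).
- by move=> r; rewrite in_itv /= => /H.
- by rewrite in_itv /= ge_min le_max !lexx.
- by rewrite in_itv /= ge_min le_max !lexx !orbT.
Qed.

(** Consider the supremum of the points up to which the lift extends.  A local lift
    at the supremum, rotated so as to meet the given one, extends it further. *)
Lemma lift_segment (a b : R) p0 : a <= b -> prj p0 = c a ->
  exists2 d, 0 < d & exists eta, eta a = p0 /\
    forall t, a - d < t -> t < b + d -> hlift c eta t.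
Proof.
move=> ab p0a.
pose good x := exists2 d, 0 < d & exists eta, eta a = p0 /\
  forall t, a - d < t -> t < x + d -> hlift c eta t.
pose S := [set x | a <= x <= b /\ good x].
have Sa : S a.
  split; first by rewrite lexx.
  have [e e0 [eta [E0 He]]] := local_lift sc p0a.
  exists e => //; exists eta; split => // t t1 t2; apply: He.
  by rewrite ltr_distl t1.
have supS : has_sup S.
  by split; [exists a|exists b => x [/andP[]]].
pose T := sup S.
have [p pT] := fiber_nonempty (c T).
have [e e0 [etaT [_ HT]]] := local_lift sc pT.
have [x [/andP[ax xb] [d d0 [eta [Ea He]]]] xT] := sup_adherent e0 supS.
have xleT : x <= T.
  by apply: (sup_upper_bound supS); split; [rewrite ax|exists d => //; exists eta].
have xe : `|x - T| < e by rewrite ltr_distl xT /= (le_lt_trans xleT) // ltrDl.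
have [hs hp hd] := HT x xe.
have [s sE] : exists s, eta x = act (etaT x) (expi s).
  have [_ px _] : hlift c eta x.
    by apply: He; rewrite ?ltrDl // (lt_le_trans _ ax) // gtrBl.
  by apply: act_transitive; rewrite hp.
pose etaT' t := act (etaT t) (expi s).
have HT' t : `|t - T| < e -> hlift c etaT' t by move=> te; exact/hlift_act/HT.
pose eta' t := if t <= x then eta t else etaT' t.
have He' t : a - d < t -> t < T + e -> hlift c eta' t.
  move=> t1 t2; have [tx|xt|tx] := ltgtP t x.
  - apply: (@hlift_near _ eta).
      have n : \forall r \near t, r < x by exact: lt_nbhsl.
      by apply: filterS n => r rx; rewrite /eta' ltW.
    by apply: He => //; rewrite (lt_trans tx) // ltrDl.
  - apply: (@hlift_near _ etaT').
      have n : \forall r \near t, x < r by exact: lt_nbhsr.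
      by apply: filterS n => r rx; rewrite /eta' leNgt rx.
    by apply: HT'; rewrite ltr_distl (lt_trans xT xt).
  apply: (@hlift_near _ etaT'); last by apply: HT'; rewrite tx.
  pose m := Num.min d (Num.min e (x - (T - e))).
  have m0 : 0 < m by rewrite !lt_min d0 e0 subr_gt0.
  rewrite tx; apply: filterS (ball_near x m0) => r.
  rewrite ltr_distl => /andP[r1 r2].
  have mle : [/\ m <= d, m <= e & m <= x - (T - e)].
    by split; rewrite /m !ge_min lexx ?orbT.
  have [m1 m2 m3] := mle.
  rewrite /eta'; case: leP => // rx.
  apply/esym; apply: (@hlift_agree _ _ x r) => // q.
  rewrite (min_idPr rx) (max_idPl rx) => /andP[q1 q2]; split.
    by apply: He; move: q1 q2 r1 m1 ax d0; lra.
  by apply: HT'; rewrite ltr_distl; apply/andP; split; move: q1 q2 r1 m3 xleT e0; lra.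
pose T' := Num.min b (T + e / 2).
have goodT' : good T'.
  exists (Num.min d (e / 2)); first by rewrite lt_min d0 divr_gt0.
  exists eta'; split; first by rewrite /eta' ax.
  have [l1 l2] : Num.min d (e / 2) <= d /\ Num.min d (e / 2) <= e / 2.
    by split; rewrite ge_min lexx ?orbT.
  have l3 : T' <= T + e / 2 by rewrite ge_min lexx orbT.
  by move=> t t1 t2; apply: He'; move: t1 t2 l1 l2 l3; lra.
have aT' : a <= T' <= b.
  rewrite le_min ab ge_min lexx /= andbT.
  by rewrite (le_trans ax) // (le_trans xleT) // lerDl divr_ge0 // ltW.
have T'T : T' <= T by apply: (sup_upper_bound supS); split.
suff <- : T' = b by [].
rewrite /T'; case: leP => // bT; exfalso; move: T'T; rewrite /T' (min_idPr (ltW bT)).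
by move: e0; lra.
Qed.

(** The lifts on the segments [-N, N] with a common value at 0 agree with each
    other, hence glue. *)
Lemma global_lift : exists eta, forall t, hlift c eta t.
Proof.
have [p0 p0c] := fiber_nonempty (c 0).
have step (N : nat) : exists eta, eta 0 = p0 /\
    forall t, `|t| <= N%:R -> hlift c eta t.
  have [q qc] := fiber_nonempty (c (- N%:R)).
  have NN : - N%:R <= N%:R :> R by rewrite ge0_cp.
  have [d d0 [eta [_ He]]] := lift_segment NN qc.
  have He' t : `|t| <= N%:R -> hlift c eta t.
    by rewrite ler_norml => /andP[t1 t2]; apply: He; move: t1 t2 d0; lra.
  have [s sE] : exists s, p0 = act (eta 0) (expi s).
    have [_ e0 _] : hlift c eta 0 by apply: He'; rewrite normr0.
    by apply: act_transitive; rewrite e0.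
  exists (fun t => act (eta t) (expi s)); split => // t tN.
  exact/hlift_act/He'.
have [f fP] := choice step.
have agree N N' t : `|t| <= N%:R -> `|t| <= N'%:R -> f N t = f N' t.
  move=> tN tN'; apply: (@hlift_agree _ _ 0 t); last by rewrite !(fP _).1.
  move=> r rt0; have rt : `|r| <= `|t|.
    move: rt0; have [t0|t0] := leP 0 t.
      by move=> /andP[r0 rt]; rewrite !ger0_norm.
    by move=> /andP[tr r0]; rewrite (ler0_norm r0) (ltr0_norm t0) lerN2.
  by split; apply: (fP _).2; exact: le_trans rt _.
pose eta t := f (Num.truncn `|t|).+1 t.
exists eta => t; pose N := (Num.truncn `|t|).+2.
have tN (r : R) : `|r| <= (Num.truncn `|r|).+1%:R by exact/ltW/truncnS_gt.
apply: (@hlift_near _ (f N)); last first.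
  by apply: (fP N).2; rewrite (le_trans (tN t)) // ler_nat.
apply: filterS (ball_near t ltr01) => r rt.
apply: agree => //; rewrite -(subrK t r) (le_trans (ler_normD _ _)) //.
by rewrite /N -natr1 addrC lerD // ltW.
Qed.

End GlobalLift.

End Bundle.

(** * Jordan curves *)

Section JordanCurve.
Context {R : realType} {M : topologicalType} {E : normedModType R}.
Variables (AM : set (chart M E)) (sM : smooth_atlas AM).
Hypothesis hausM : hausdorff_space M.
Variable g : chart M E -> M -> E -> E -> R.
Hypothesis hg : is_riemannian_metric AM g.
Variables (L : R) (c : R -> M).
Hypotheses (hc : is_smooth_jordan_curve AM L c) (hc1 : is_unit_speed AM g c).

Let L0 : 0 < L. Proof. by have [] := hc. Qed.

Let sR : smooth_atlas (@model_atlas _ R).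
Proof. exact: model_smooth_atlas. Qed.

Lemma jordan_smooth t : msmooth_at (@model_atlas _ R) AM c t.
Proof.
have [_ _ _ s] := hc; exact: ((morphism_onP sR sM c openT).1 s t I).
Qed.

Lemma jordan_periodic t (n : int) : c (t + L *~ n) = c t.
Proof.
have [_ per _ _] := hc.
have P k s : c (s + L *+ k) = c s.
  by elim: k s => [|k IH] s; rewrite ?mulr0n ?addr0 // mulrSr addrA per.
case: n => k; first by rewrite -pmulrn P.
by rewrite NegzE mulrNz -pmulrn -{1}(subrK (L *+ k.+1) t) -[in RHS](subrK (L *+ k.+1) t) P
  subrK.
Qed.

Lemma mod_period a t : exists n : int, a <= t - L *~ n < a + L.
Proof.
exists (Num.floor ((t - a) / L)).
have := floor_itv ((t - a) / L); rewrite ler_pdivlMr // ltr_pdivrMr //.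
set n := Num.floor _; have -> : (n + 1)%:~R * L = n%:~R * L + L.
  by rewrite intrD mulrDl mul1r.
rewrite mulrzl => /andP[n1 n2].
by move: (L *~ n) n1 n2 => x n1 n2; apply/andP; split; move: n1 n2; lra.
Qed.

Lemma jordan_eq s t : c s = c t <-> exists n : int, s - t = L *~ n.
Proof.
have [_ _ inj _] := hc; split; last first.
  by move=> [n /eqP]; rewrite subr_eq addrC => /eqP ->; rewrite jordan_periodic.
move=> E0; have [n] := mod_period 0 s; have [m] := mod_period 0 t.
rewrite add0r => tm sn.
have cE (r : R) (k : int) : c (r - L *~ k) = c r.
  by rewrite -mulrNz jordan_periodic.
have := inj _ _ sn tm; rewrite !cE => /(_ E0) e1.
exists (n - m); rewrite mulrzBr.
by move: (L *~ n) (L *~ m) e1 => x y; lra.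
Qed.

Lemma jordan_immersion t y : AM y -> cdom y (c t) -> velocity y c t != 0.
Proof.
move=> Ay yc; apply/eqP => v0; have := hc1 Ay yc.
have [lin _ _ _ _] := hg.
rewrite v0; have := lin y (c t) 1 0 0 0 Ay yc.
rewrite scaler0 addr0 mul1r => /eqP; rewrite -subr_eq0 opprD addrA subrr sub0r.
by rewrite oppr_eq0 => /eqP -> /eqP; rewrite eq_sym oner_eq0.
Qed.

(** The curve is an embedding: some coordinate of the curve has nonzero
    derivative, so it can be inverted along the curve, and compactness keeps the
    remote part of the curve away. *)
Lemma jordan_left_inverse t0 : exists (W : set M) (tau : M -> R),
  [/\ open W, W (c t0),
      forall q, W q -> msmooth_at AM (@model_atlas _ R) tau q,
      \forall t \near t0, tau (c t) = t
    & forall t, W (c t) -> c (tau (c t)) = c t].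
Proof.
have [fE cM covM _] := sM; have [y Ay yc] := covM (c t0).
have cy := cM y Ay; have [m [e [l [cl el]]]] := @findimP _ _ fE.
have sg : smooth_at t0 (cmap y \o c).
  exact (@msmooth_at_chart _ _ _ _ _ _ _ sR sM c t0 (Chart setT id id) y
    (jordan_smooth t0) erefl Ay I yc).
pose v := velocity y c t0.
have [i li0] : exists i, l i v != 0.
  apply: contrapT => /forallNP l0; have := jordan_immersion Ay yc.
  rewrite -/v [v]el big1 ?eqxx // => i _.
  by have /negP := l0 i; rewrite negbK => /eqP ->; rewrite scale0r.
pose f := l i \o (cmap y \o c).
have sf : smooth_at t0 f.
  apply: (@smooth_at_comp _ _ _ _ fE _ t0 (cmap y \o c) (l i)) => //.
  exact: smooth_at_linear.
have f0 : 'D_1 f t0 != 0.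
  have := is_derive_lin (cl i) (derivableP (@smooth_at_derivable _ _ _ t0 1 _ sg)).
  by move=> [_ ->]; rewrite -derive1E.
have [U [oU Ut0 sU]] := sf.
have [V [W' [h [oV Vt0 oW' VW sh]]]] := local_inverse oU Ut0 sU f0.
have [e1 e10 e1P] := near_ball (open_nbhs_nbhs (conj oV Vt0)).
pose eps := Num.min e1 (L / 2).
have eps0 : 0 < eps by rewrite lt_min e10 divr_gt0.
have [epsL epse] : eps <= L / 2 /\ eps <= e1.
  by rewrite /eps; split; rewrite ge_min lexx ?orbT.
pose K := c @` `[t0 + eps, t0 + L - eps].
have cK : closed K.
  apply: compact_closed => //; apply: continuous_compact; last exact: segment_compact.
  by apply: continuous_subspaceT => t; exact: (jordan_smooth t).1.
have nK : ~ K (c t0).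
  move=> [t /=]; rewrite in_itv /= => /andP[t1 t2] /jordan_eq[n E0].
  have n0 : 0 < (n%:~R : R).
    by rewrite -(pmulr_lgt0 _ L0) mulrzl -E0; move: t1 eps0; lra.
  have n1 : (n%:~R : R) < 1.
    by rewrite -(ltr_pM2r L0) mulrzl -E0 mul1r; move: t2 eps0; lra.
  by move: n0 n1; rewrite ltr0z ltrz1; case: n {E0} => // -[].
pose W0 := [set q | cdom y q /\ W' (l i (cmap y q))].
pose tau q := h (l i (cmap y q)).
have slW q : W0 q -> msmooth_at AM (@model_atlas _ R) (l i \o cmap y) q.
  move=> [yq _]; have sy := msmooth_at_cmap sM Ay yq.
  have sE : smooth_atlas (@model_atlas _ E) by exact: model_smooth_atlas.
  apply: (msmooth_at_comp sM sE sR sy).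
  by apply/msmooth_at_model; exact: smooth_at_linear.
have oW0 : open W0.
  rewrite openE => q qW; have [yq Wq] := qW.
  apply: filterI; first exact: chart_dom.
  apply: (slW q qW).1; exact: open_nbhs_nbhs.
have tauV t : V t -> tau (c t) = t by move=> /VW[_].
exists (W0 `&` ~` K), tau; split.
- by apply: openI => //; exact: closed_openC.
- by split => //; split => //; have [] := VW t0 Vt0.
- move=> q [qW _]; have [yq Wq] := qW.
  apply: (msmooth_at_comp sM sR sR (slW q qW)).
  by apply/msmooth_at_model; exists W'.
- by apply: filterS (open_nbhs_nbhs (conj oV Vt0)) => t; exact: tauV.
move=> t [_ Kt]; have [n /andP[n1 n2]] := mod_period (t0 - eps) t.
set s := t - L *~ n in n1 n2.
have cst : c s = c t by rewrite /s -mulrNz jordan_periodic.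
have s1 : s < t0 + eps.
  rewrite ltNge; apply/negP => st; apply: Kt; exists s => //=.
  by rewrite in_itv /= st /= ltW //; move: n2; lra.
have s2 : t0 - eps < s.
  rewrite lt_neqAle n1 andbT; apply/eqP => st; apply: Kt; exists (s + L).
    by rewrite /= in_itv /= -st; move: epsL; lra.
  by have := jordan_periodic s 1; rewrite mulr1z cst.
by rewrite -cst tauV //; apply: e1P; rewrite (lt_le_trans _ epse) // ltr_distl s2.
Qed.

End JordanCurve.

(** * Submanifolds *)

Section Submanifold.
Context {R : realType} {T : topologicalType} {E F : normedModType R}.
Context {fF : findim F}.
Variables (A : set (chart T E)) (S : set T).
Hypothesis sA : smooth_atlas A.

Local Notation AS := (submanifold_atlas (F := F) A (S := S)).

Let sF : smooth_atlas (@model_atlas _ F).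
Proof. exact: model_smooth_atlas. Qed.

Lemma submanifold_inv_smooth x u : AS x -> cim x u ->
  msmooth_at (@model_atlas _ F) A (fun v => set_val (cinv x v)) u.
Proof.
move=> [[_ oi _ _ _] sx _]; exact: ((morphism_onP sF sA _ oi).1 sx u).
Qed.

Lemma submanifold_cmap_smooth x p : AS x -> cdom x p -> exists W h,
  [/\ open W, W (set_val p), forall q, W q -> msmooth_at A (@model_atlas _ F) h q
    & forall q, cdom x q -> W (set_val q) -> cmap x q = h (set_val q)].
Proof.
move=> [_ _ loc] /loc[W [h [oW Wp sh hE]]]; exists W, h; split => //.
by move=> q Wq; exact: ((morphism_onP sA sF _ oW).1 sh q).
Qed.

Lemma submanifold_transition x y p : AS x -> AS y -> cdom x p -> cdom y p ->
  smooth_at (cmap x p) (cmap y \o cinv x).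
Proof.
move=> Ax Ay xp yp; have [cx _ _] := Ax; have [cy _ _] := Ay.
have [W [h [oW Wp sh hE]]] := submanifold_cmap_smooth Ay yp.
have s1 := submanifold_inv_smooth Ax (chart_cim xp).
have Wp' : W (set_val (cinv x (cmap x p))) by rewrite chartK.
have /msmooth_at_model s2 := msmooth_at_comp sF sA sF s1 (sh _ Wp').
have nW : \forall q \near p, W (set_val q).
  by apply: set_val_continuous; exact: open_nbhs_nbhs.
apply: smooth_at_near s2.
apply: filterS (chart_near cx xp (filterI (chart_dom cy yp) nW)) => u [yu Wu].
by rewrite /= hE.
Qed.

Hypothesis covS : forall p, exists2 x, AS x & cdom x p.

Lemma submanifold_smooth_atlas : smooth_atlas AS.
Proof.
by split => //; [move=> x []|exact: submanifold_transition].
Qed.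

Lemma set_val_smooth p : msmooth_at AS A set_val p.
Proof.
have [x Ax xp] := covS p; have [cx _ _] := Ax.
have s1 := submanifold_inv_smooth Ax (chart_cim xp).
have s2 := msmooth_at_cmap submanifold_smooth_atlas Ax xp.
apply: msmooth_at_near (msmooth_at_comp submanifold_smooth_atlas sF sA s2 s1).
  exact: submanifold_smooth_atlas.
by apply: filterS (chart_dom cx xp) => q xq; rewrite /= chartK.
Qed.

(** A chart of the submanifold is locally the restriction of an ambient map, which
    inverts the inclusion. *)
Lemma set_val_immersion x y p u v : AS x -> A y -> cdom x p ->
  cdom y (set_val p) -> dmap x y set_val p u = dmap x y set_val p v -> u = v.
Proof.
move=> Ax Ay xp yp uv; have [cx _ _] := Ax.
have [W [h [oW Wp sh hE]]] := submanifold_cmap_smooth Ax xp.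
have nW : \forall q \near p, W (set_val q).
  by apply: set_val_continuous; exact: open_nbhs_nbhs.
suff H w : w = dmap y (Chart setT id id) h (set_val p) (dmap x y set_val p w).
  by rewrite [LHS]H uv -H.
have <- := @dmap_comp _ _ _ _ _ _ _ _ _ _ submanifold_smooth_atlas sA sF
  set_val h p x y (Chart setT id id) w Ax Ay erefl xp yp I (set_val_smooth p)
  (sh _ Wp).
rewrite /dmap -[LHS](derive_id (cmap x p) w); apply: near_eq_derive.
apply: filterS2 (chart_im cx xp) (chart_near cx xp (filterI (chart_dom cx xp) nW)).
by move=> q xq [dq Wq]; rewrite /= -hE // chart_invK.
Qed.

End Submanifold.

(** * The parametrization of the pullback bundle *)

Section Pullback.
Context {R : realType} {M P : topologicalType} {E F : normedModType R}.
Variables (AM : set (chart M E)) (AP : set (chart P F)).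
Hypotheses (sM : smooth_atlas AM) (sP : smooth_atlas AP).
Hypotheses (hausM : hausdorff_space M) (hausP : hausdorff_space P).
Hypothesis sctP : @second_countable P.
Variable g : chart M E -> M -> E -> E -> R.
Hypothesis hg : is_riemannian_metric AM g.
Variables (prj : P -> M) (act : P -> S1 R -> P).
Hypothesis hprj : is_principal_S1_bundle AM AP prj act.
Variable phi : chart P F -> P -> F -> R.
Hypothesis hphi : is_connection AP act phi.
Variables (L : R) (c : R -> M).
Hypotheses (hc : is_smooth_jordan_curve AM L c) (hc1 : is_unit_speed AM g c).
Variable eta : R -> P.
Hypothesis heta : forall t, hlift sP prj phi c eta t.

Let L0 : 0 < L. Proof. by have [] := hc. Qed.

Let sR : smooth_atlas (@model_atlas _ R).
Proof. exact: model_smooth_atlas. Qed.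

Let sR2 : smooth_atlas (@model_atlas _ (R * R)%type).
Proof. by apply: model_smooth_atlas; exact: findim_prod. Qed.

Local Notation S := (pullback_space prj L c).
Local Notation AS := (pullback_atlas AP prj L c).

Let seta t : msmooth_at (@model_atlas _ R) AP eta t.
Proof. by have [] := heta t. Qed.

Let peta t : prj (eta t) = c t.
Proof. by have [] := heta t. Qed.

Lemma holonomy_exists : exists alpha, eta L = act (eta 0) (expi alpha).
Proof.
apply: (act_transitive sM sP hprj); rewrite !peta -[in RHS](add0r L).
by have [_ -> _ _] := hc.
Qed.

(** The lift translated by [L] is again a horizontal lift of [c], hence a rotation
    of the lift. *)
Lemma eta_periodic alpha t (n : int) : eta L = act (eta 0) (expi alpha) ->
  eta (t + L *~ n) = act (eta t) (expi (alpha *~ n)).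
Proof.
move=> aE.
have step s : eta (L + s) = act (eta s) (expi alpha).
  apply: (@hlift_agree _ _ _ _ _ _ _ sM sP _ _ hprj _ hphi c
    (fun s => eta (L + s)) (fun s => act (eta s) (expi alpha)) 0 s).
    move=> r _; split; last exact (hlift_act hprj hphi alpha (heta r)).
    have [_ p1 d1] := heta (L + r).
    have st : smooth_at r (fun s => L + s).
      by apply: smooth_at_add; [exact: smooth_at_cst|exact: smooth_at_id].
    split.
    - exact (msmooth_at_comp sR sR sP ((msmooth_at_model _ _).2 st) (seta (L + r))).
    - by rewrite p1 addrC; have [_ -> _ _] := hc.
    - rewrite -[RHS]d1 /phi_dot; congr (phi _ _ _).
      rewrite /velocity !derive1E.
      exact: (derive_translate (cmap _ \o eta) L r).
  by rewrite addr0.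
have Pk k s : eta (s + L *+ k) = act (eta s) (expi (alpha *+ k)).
  elim: k s => [|k IH] s; first by rewrite !mulr0n addr0 (act_expi0 hprj).
  by rewrite !mulrS addrCA step IH (act_expiD hprj) addrC.
case: n => k; first by rewrite -!pmulrn Pk.
rewrite NegzE !mulrNz -!pmulrn.
by rewrite -[in RHS](subrK (L *+ k.+1) t) Pk (act_expiD hprj) subrr (act_expi0 hprj).
Qed.

Lemma pullback_mem p : (p \in S) <-> exists t, prj p = c t.
Proof.
rewrite inE; split=> [[t _ tE]|[t tE]]; first by exists t.
have [n /andP[n1 n2]] := mod_period hc 0 t; exists (t - L *~ n).
  by rewrite add0r in n2; rewrite /= n1 /= ltW.
by rewrite tE -mulrNz (jordan_periodic hc).
Qed.

Let param_mem u : sweep act eta u \in S.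
Proof. by apply/pullback_mem; exists u.2; rewrite (prj_act hprj) peta. Qed.

(** The map s1 + i s2 |-> eta(s2) e^{i s1}, which is to be locally biholomorphic. *)
Definition param (u : R * R) : S := SigSub (param_mem u).

Lemma set_val_param u : set_val (param u) = sweep act eta u.
Proof. by []. Qed.

Lemma prj_param u : prj (set_val (param u)) = c u.2.
Proof. by rewrite set_val_param (prj_act hprj) peta. Qed.

Lemma param_over p t : prj (set_val p) = c t -> exists2 u, param u = p & u.2 = t.
Proof.
move=> pt; have [s sE] : exists s, set_val p = act (eta t) (expi s).
  by apply: (act_transitive sM sP hprj); rewrite peta.
by exists (s, t) => //; apply: val_inj; exact: (esym sE).
Qed.

Lemma param_surj p : exists u, param u = p.
Proof.
have [t pt] := (pullback_mem (set_val p)).1 (valP p).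
by have [u <- _] := param_over pt; exists u.
Qed.

(** Along [n] turns of the curve the lift is rotated by [n alpha], which the first
    coordinate compensates up to a multiple of 2 pi. *)
Lemma param_eq alpha u v : eta L = act (eta 0) (expi alpha) ->
  param u = param v <-> lattice (2 * pi)%:C (- alpha +i* L) (cplx (u - v)).
Proof.
move=> aE; apply: iff_trans _ (iff_sym (lattice_coord _ _ _)).
have shift n : u.2 = v.2 + L *~ n ->
    sweep act eta u = act (eta v.2) (expi (alpha *~ n + u.1)).
  by move=> un; rewrite /sweep un (eta_periodic _ _ aE) (act_expiD hprj).
split=> [E0|[m [n [e1 e2]]]].
  have [n nE] : exists n : int, u.2 - v.2 = L *~ n.
    by apply/(jordan_eq hc); rewrite -!prj_param E0.
  have E1 := congr1 set_val E0.
  rewrite !set_val_param (shift n) in E1; last by rewrite -nE addrC subrK.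
  have /expi_eq[m mE] := act_free sM sP hprj E1.
  exists m, n; split => //.
  by rewrite -mE -[LHS]/(u.1 - v.1); ring.
apply: val_inj; rewrite /= (shift n); last by rewrite -e2 /= addrC subrK.
congr act; apply/expi_eq; exists m.
have -> : (2 * pi) *~ m = (u - v).1 + alpha *~ n by rewrite e1 subrK.
by rewrite -[(u - v).1]/(u.1 - v.1); ring.
Qed.

Lemma param_smooth u : msmooth_at (@model_atlas _ (R * R)%type) AP (set_val \o param) u.
Proof. exact (sweep_smooth sP hprj (seta u.2)). Qed.

Lemma param_continuous : continuous param.
Proof. by move=> u; apply: subspace_continuous; have [] := param_smooth u. Qed.

(** The projection to [M] gives the parameter of the curve, and a trivialization
    the angle relative to the lift. *)
Lemma param_left_inverse u0 : exists (W : set P) (h : P -> R * R),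
  [/\ open W, W (set_val (param u0)),
      forall p, W p -> msmooth_at AP (@model_atlas _ (R * R)%type) h p,
      \forall u \near u0, h (set_val (param u)) = u
    & forall p, W (set_val p) -> param (h (set_val p)) = p].
Proof.
case: u0 => a0 t0; pose p0 := set_val (param (a0, t0)).
have pp0 : prj p0 = c t0 by rewrite /p0 prj_param.
have [W1 [tau [oW1 W1c stau tauK tauc]]] :=
  jordan_left_inverse sM hausM hg hc hc1 t0.
have [U [Phi [Psi [oU Uc sPhi _ [T1 T2 _ T4]]]]] := trivialization sM sP hprj (c t0).
pose sS := @S1_smooth_atlas R; have [_ cS1 covS1 _] := sS.
have sMS := prod_smooth_atlas sM sS.
have [w1 Aw1 w1z] := covS1 (Phi p0).2.
have [w2 Aw2 w2z] := covS1 (Phi (eta t0)).2.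
have tau0 : tau (c t0) = t0 by exact: nbhs_singleton tauK.
(* the angle is normalized so that it is [a0] at the base point *)
have [k kE] : exists k : int,
    cmap w1 (Phi p0).2 - cmap w2 (Phi (eta t0)).2 - a0 = (2 * pi) *~ k.
  apply/expi_eq; apply: (act_free sM sP hprj (p := eta t0)).
  have e1 : expi (cmap w1 (Phi p0).2) = (Phi p0).2 by exact: section_cmap Aw1 w1z.
  have e2 : expi (cmap w2 (Phi (eta t0)).2) = (Phi (eta t0)).2.
    exact: section_cmap Aw2 w2z.
  have Ue : U (prj (eta t0)) by rewrite peta.
  set b1 := cmap w1 _ in e1 *; set b2 := cmap w2 _ in e2 *.
  rewrite -[RHS]/p0 -[LHS]T2 ?(prj_act hprj) // T4 // -e2 -expiD.
  rewrite [b2 + _]addrC subrK e1 peta -pp0 -T1 ?pp0 //.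
  by rewrite -surjective_pairing T2 // pp0.
pose ang p := cmap w1 (Phi p).2 - cmap w2 (Phi (eta (tau (prj p)))).2 - (2 * pi) *~ k.
pose h p : R * R := (ang p, tau (prj p)).
pose W := [set p | [/\ W1 (prj p), U (prj p), U (c (tau (prj p))),
  cdom w1 (Phi p).2 & cdom w2 (Phi (eta (tau (prj p)))).2]].
have stp p : W1 (prj p) -> msmooth_at AP (@model_atlas _ R) (tau \o prj) p.
  by move=> Wp; exact (msmooth_at_comp sP sM sR (prj_smooth sM sP hprj p) (stau _ Wp)).
have sz p : U (prj p) -> msmooth_at AP (@S1_atlas R) (fun p => (Phi p).2) p.
  move=> Up; exact (msmooth_at_comp sP sMS sS (sPhi _ Up) (msmooth_at_snd sM sS _)).
have sze p : W1 (prj p) -> U (c (tau (prj p))) ->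
    msmooth_at AP (@S1_atlas R) (fun p => (Phi (eta (tau (prj p)))).2) p.
  move=> Wp Up; have s1 := msmooth_at_comp sP sR sP (stp p Wp) (seta (tau (prj p))).
  have Up' : U (prj (eta (tau (prj p)))) by rewrite peta.
  exact (msmooth_at_comp sP sP sS s1 (sz _ Up')).
have sh p : W p -> msmooth_at AP (@model_atlas _ (R * R)%type) h p.
  move=> [Wp Up Utp w1p w2p].
  have s1 := msmooth_at_comp sP sS sR (sz p Up) (msmooth_at_cmap sS Aw1 w1p).
  have s2 := msmooth_at_comp sP sS sR (sze p Wp Utp) (msmooth_at_cmap sS Aw2 w2p).
  have s12 : msmooth_at AP (@model_atlas _ (R * R)%type)
      (fun q => (cmap w1 (Phi q).2, cmap w2 (Phi (eta (tau (prj q)))).2)) p.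
    exact (msmooth_at_model_pair sP s1 s2).
  have sub u : msmooth_at (@model_atlas _ (R * R)%type) (@model_atlas _ R)
      (fun u => u.1 - u.2 - (2 * pi) *~ k) u.
    apply/msmooth_at_model; apply: smooth_at_add; last exact: smooth_at_cst.
    apply: smooth_at_add; first exact: smooth_at_fst.
    by apply: smooth_at_opp; exact: smooth_at_snd.
  exact (msmooth_at_model_pair sP (msmooth_at_comp sP sR2 sR s12 (sub _)) (stp p Wp)).
have oW : open W.
  rewrite openE => p [Wp Up Utp w1p w2p].
  have n1 : nbhs p (prj @^-1` (W1 `&` U)).
    apply: (prj_smooth sM sP hprj p).1; apply: open_nbhs_nbhs.
    by split; [exact: openI|].
  have n2 : nbhs p ((tau \o prj) @^-1` (c @^-1` U)).
    apply: (stp p Wp).1; apply: (jordan_smooth sM hc _).1.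
    by apply: open_nbhs_nbhs.
  have n3 : \forall q \near p, cdom w1 (Phi q).2.
    exact: (sz p Up).1 _ (chart_dom (cS1 w1 Aw1) w1p).
  have n4 : \forall q \near p, cdom w2 (Phi (eta (tau (prj q)))).2.
    exact: (sze p Wp Utp).1 _ (chart_dom (cS1 w2 Aw2) w2p).
  apply: filterS2 (filterI n1 n2) (filterI n3 n4).
  by move=> q [[Wq Uq] Utq] [w1q w2q].
have Wp0 : W p0.
  by split; rewrite ?pp0 ?tau0.
have QhK p : W (set_val p) -> param (h (set_val p)) = p.
  move=> [Wp Up Utp w1p w2p]; apply: val_inj.
  rewrite /= /sweep /=; set q := set_val p in Wp Up Utp w1p w2p *.
  have [t qt] := (pullback_mem q).1 (valP p).
  have ct : c (tau (prj q)) = prj q by rewrite qt; apply: tauc; rewrite -qt.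
  set s := tau (prj q) in ct w2p Utp *.
  have Ue : U (prj (eta s)) by rewrite peta.
  rewrite -[LHS]T2 ?(prj_act hprj) // T4 // peta ct.
  have -> : expi (ang q) = expi (cmap w1 (Phi q).2 - cmap w2 (Phi (eta s)).2).
    by apply/expi_eq; exists (- k); rewrite /ang -/s mulrNz addrAC subrr add0r.
  have E1 : expi (cmap w1 (Phi q).2) = (Phi q).2 by exact: section_cmap Aw1 w1p.
  have E2 : expi (cmap w2 (Phi (eta s)).2) = (Phi (eta s)).2.
    exact: section_cmap Aw2 w2p.
  set b1 := cmap w1 _ in E1 *; set b2 := cmap w2 _ in E2 *.
  rewrite -E2 -expiD [b2 + _]addrC subrK E1.
  by rewrite -(T1 q Up) -surjective_pairing T2.
exists W, h; split => //.
(* near the base point the angle differs from the first coordinate by a small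
   multiple of 2 pi *)
have nW : \forall u \near (a0, t0), W (set_val (param u)).
  by have [cq _] := param_smooth (a0, t0); apply: cq; exact: open_nbhs_nbhs.
have ntau : \forall u \near (a0, t0), tau (c u.2) = u.2.
  exact: (cvg_snd tauK).
have nang : \forall u \near (a0, t0), `|ang (set_val (param u)) - u.1| < 2 * pi.
  have ca : {for (a0, t0), continuous (fun u => ang (set_val (param u)) - u.1)}.
    have [cq _] := param_smooth (a0, t0); have [ch _] := sh _ Wp0.
    apply: cvgB; last exact: cvg_fst.
    have ch' : {for (a0, t0), continuous (h \o (set_val \o param))}.
      exact: continuous_for_comp cq ch.
    by apply: (@continuous_for_comp _ _ _ _ fst _ ch'); exact: cvg_fst.
  have a00 : ang (set_val (param (a0, t0))) - a0 = 0.
    by rewrite /ang -/p0 pp0 tau0 addrAC kE subrr.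
  have pi0 : 0 < 2 * pi :> R by rewrite mulr_gt0 // pi_gt0.
  apply: (ca [set x | `|x| < 2 * pi]); rewrite /= a00.
  by apply: filterS (ball_near 0 pi0) => x; rewrite subr0.
apply: filterS3 nW ntau nang => u Wu tu angu.
have hE : h (set_val (param u)) = (ang (set_val (param u)), u.2) by rewrite /h prj_param tu.
have := congr1 set_val (QhK _ Wu); rewrite hE.
move=> /(act_free sM sP hprj) /expi_eq[m /= mE].
suff -> : ang (set_val (param u)) = u.1 by rewrite -surjective_pairing.
have m0 : m = 0.
  apply/eqP; apply: contraTT angu => m0; rewrite -leNgt mE -mulrzr normrM.
  rewrite gtr0_norm ?mulr_gt0 ?pi_gt0 // ler_peMr ?mulr_ge0 ?pi_ge0 //.
  by rewrite -intr_norm -[leLHS]/(1%:~R) ler_int -gtz0_ge1 normr_gt0.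
by apply/eqP; rewrite -subr_eq0 mE m0 mulr0z.
Qed.

(** The smooth left inverse is the local extension to the ambient manifold required
    of a chart of a submanifold. *)
Lemma pullback_local_charts : local_charts AS param.
Proof.
move=> u0; have [W [h [oW Wu0 sh hQ Qh]]] := param_left_inverse u0.
have [N [oN Nu0 NK]] : exists N, [/\ open N, N u0 &
    forall u, N u -> h (set_val (param u)) = u].
  exact: ((near_open _ _).1 hQ).
have oV : open [set p | W p /\ N (h p)].
  rewrite openE => p [Wp Np]; apply: filterI; first exact: open_nbhs_nbhs.
  by have [ch _] := sh p Wp; apply: ch; exact: open_nbhs_nbhs.
pose x : chart S (R * R)%type :=
  Chart (set_val @^-1` [set p | W p /\ N (h p)]) (h \o set_val) param.
have iE : cim x = N `&` (set_val \o param) @^-1` W.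
  apply/seteqP; split=> [_ [p [Wp Np] <-]|u [Nu Wu]].
    by split => //; rewrite /= Qh.
  by exists (param u); [split => //; rewrite NK|exact: NK].
have oi : open (cim x).
  rewrite iE; apply: openI => //; apply: open_comp => // u _.
  by have [] := param_smooth u.
have cx : is_chart x.
  split => //.
  - exact: subspace_open.
  - by move=> p [Wp _]; exact: Qh.
  - move=> p [Wp _]; apply: continuous_for_comp; first exact: set_val_continuous.
    by have [] := sh _ Wp.
  - by move=> u _; exact: param_continuous.
exists x; split => //; last by rewrite iE.
split => //; first by apply/(morphism_onP sR2 sP _ oi) => u _; exact: param_smooth.
move=> p [Wp Np]; exists W, h; split => //.
by apply/(morphism_onP sP sR2 _ oW).
Qed.

Lemma pullback_cover p : exists2 x, AS x & cdom x p.
Proof.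
have [u <-] := param_surj p; have [x [Ax qx xu]] := pullback_local_charts u.
by exists x => //; exact: (section_cdom qx xu).1.
Qed.

Let sS : smooth_atlas AS.
Proof.
exact (@submanifold_smooth_atlas _ _ _ _ (findim_prod _ _) _ _ sP pullback_cover).
Qed.

(** A lift over [0, L] is the restriction of a rotation of [eta], and rotations
    commute, so the angle does not depend on the lift. *)
Lemma holonomy_lift alpha : is_holonomy_angle AP prj act phi L c alpha ->
  eta L = act (eta 0) (expi alpha).
Proof.
move=> [eta' [s' p' h'] aE].
have se t : msmooth_at (@model_atlas _ R) AP eta' t.
  by exact: ((morphism_onP sR sP _ openT).1 s' t I).
have [_ _ cov _] := sP.
have d' t : 0 <= t <= L -> phi_dot sP phi eta' t = 0.
  move=> tL; have [x Ax xp] := cov (eta' t).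
  by rewrite -(phi_dotE sP hphi (se t) Ax xp); exact: h'.
have [r rE] : exists r, eta' 0 = act (eta 0) (expi r).
  by apply: (act_transitive sM sP hprj); rewrite peta p' // lexx ltW.
pose eta1 t := act (eta t) (expi r).
have l1 t : hlift sP prj phi c eta1 t := hlift_act hprj hphi r (heta t).
have : eta' L = eta1 L.
  apply: (@horizontal_unique _ _ _ _ _ _ _ sM sP _ _ hprj _ hphi 0 L eta' eta1
    _ _ 0 L) => //; rewrite ?in_itv /= ?lexx ?ltW //.
    by move=> t; rewrite in_itv /= => tL; have [s1 p1 _] := l1 t; rewrite p1 p'.
  move=> t /andP[]; rewrite !bnd_simp => t0 tL; have [_ _ d1] := l1 t.
  by split => //; apply: d'; rewrite !ltW.
rewrite aE rE (act_expiD hprj) /eta1 => /(congr1 (act^~ (expi (- r)))).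
rewrite !(act_expiD hprj) subrr (act_expi0 hprj) => <-.
by rewrite addrAC subrr add0r.
Qed.

Lemma holonomy_angle_exists :
  exists alpha, is_holonomy_angle AP prj act phi L c alpha.
Proof.
have [alpha aE] := holonomy_exists; exists alpha, eta => //; split => //.
  by apply/(morphism_onP sR sP _ openT) => t _; exact: seta.
move=> x t _ Ax xp; rewrite (phi_dotE sP hphi (seta t) Ax xp).
by have [] := heta t.
Qed.

(** ** The complex structure in terms of the parametrization *)

Definition pullback_J := quotient_J pullback_local_charts param_surj.
Local Notation J := pullback_J.

Local Notation model2 := (Chart setT id id : chart (R * R)%type (R * R)%type).

Let dparam (x : chart S (R * R)%type) (u v : R * R) : R * R :=
  dmap model2 x param u v.

Let sparam u : msmooth_at (@model_atlas _ (R * R)%type) AS param u.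
Proof. exact (local_charts_smooth sS pullback_local_charts u). Qed.

(** In a section of [param] the partial derivatives of [param] are constant. *)
Let dparam_section x u : AS x -> cdom x (param u) -> exists k,
  [/\ section_chart AS param (param u) k,
      forall v, dmap x k id (param u) (dparam x u v) = v
    & forall v, dmap k x id (param u) v = dparam x u v].
Proof.
move=> Ax xp; have [k [Ak qk ku]] := pullback_local_charts u.
have [kp kpu] := section_cdom qk ku.
have dk v : dparam k u v = v.
  rewrite /dparam /dmap -[RHS](derive_id u v); apply: near_eq_derive.
  have [[_ oi _ _ _] _] := qk.
  have : nbhs u (cim k) by exact: open_nbhs_nbhs.
  by apply: filterS => w kw; have [] := section_cdom qk kw.
have sid : msmooth_at AS AS id (param u) by exact: msmooth_at_id.
have dxk y z v : AS y -> AS z -> cdom y (param u) -> cdom z (param u) ->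
    dmap y z id (param u) (dparam y u v) = dparam z u v.
  move=> Ay Az yp zp; apply: esym.
  exact (@dmap_comp _ _ _ _ _ _ _ _ _ _ sR2 sS sS param id u model2 y z v
    erefl Ay Az I yp zp (sparam u) sid).
exists k; split; first by split.
  by move=> v; exact: (etrans (dxk x k v Ax Ak xp kp) (dk v)).
by move=> v; rewrite -(dxk k x v Ak Ax kp xp) dk.
Qed.

Let dparam_surj x u w : AS x -> cdom x (param u) -> exists v, w = dparam x u v.
Proof.
move=> Ax xp; have [k [[Ak qk kp] _ dk]] := dparam_section Ax xp.
exists (dmap x k id (param u) w); rewrite -dk (dmap_trans sS) //.
by rewrite (dmap_idE sS).
Qed.

Let J_dparam x u v : AS x -> cdom x (param u) ->
  J x (param u) (dparam x u v) = dparam x u (rot90 v).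
Proof.
move=> Ax xp; have [k [sk dk1 dk2]] := dparam_section Ax xp.
have [alpha aE] := holonomy_exists.
rewrite /J (quotient_JE sS pullback_local_charts
  (fun u v => param_eq u v aE) param_surj (dparam x u v) Ax xp sk).
by rewrite dk1 dk2.
Qed.

Let dparam_val x u y v : AS x -> cdom x (param u) -> AP y ->
  cdom y (set_val (param u)) ->
  dmap x y set_val (param u) (dparam x u v) = 'D_v (cmap y \o sweep act eta) u.
Proof.
move=> Ax xp Ay yp; apply: esym.
exact (@dmap_comp _ _ _ _ _ _ _ _ _ _ sR2 sS sP param set_val u model2 x y v
  erefl Ax Ay I xp yp (sparam u) (set_val_smooth sP pullback_cover _)).
Qed.

Let dparam_prj x u y v : AS x -> cdom x (param u) -> AM y -> cdom y (c u.2) ->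
  dmap x y (prj \o set_val) (param u) (dparam x u v) = v.2 *: velocity y c u.2.
Proof.
move=> Ax xp Ay yp; have sc := jordan_smooth sM hc u.2.
have sp : msmooth_at AS AM (prj \o set_val) (param u).
  exact (msmooth_at_comp sS sP sM (set_val_smooth sP pullback_cover (param u))
    (prj_smooth sM sP hprj _)).
have yp' : cdom y ((prj \o set_val) (param u)) by rewrite /= prj_param.
rewrite -(@dmap_comp _ _ _ _ _ _ _ _ _ _ sR2 sS sM param (prj \o set_val) u model2 x y v
  erefl Ax Ay I xp yp' (sparam u) sp).
have -> : (prj \o set_val) \o param = c \o snd by apply/funext => w; exact: prj_param.
have ss : smooth_at u (@snd R R) by exact: smooth_at_snd.
rewrite (@dmap_comp _ _ _ _ _ _ _ _ _ _ sR2 sR sM snd c u model2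
  (Chart setT id id : chart R R) y v
  erefl erefl Ay I I yp ((msmooth_at_model _ _).2 ss) sc).
have -> : dmap model2 (Chart setT id id : chart R R) snd u v = v.2.
  have cs : continuous (@snd R R : {linear _ -> _}) by move=> w; exact: cvg_snd.
  by have [] := is_derive_lin cs (is_derive_id u v).
rewrite velocityE.
have fR : findim R by exact: findim_real.
have lin := @dmap_linear _ _ _ _ _ _ _ sR sM c u.2
  (Chart setT id id : chart R R) y sc erefl Ay I yp v.2 1 0.
have d0 : dmap (Chart setT id id : chart R R) y c u.2 0 = 0 by exact: derive0.
by rewrite d0 addr0 addr0 in lin; rewrite -lin; congr dmap; rewrite [_ *: _]mulr1.
Qed.

Let dparam_vertical x u y : AS x -> cdom x (param u) -> AP y ->
  cdom y (set_val (param u)) ->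
  dmap x y set_val (param u) (dparam x u (1, 0)) =
  velocity y (fun s => act (set_val (param u)) (expi s)) 0.
Proof.
by move=> Ax xp Ay yp; rewrite dparam_val // (sweep_derive1 sP hprj).
Qed.

Let dparam_horizontal x u y : AS x -> cdom x (param u) -> AP y ->
  cdom y (set_val (param u)) ->
  phi y (set_val (param u)) (dmap x y set_val (param u) (dparam x u (0, 1))) = 0.
Proof.
move=> Ax xp Ay yp; rewrite dparam_val //.
have [_ _ cov _] := sP; have [_ _ inv] := hphi.
have [z Az zp] := cov (eta u.2).
rewrite (sweep_derive2 sP hprj (seta u.2) Az Ay zp yp) [_ (param u)]/= inv //.
by rewrite (phi_dotE sP hphi (seta u.2) Az zp); have [] := heta u.2.
Qed.

Let dparam_linear x u : AS x -> cdom x (param u) -> linear (dparam x u).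
Proof. by move=> Ax xp; exact (dmap_linear sR2 sS (sparam u) erefl Ax I xp). Qed.

Let dparamN x u v : AS x -> cdom x (param u) -> dparam x u (- v) = - dparam x u v.
Proof.
move=> Ax xp; have d0 : dparam x u 0 = 0 by exact: derive0.
have := dparam_linear Ax xp (-1) v 0.
by rewrite d0 !addr0 !scaleN1r.
Qed.

Let dparam_basis x u v : AS x -> cdom x (param u) ->
  dparam x u v = v.1 *: dparam x u (1, 0) + v.2 *: dparam x u (0, 1).
Proof.
move=> Ax xp; apply: derive_linear_basis; have [fF _ _ _] := sP.
exact (msmooth_at_chart sR2 sS (sparam u) (x := model2) erefl Ax I xp).
Qed.

Lemma pullback_J_induced :
 is_induced_structure AM AP act phi J.
Proof.
move=> x p t Ax xp pt; have [u up ut] := param_over pt.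
rewrite -up -ut in xp *.
have rot1 : rot90 (1, 0) = (0, 1) :> R * R by rewrite /rot90 oppr0.
exists (dparam x u (1, 0)), (dparam x u (0, 1)); split.
- by move=> y Ay yp; exact: dparam_vertical.
- by move=> y Ay yp; rewrite dparam_prj // scale1r.
- by move=> y Ay yp; exact: dparam_horizontal.
- exact (etrans (J_dparam (1, 0) Ax xp) (congr1 (dparam x u) rot1)).
- have rot2 : rot90 (0, 1) = - (1, 0) :> R * R by rewrite -rot1 rot90K.
  apply: (etrans (J_dparam (0, 1) Ax xp)); rewrite rot2.
  exact (dparamN (1, 0) Ax xp).
Qed.

(** The vector v is determined by its image in [P].  The vector h is a combination
    of the partial derivatives of [param]: the projection to [M] fixes the
    coefficient of the second one, as [c] is an immersion, and [phi] that of the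
    first. *)
Lemma induced_unique J' : is_almost_complex AS J' ->
  is_induced_structure AM AP act phi J' ->
  forall x p v, AS x -> cdom x p -> J' x p v = J x p v.
Proof.
move=> [linJ' _ _ _] indJ' x p w Ax; have [u <-] := param_surj p => xp.
have [v' [h' [v'E h'E phi_h' Jv Jh]]] := indJ' x (param u) u.2 Ax xp (prj_param u).
have [_ _ covP _] := sP; have [y Ay yp] := covP (set_val (param u)).
have [_ _ covM _] := sM; have [z Az zp] := covM (c u.2).
have [form vert _] := hphi; have [linphi _ _] := form.
have sw : smooth_at u (cmap y \o sweep act eta).
  exact: (sweep_chart sP hprj (seta u.2)).
have E1 : v' = dparam x u (1, 0).
  apply: (set_val_immersion sP pullback_cover Ax Ay xp yp).
  exact (etrans (v'E y Ay yp) (esym (dparam_vertical Ax xp Ay yp))).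
have E2 : h' = dparam x u (0, 1).
  have [e eE] := dparam_surj h' Ax xp.
  have e2 : e.2 = 1.
    have := h'E z Az zp; rewrite eE dparam_prj // => /eqP.
    rewrite -subr_eq0 -[X in _ - X]scale1r -scalerBl scaler_eq0.
    by rewrite (negbTE (jordan_immersion hg hc1 Az zp)) orbF subr_eq0 => /eqP.
  have e1 : e.1 = 0.
    have h'1 : h' = e.1 *: dparam x u (1, 0) + dparam x u (0, 1).
      by rewrite (etrans eE (dparam_basis e Ax xp)) e2 scale1r.
    have gen (D : R * R -> F) (a b : R * R) : linear D -> h' = e.1 *: a + b ->
        phi y (set_val (param u)) (D a) = 1 -> phi y (set_val (param u)) (D b) = 0 ->
        phi y (set_val (param u)) (D h') = e.1.
      move=> linD -> Da Db.
      by rewrite linD (linphi _ _ _ _ _ Ay yp) Da Db mulr1 addr0.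
    have linD : linear (dmap x y set_val (param u)).
      exact (dmap_linear sS sP (set_val_smooth sP pullback_cover (param u)) Ax Ay xp yp).
    have D1 : phi y (set_val (param u))
        (dmap x y set_val (param u) (dparam x u (1, 0))) = 1.
      by rewrite (dparam_vertical Ax xp Ay yp) (vert _ _ Ay yp).
    have D2 : phi y (set_val (param u))
        (dmap x y set_val (param u) (dparam x u (0, 1))) = 0.
      exact (dparam_horizontal Ax xp Ay yp).
    have E3 := gen (dmap x y set_val (param u)) (dparam x u (1, 0))
      (dparam x u (0, 1))
      linD h'1 D1 D2.
    exact (etrans (esym E3) (phi_h' y Ay yp)).

  have e01 : e = (0, 1) by rewrite [LHS]surjective_pairing e1 e2.
  exact (etrans eE (congr1 (dparam x u) e01)).
have [e eE] := dparam_surj w Ax xp.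
have J'0 : J' x (param u) 0 = 0.
  have := linJ' x (param u) 1 0 0 Ax xp; rewrite scaler0 addr0 scale1r => /eqP.
  by rewrite -subr_eq subrr eq_sym => /eqP.
have wE : w = e.1 *: v' + (e.2 *: h' + 0).
  by rewrite addr0 (etrans eE (dparam_basis e Ax xp)) -E1 -E2.
rewrite [in LHS]wE (linJ' _ _ _ _ _ Ax xp) (linJ' _ _ _ _ _ Ax xp) Jv Jh J'0 addr0.
apply: esym; rewrite eE (etrans (J_dparam e Ax xp) (dparam_basis (rot90 e) Ax xp)).
by rewrite -E1 -E2 /= scaleNr scalerN addrC.
Qed.

(** ** The quotient by the lattice *)

Let hausS : hausdorff_space S.
Proof. exact: subspace_hausdorff. Qed.

Let sctS : @second_countable S.
Proof. exact: subspace_second_countable. Qed.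

Lemma pullback_torus : is_torus AS.
Proof.
have [alpha aE] := holonomy_exists.
exact (parametrized_torus sS hausS sctS pullback_local_charts
  (fun u v => param_eq u v aE) param_surj L0 erefl erefl).
Qed.

Lemma pullback_J_complex : is_complex_structure AS J.
Proof.
have [alpha aE] := holonomy_exists.
exact (quotient_J_complex sS hausS sctS pullback_local_charts
  (fun u v => param_eq u v aE) param_surj).
Qed.

Lemma pullback_uniformization alpha :
  is_holonomy_angle AP prj act phi L c alpha ->
  isomorphic (@holomorphic_on R) (holo_atlas AS J)
    (@C_mod_atlas R ((2 * pi)%:C) ((- alpha) +i* L)).
Proof.
move=> /holonomy_lift aE.
exact (parametrized_uniformization sS hausS sctS pullback_local_charts
  (fun u v => param_eq u v aE) param_surj).
Qed.

End Pullback.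

Theorem lemma1 (R : realType) (n : nat) (M P : topologicalType)
  (AM : set (chart M 'rV[R]_n)) (AP : set (chart P 'rV[R]_n.+1))
  (hM : is_manifold (@smooth_on _ _ _) AM)
  (hP : is_manifold (@smooth_on _ _ _) AP)
  (g : chart M 'rV[R]_n -> M -> 'rV[R]_n -> 'rV[R]_n -> R)
  (hg : is_riemannian_metric AM g)
  (prj : P -> M) (act : P -> S1 R -> P)
  (hprj : is_principal_S1_bundle AM AP prj act)
  (phi : chart P 'rV[R]_n.+1 -> P -> 'rV[R]_n.+1 -> R)
  (hphi : is_connection AP act phi)
  (L : R) (c : R -> M)
  (hc : is_smooth_jordan_curve AM L c)
  (hc1 : is_unit_speed AM g c) :
  is_torus (pullback_atlas AP prj L c) /\
  exists J : chart (pullback_space prj L c) (R * R)%type ->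
             pullback_space prj L c -> R * R -> R * R,
    [/\ is_complex_structure (pullback_atlas AP prj L c) J,
        is_induced_structure AM AP act phi J,
        forall J', is_complex_structure (pullback_atlas AP prj L c) J' ->
          is_induced_structure AM AP act phi J' ->
          forall x p v, pullback_atlas AP prj L c x -> cdom x p ->
            J' x p v = J x p v,
        exists alpha, is_holonomy_angle AP prj act phi L c alpha
      & forall alpha, is_holonomy_angle AP prj act phi L c alpha ->
          isomorphic (@holomorphic_on R)
            (holo_atlas (pullback_atlas AP prj L c) J)
            (@C_mod_atlas R ((2 * pi)%:C) ((- alpha) +i* L))].
Proof.
have sM : smooth_atlas AM by exact (manifold_smooth_atlas hM).
have sP : smooth_atlas AP by exact (manifold_smooth_atlas hP).
have [hausM _ _ _ _] := hM; have [hausP sctP _ _ _] := hP.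
have [eta heta] := global_lift sM sP hprj hphi (jordan_smooth sM hc).
split.
  exact (pullback_torus sM hausM hausP sctP hg hprj hphi hc hc1 heta).
exists (pullback_J sM hausM hg hprj hc hc1 heta); split.
- exact (pullback_J_complex sM hausM hausP sctP hg hprj hphi hc hc1 heta).
- exact (pullback_J_induced sM hausM hg hprj hphi hc hc1 heta).
- move=> J' [J'ac _] ind.
  exact (induced_unique sM hausM hg hprj hphi hc hc1 heta J'ac ind).
- exact (holonomy_angle_exists sM hprj hphi hc heta).
- move=> alpha; exact: pullback_uniformization.
Qed.
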